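(* Let $\omega_n$ be a uniform $n$-element sorting network. The scaled swap process $\eta$ satisfies $$\eta(\omega_n)\Longrightarrow \mathfrak{Leb}\times\mathfrak{semi}\qquad\text{as } n\to\infty.$$ Here $\Longrightarrow$ denotes convergence in distribution of random measures in the vague topology on Borel measures on $\mathbb R^2$, and the right side denotes the deterministic product measure.
   Context: Let $\mathcal S_n$ be the symmetric group of all permutations of $\{1,\ldots,n\}$, with composition $(\sigma\tau)(i)=\sigma(\tau(i))$. For $1\le s\le n-1$ let $\tau_s=(s\ \ s+1)\in\mathcal S_n$, and let $\rho=(n,n-1,\ldots,1)$ be the reverse permutation. Put $N=\binom n2$. An $n$-element sorting network is a sequence $\omega=(s_1,\ldots,s_N)$ of elements of $\{1,\dots,n-1\}$ such that $\tau_{s_1}\cdots\tau_{s_N}=\rho$; write $s_k=s_k(\omega)$. A uniform $n$-element sorting network is a uniformly distributed random element of the set of all $n$-element sorting networks. The scaled swap process of an $n$-element sorting network $\omega$ is the measure on $\mathbb R^2$ $$\eta=\eta(\omega):=\frac1N\sum_{k=1}^N\delta\Big(\frac kN,\ \frac{2s_k}{n}-1\Big),$$ where $\delta(x,y)$ is the point mass at $(x,y)$. The measures on $\mathbb R$ are $\mathfrak{semi}(dy):=\frac2\pi\sqrt{1-y^2}\,\mathbf 1_{y\in(-1,1)}\,dy$ and $\mathfrak{Leb}(dx):=\mathbf 1_{x\in[0,1]}\,dx$. *)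

(* Defs.v *)
From HB Require Import structures.
From mathcomp Require Import all_boot all_order all_algebra all_fingroup.
From mathcomp Require Import all_classical all_reals all_analysis.
From mathcomp Require Import measurable_realfun.

Set Implicit Arguments.
Unset Strict Implicit.
Unset Printing Implicit Defensive.

Import Order.TTheory GRing.Theory Num.Theory.
Import numFieldNormedType.Exports.

Local Open Scope classical_set_scope.
Local Open Scope ring_scope.

Section SortingNetworks.

Let ltn_loc n (s : 'I_n.-1) : (s < n)%N.
Proof. by case: n s => [|n] [] //= s /ltnW. Qed.

Let ltn_locS n (s : 'I_n.-1) : (s.+1 < n)%N.
Proof. by case: n s => [|n] []. Qed.

(* [1 .. n] is encoded as ['I_n], and the location s in [1 .. n-1] as the
   element s-1 of ['I_n.-1]. *)
Definition adj_transp n (s : 'I_n.-1) : 'S_n :=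
  tperm (Ordinal (ltn_loc s)) (Ordinal (ltn_locS s)).

Definition rev_perm n : 'S_n := perm (@rev_ord_inj n).

(* In ['S_n] the product [s * t] means "first s, then t", which is opposite to
   the composition (st)(i) = s(t(i)); hence the [rev]. *)
Definition is_network n (w : 'C(n, 2).-tuple 'I_n.-1) : bool :=
  (\prod_(s <- rev w) adj_transp s)%g == rev_perm n.

Definition network n := {w : 'C(n, 2).-tuple 'I_n.-1 | is_network w}.

HB.instance Definition _ n := Finite.on (network n).

(* s_k, for 1 <= k <= N, as an element of [1 .. n-1] *)
Definition swap_loc n (w : network n) (k : nat) : nat :=
  nth 0%N [seq (val s).+1 | s <- val w] k.-1.

End SortingNetworks.

(* On the finite set of networks every subset is an event, so the singletons
   suffice for the measurability of [omega]. *)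
Definition uniform_network (R : realType) d (Om : measurableType d)
    (P : probability Om R) n (omega : Om -> network n) : Prop :=
  forall w : network n, measurable (omega @^-1` [set w]) /\
    P (omega @^-1` [set w]) = (#|{: network n}|%:R^-1)%:E.

Section VagueTopology.
Context (R : realType).

(* The locally finite Borel measures on the plane: the product sigma-algebra
   of [R * R] is its Borel sigma-algebra. *)
Record lfmeasure := LFMeasure {
  lfm :> {measure set (R * R) -> \bar R} ;
  lfm_finite : forall B : set (R * R),
    measurable B -> bounded_set B -> (lfm B < +oo)%E }.

HB.instance Definition _ := gen_eqMixin lfmeasure.
HB.instance Definition _ := gen_choiceMixin lfmeasure.

Definition Cc : set (R * R -> R) :=
  [set f | continuous f /\ compact (closure [set z | f z != 0])].

(* The vague topology is the coarsest one making [mu |-> \int f dmu] continuous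
   for every continuous, compactly supported f. *)
Definition vague_ev (mu : lfmeasure) : prod_topology (fun _ : Cc => R) :=
  fun f => \int[mu]_z (val f z).

HB.instance Definition _ :=
  Topological.copy lfmeasure (initial_topology vague_ev).

End VagueTopology.

(* The random elements [X n] and the limit [Y] may live on different
   probability spaces. *)
Definition cvg_in_distribution (R : realType) (T : topologicalType)
    (d : nat -> measure_display) (Om : forall n, measurableType (d n))
    (P : forall n, probability (Om n) R) (X : forall n, Om n -> T)
    d' (Om' : measurableType d') (P' : probability Om' R) (Y : Om' -> T) :=
  forall F : T -> R, continuous F -> bounded_fun F ->
    ('E_(P n)[F \o X n] @[n --> \oo] --> 'E_P'[F \o Y])%E.

Section Density.
Context (R : realType).

Definition density (f : R -> R) (A : set R) : \bar R :=
  (\int[@lebesgue_measure R]_(x in A) (f x)%:E)%E.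

Definition Leb : set R -> \bar R := density \1_(`[0, 1]).

Definition semi_pdf (y : R) : R :=
  2 / pi * Num.sqrt (1 - y ^+ 2) * \1_(`]-1, 1[) y.

Definition semi : set R -> \bar R := density semi_pdf.

Section MeasureDensity.
Variables (f : R -> R) (mf : measurable_fun setT f) (f0 : forall x, 0 <= f x).

Let density0 : density f set0 = 0%E.
Proof. by rewrite /density integral_set0. Qed.

Let density_ge0 A : (0 <= density f A)%E.
Proof. by apply: integral_ge0 => x _; rewrite lee_fin. Qed.

Let density_sigma_additive : semi_sigma_additive (density f).
Proof.
apply: (@semi_sigma_additive_nng_induced _ _ R
  (@lebesgue_measure R) (EFin \o f)) => [|x]; last by rewrite /= lee_fin.
exact/measurable_EFinP.
Qed.

Definition density_isMeasure :=
  isMeasure.Build _ _ _ (density f)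
    density0 density_ge0 density_sigma_additive.

Lemma density_fin_num_fun (M : R) (D : set R) : measurable D ->
  (@lebesgue_measure R D < +oo)%E -> (forall x, f x <= M * \1_D x) ->
  fin_num_fun (density f).
Proof.
move=> mD Dfin fM A mA; rewrite ge0_fin_numE ?density_ge0//.
apply: (@le_lt_trans _ _ (\int[@lebesgue_measure R]_x (f x)%:E)%E).
  apply: ge0_subset_integral => //; first exact/measurable_EFinP.
  by move=> x _; rewrite lee_fin.
apply: (@le_lt_trans _ _
  (\int[@lebesgue_measure R]_x (`|M| * \1_D x)%:E)%E).
  apply: ge0_le_integral => //=.
  - by move=> x _; rewrite lee_fin.
  - exact/measurable_EFinP.
  - by apply/measurable_EFinP; apply: measurable_funM.
  - move=> x _; rewrite lee_fin (le_trans (fM x))// ler_wpM2r//.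
    exact: ler_norm.
under eq_integral do rewrite EFinM.
rewrite ge0_integralZl//=; last exact/measurable_EFinP.
by rewrite integral_indic// setIT lte_mul_pinfty// lee_fin.
Qed.

End MeasureDensity.

Let mLeb : measurable_fun [set: R] (\1_(`[0, 1]) : R -> R).
Proof. by []. Qed.

Let Leb_ge0 (x : R) : 0 <= \1_(`[0, 1]) x :> R.
Proof. by []. Qed.

HB.instance Definition _ : isMeasure _ _ _ Leb :=
  density_isMeasure mLeb Leb_ge0.

Let Leb_fin : fin_num_fun Leb.
Proof.
apply: (@density_fin_num_fun _ mLeb Leb_ge0 1 `[0, 1]) => //.
- by rewrite lebesgue_measure_itv/= lte01 sube0 ltry.
- by move=> x; rewrite mul1r.
Qed.

HB.instance Definition _ := Measure_isFinite.Build _ _ _ Leb Leb_fin.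

Let msemi : measurable_fun setT semi_pdf.
Proof.
apply: measurable_funM => //; apply: measurable_funM => //.
apply: measurableT_comp.
  by apply: continuous_measurable_fun; exact: sqrt_continuous.
by apply: measurable_funB => //; exact: measurable_funX.
Qed.

Let semi_ge0 y : 0 <= semi_pdf y.
Proof. by rewrite !mulr_ge0 ?invr_ge0 ?pi_ge0 ?sqrtr_ge0. Qed.

HB.instance Definition _ : isMeasure _ _ _ semi :=
  density_isMeasure msemi semi_ge0.

Let semi_fin : fin_num_fun semi.
Proof.
apply: (@density_fin_num_fun _ msemi semi_ge0 (2 / pi) `]-1, 1[) => //.
- by rewrite lebesgue_measure_itv/=; case: ifPn => // _; rewrite -EFinB ltry.
- move=> y; rewrite /semi_pdf ler_wpM2r// ler_piMr//.
    by rewrite divr_ge0// pi_ge0.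
  by rewrite -[leRHS]sqrtr1 ler_wsqrtr// gerBl sqr_ge0.
Qed.

HB.instance Definition _ := Measure_isFinite.Build _ _ _ semi semi_fin.

Let Leb_semi_fin (B : set (R * R)) :
  measurable B -> bounded_set B -> ((Leb \x semi)%E B < +oo)%E.
Proof.
move=> mB _; apply: (@le_lt_trans _ _ ((Leb \x semi)%E setT)).
  by apply: le_measure; rewrite ?inE.
rewrite -setXTT product_measure1E//.
by rewrite lte_mul_pinfty// ?fin_num_measure// -ge0_fin_numE// fin_num_measure.
Qed.

Definition Leb_semi : lfmeasure R :=
  @LFMeasure R (Leb \x semi)%E Leb_semi_fin.

End Density.

Section SwapProcess.
Context (R : realType) (n : nat) (w : network n).
Let N := 'C(n, 2).

Definition swap_point (k : nat) : R * R :=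
  (k%:R / N%:R, 2 * (swap_loc w k)%:R / n%:R - 1).

(* [msum] is indexed from 0, whence [k.+1]. *)
Definition swap_process : set (R * R) -> \bar R :=
  mscale (N%:R^-1)%:nng (msum (fun k => \d_(swap_point k.+1)) N).

HB.instance Definition _ := Measure.on swap_process.

Let swap_process_fin (B : set (R * R)) :
  measurable B -> bounded_set B -> (swap_process B < +oo)%E.
Proof.
move=> _ _; rewrite /swap_process /mscale/= /msum lte_mul_pinfty ?lee_fin//.
by apply/lte_sum_pinfty => k _; rewrite /= diracE ltry.
Qed.

Definition eta : lfmeasure R := LFMeasure swap_process_fin.

End SwapProcess.

(* Main.v *)
(** On functions on the symmetric group put (u_i f)(v) = f(v s_i) if v has a
    descent at i, and 0 otherwise; then ((\sum_i u_i)^l f)(v), with f the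
    indicator of the identity, counts the reduced words of a permutation v of
    length l. By the nilCoxeter relations (Fomin-Stanley), the sums e_j and h_j
    of the decreasing and increasing products of j operators commute, so that
    the Jacobi-Trudi determinants in the h_j obey the Pieri rule for the e_j.
    Let I be a set of pairwise far apart locations. For v = w_0 \prod_{i in I} s_i
    the code and cocode of v let a single shape contribute, whence, as in the
    hook length formula, v has c_I l(v)! Delta(l) / \prod_i l_i! reduced words,
    with c_I a positive integer and c_I = 1 for I empty. Comparing with w_0, a
    uniform network starts with the pairwise far apart swaps i_1, ..., i_m with
    probability at least \prod_t p(i_t), for an explicit p summing to 1 that is
    asymptotically semicircular. Adjacent or repeated swaps among the first m
    have p-probability O(m^2 / n), so these m swaps are close in total variation
    to independent draws from p. The shift
    (s_1, ..., s_N) |-> (s_2, ..., s_N, n - s_1) preserves the uniform measure;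
    hence the same holds in every window of m swaps, the averages over windows
    concentrate, and \int f d eta tends to \int f d(Leb x semi) in L^1 for every
    continuous compactly supported f. *)
From HB Require Import structures.
Require Import Defs.
From mathcomp Require Import all_boot all_order all_algebra all_fingroup.
From mathcomp Require Import zify ring lra.
From mathcomp Require Import boolp.

Set Implicit Arguments.
Unset Strict Implicit.
Unset Printing Implicit Defensive.

Import Order.TTheory GRing.Theory Num.Theory.

Local Open Scope ring_scope.

(** * NilCoxeter relations *)

(** Lower bounds control the whole law of a prefix. The bounds for separated words have total mass
    close to 1, so they leave little mass for any excess and for the other words. Hence it is enough
    to know that the multiplicity of the surviving shape is a positive integer, and this follows
    from the existence of a reduced word.

    The bound is multiplicative because of the Vandermonde product: lowering two of its arguments
    together keeps their difference, while the two separate effects multiply to (1 - z)(1 + z) <= 1,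
    with z the inverse of the difference. For w_0 the arguments are 2p, 2p - 2, ..., 0, where n = p
    + 1; this spacing by 2 is the origin of the Wallis products in the law of a swap. Their
    asymptotic constant is fixed by total mass: the law of a swap and the semicircle law both sum to
    1 and are close to multiples of one profile.

    Windows may depend on each other. What is summed over them is the mean absolute deviation in
    each, and the window length is fixed before n grows. *)

Section NilCoxeter.
Variables (K : comNzRingType) (R : algType K) (u : nat -> R).
Hypothesis u_nil : forall i, u i * u i = 0.
Hypothesis u_far : forall i j, (i.+1 < j)%N -> u i * u j = u j * u i.
Hypothesis u_braid : forall i, u i * u i.+1 * u i = u i.+1 * u i * u i.+1.

(** The exponential of [x *: u i], as [u i] squares to 0; hence the parameters add in [nil_facD]. *)
Definition nil_fac (i : nat) (x : K) : R := 1 + x *: u i.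

Fixpoint desc_prod (m : nat) (x : K) : R :=
  if m is k.+1 then nil_fac k x * desc_prod k x else 1.

Lemma nil_facD i x y : nil_fac i x * nil_fac i y = nil_fac i (x + y).
Proof.
rewrite /nil_fac mulrDl mul1r mulrDr mulr1 -scalerAl -scalerAr u_nil !scaler0.
by rewrite addr0 -addrA -scalerDl addrC [y + x]addrC [RHS]addrC.
Qed.

Lemma nil_fac0 i : nil_fac i 0 = 1.
Proof. by rewrite /nil_fac scale0r addr0. Qed.

Lemma nil_fac_far i j x y : (i.+1 < j)%N ->
  nil_fac i x * nil_fac j y = nil_fac j y * nil_fac i x.
Proof.
move=> ij; rewrite /nil_fac !mulrDl !mulrDr !mul1r !mulr1 -!scalerAl -!scalerAr.
by rewrite (u_far ij) !scalerA [y * x]mulrC -!addrA; congr (_ + _); rewrite addrCA.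
Qed.

(** Squares vanish, so both sides stop at degree 3. The linear and quadratic terms agree because the
    middle parameter is the sum of the outer ones, and the cubic terms agree by the braid
    relation. *)
Lemma yang_baxter i x y :
  nil_fac i x * nil_fac i.+1 (x + y) * nil_fac i y =
  nil_fac i.+1 y * nil_fac i (x + y) * nil_fac i.+1 x.
Proof.
have expand (a b : R) (s t r : K) : a * a = 0 ->
    (1 + s *: a) * (1 + r *: b) * (1 + t *: a) =
    (1 + (s + t) *: a + r *: b) + ((s * r) *: (a * b) + (r * t) *: (b * a)) +
    (s * r * t) *: (a * b * a).
  move=> aa; rewrite mulrDr mulr1 -scalerAr.
  have -> : (1 + s *: a) * (1 + r *: b) = 1 + s *: a + r *: b + (s * r) *: (a * b).
    rewrite mulrDl mul1r mulrDr mulr1 -!(scalerAl, scalerAr) scalerA.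
    by rewrite !addrA (ACl (1*3*2*4)).
  rewrite !mulrDl mul1r -!scalerAl aa scaler0 addr0 !scalerDr !scalerA.
  rewrite scalerDl [t * r]mulrC [t * (s * r)]mulrC.
  by rewrite !addrA (ACl (1*2*5*3*4*6*7)).
rewrite !expand //; first congr (_ + _ + _).
- by rewrite [y + x]addrC addrAC.
- by rewrite [LHS]addrC [y * _]mulrC [_ * x]mulrC.
- by rewrite u_braid; congr (_ *: _); rewrite [RHS]mulrC [y * _]mulrC mulrA.
Qed.

Lemma desc_prod_far m j x y : (m < j)%N ->
  desc_prod m x * nil_fac j y = nil_fac j y * desc_prod m x.
Proof.
elim: m => [|m IH] mj /=; first by rewrite mul1r mulr1.
by rewrite -mulrA IH ?(ltnW mj)// mulrA nil_fac_far// -mulrA.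
Qed.

(** Each product splits as [a x * (b x * A x)] with its two top factors in front. By induction the
    lower products commute; [key] uses this to move [A x] to the right at the price of a factor
    [b (y - x)], which is the third factor that the Yang-Baxter relation requires. *)
Lemma desc_prod_comm m x y :
  desc_prod m x * desc_prod m y = desc_prod m y * desc_prod m x.
Proof.
have [k] := ubnP m; elim: k m x y => // k IH [|[|m]] x y //= mk.
  by rewrite !mulr1 !nil_facD addrC.
set A := desc_prod m; set a := nil_fac m.+1; set b := nil_fac m.
have far z t : A z * a t = a t * A z by apply: desc_prod_far.
have IH' z t : b z * A z * (b t * A t) = b t * A t * (b z * A z) by exact: (IH m.+1 z t mk).
have key z t : A z * (b t * A t) = b (t - z) * (A t * (b z * A z)).
  have {1}-> : A z = b (- z) * (b z * A z).
    by rewrite mulrA nil_facD addNr nil_fac0 mul1r.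
  by rewrite -mulrA IH' !mulrA nil_facD [- z + t]addrC.
have -> : a x * (b x * A x) * (a y * (b y * A y)) =
    a x * (b x * a y * b (y - x)) * (A y * (b x * A x)).
  by rewrite -!mulrA -key; congr (_ * (_ * _)); rewrite mulrA far -mulrA.
have := yang_baxter m x (y - x); rewrite addrC subrK => ->.
rewrite !mulrA nil_facD addrC subrK -!mulrA; congr (_ * (_ * _)).
by rewrite mulrA -far -mulrA.
Qed.

Fixpoint desc_sum (m j : nat) : R :=
  if m is k.+1 then
    desc_sum k j + (if j is i.+1 then u k * desc_sum k i else 0)
  else (j == 0)%:R.

Fixpoint asc_sum (m j : nat) : R :=
  if m is k.+1 then
    asc_sum k j + (if j is i.+1 then asc_sum k i * u k else 0)
  else (j == 0)%:R.

Lemma desc_sum0 m : desc_sum m 0 = 1.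
Proof. by elim: m => //= m ->; rewrite addr0. Qed.

Lemma asc_sum0 m : asc_sum m 0 = 1.
Proof. by elim: m => //= m ->; rewrite addr0. Qed.

Lemma desc_sum_gt m j : (m < j)%N -> desc_sum m j = 0.
Proof.
elim: m j => [|m IH] [|j] //= mj.
by rewrite !IH ?mulr0 ?addr0// ltnW.
Qed.

Lemma asc_sum_gt m j : (m < j)%N -> asc_sum m j = 0.
Proof.
elim: m j => [|m IH] [|j] //= mj.
by rewrite !IH ?mul0r ?addr0// ltnW.
Qed.

Lemma desc_prodE m x : desc_prod m x = \sum_(j < m.+1) x ^+ j *: desc_sum m j.
Proof.
elim: m => [|m IH] /=.
  by rewrite big_ord_recl big_ord0 expr0 scale1r addr0.
transitivity (\sum_(j < m.+2) x ^+ j *: desc_sum m j +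
    \sum_(j < m.+1) x ^+ j.+1 *: (u m * desc_sum m j)).
  rewrite big_ord_recr /= desc_sum_gt// scaler0 addr0 -IH.
  rewrite /nil_fac mulrDl mul1r -scalerAl; congr (_ + _).
  rewrite IH mulr_sumr scaler_sumr; apply: eq_bigr => j _.
  by rewrite -scalerAr scalerA exprS.
rewrite [in RHS]big_ord_recl [in LHS]big_ord_recl /= addr0 -addrA; congr (_ + _).
by rewrite -big_split /=; apply: eq_bigr => j _; rewrite -scalerDr.
Qed.

(** The product of the 1 + u_i X in decreasing order, times that of the 1 - u_i X in increasing
    order, telescopes from the inside, since (1 + u_i X)(1 - u_i X) = 1. The variable is central
    although the coefficients do not commute. *)
Lemma desc_asc_conv m k : (0 < k)%N ->
  \sum_(i < k.+1) desc_sum m i * ((-1) ^+ (k - i) * asc_sum m (k - i)) = 0.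
Proof.
move=> k_gt0.
pose D := fix D m : {poly R} := if m is k.+1 then (1 + (u k)%:P * 'X) * D k else 1.
pose A := fix A m : {poly R} := if m is k.+1 then A k * (1 - (u k)%:P * 'X) else 1.
have DA : D m * A m = 1.
  elim: m => [|m IH] /=; first by rewrite mulr1.
  have uX2 : (u m)%:P * 'X * ((u m)%:P * 'X) = 0.
    rewrite -mulrA [X in _ * X]mulrA -[X in _ * (X * _)]commr_polyX !mulrA -polyCM.
    by rewrite u_nil !mul0r.
  by rewrite mulrA -[_ * D m * A m]mulrA IH mulr1 mulrDl mul1r mulrBr mulr1 uX2 subr0 subrK.
have DE j : (D m)`_j = desc_sum m j.
  elim: m j {DA} => [|m IH] j /=; first by rewrite coef1.
  rewrite mulrDl mul1r coefD IH; congr (_ + _).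
  by rewrite -mulrA coefCM coefXM; case: j => [|j] /=; rewrite ?mulr0// IH.
have AE j : (A m)`_j = (-1) ^+ j * asc_sum m j.
  elim: m j {DA DE} => [|m IH] j /=.
    by rewrite coef1; case: j => [|j]; rewrite /= ?mulr0// expr0 mulr1.
  rewrite mulrBr mulr1 coefB IH mulrDr; congr (_ + _).
  rewrite mulrA coefMX; case: j => [|j] /=; rewrite ?oppr0 ?mulr0// coefMC IH.
  by rewrite exprS mulN1r mulNr mulrA.
have := congr1 (fun p : {poly R} => p`_k) DA; rewrite coefM coef1 gtn_eqF//= => E.
by rewrite -[RHS]E; apply: eq_bigr => i _; rewrite DE AE.
Qed.

Lemma desc_sum1 m : desc_sum m 1 = \sum_(i < m) u i.
Proof.
elim: m => [|m IH] /=; first by rewrite big_ord0.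
by rewrite big_ord_recr /= IH desc_sum0 mulr1.
Qed.

End NilCoxeter.

(* Over int, an identity between coefficients follows from evaluating at all
   integers, which an infinite domain allows. *)
Section Coefficients.
Variables (d1 d2 : nat).
Implicit Types a : nat -> 'M[int]_(d1, d2).

Lemma poly_coef_eq0 m a :
  (forall x : int, \sum_(j < m) x ^+ j *: a j = 0) -> forall j, (j < m)%N -> a j = 0.
Proof.
move=> a0 j jm; apply/matrixP => r c; rewrite mxE.
pose p := \poly_(k < m) a k r c.
have p0 : p = 0.
  apply/eqP; apply: contraT => p_neq0.
  have := @max_poly_roots _ p [seq k%:Z | k <- iota 0 (size p)] p_neq0.
  rewrite size_map size_iota ltnn => H; apply: H; last first.
    by rewrite map_inj_uniq ?iota_uniq// => x y [].
  apply/allP => _ /mapP [k _ ->]; apply/rootP.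
  rewrite horner_poly; have /matrixP/(_ r c) := a0 k.
  rewrite summxE [RHS]mxE => E; rewrite -[RHS]E; apply: eq_bigr => i _.
  by rewrite mxE mulrC.
by have := coef_poly m (fun k => a k r c) j; rewrite -/p p0 coef0 jm.
Qed.
End Coefficients.

Section NilCoxeterMatrices.
Variables (d : nat) (u : nat -> 'M[int]_d.+1).
Hypothesis u_nil : forall i, u i * u i = 0.
Hypothesis u_far : forall i j, (i.+1 < j)%N -> u i * u j = u j * u i.
Hypothesis u_braid : forall i, u i * u i.+1 * u i = u i.+1 * u i * u i.+1.

Lemma desc_sum_comm m i j :
  desc_sum u m i * desc_sum u m j = desc_sum u m j * desc_sum u m i.
Proof.
have [im|/desc_sum_gt->] := leqP i m; last by rewrite mul0r mulr0.
have [jm|/desc_sum_gt->] := leqP j m; last by rewrite mul0r mulr0.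
apply/eqP; rewrite -subr_eq0; apply/eqP.
pose c k l := desc_sum u m k * desc_sum u m l - desc_sum u m l * desc_sum u m k.
rewrite -/(c i j); apply: (@poly_coef_eq0 _ _ m.+1 (c i)) => // y.
apply: (@poly_coef_eq0 _ _ m.+1 (fun k => \sum_(l < m.+1) y ^+ l *: c k l)) => // x.
have := desc_prod_comm u_nil u_far u_braid m x y.
move/eqP; rewrite -subr_eq0 => /eqP E; rewrite -[RHS]E !desc_prodE.
rewrite big_distrlr /= [X in _ - X]big_distrlr /= [X in _ - X]exchange_big /=.
rewrite -sumrB; apply: eq_bigr => k _; rewrite scaler_sumr -sumrB.
apply: eq_bigr => l _; rewrite !(scalerA, =^~ scalerAl, =^~ scalerAr) scalerBr.
by rewrite [_ ^+ l * _]mulrC.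
Qed.

End NilCoxeterMatrices.

(* Determinants need a commutative ring: the double commutant of a commuting
   family is one, and it contains the family. *)
Section DoubleCommutant.
Variables (R : nzRingType) (e : nat -> R).
Hypothesis e_comm : forall i j, e i * e j = e j * e i.

Definition centralizes (y : R) := forall i, y * e i = e i * y.

Definition dcomm : {pred R} := fun z => `[< forall y, centralizes y -> z * y = y * z >].

Lemma dcommP z : reflect (forall y, centralizes y -> z * y = y * z) (z \in dcomm).
Proof. exact: asboolP. Qed.

Lemma dcomm_gen i : e i \in dcomm.
Proof. by apply/dcommP => y ->. Qed.

Lemma dcomm_subring : subring_closed dcomm.
Proof.
split=> [|x y /dcommP xc /dcommP yc|x y /dcommP xc /dcommP yc]; apply/dcommP => z zc.
- by rewrite mul1r mulr1.
- by rewrite mulrBl mulrBr xc// yc.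
- by rewrite -mulrA yc// !mulrA xc.
Qed.

HB.instance Definition _ := GRing.isSubringClosed.Build R dcomm dcomm_subring.

Record dcomm_ring := DcommRing { dcomm_val : R; dcomm_valP : dcomm_val \in dcomm }.

HB.instance Definition _ := [isSub for dcomm_val].
HB.instance Definition _ := [Choice of dcomm_ring by <:].
HB.instance Definition _ := [SubChoice_isSubNzRing of dcomm_ring by <:].

Lemma dcomm_valB x y : dcomm_val (x - y) = dcomm_val x - dcomm_val y.
Proof. exact: (rmorphB val). Qed.

Lemma dcomm_valM x y : dcomm_val (x * y) = dcomm_val x * dcomm_val y.
Proof. exact: (rmorphM val). Qed.

Lemma dcomm_val1 : dcomm_val 1 = 1.
Proof. exact: (rmorph1 val). Qed.

Lemma dcomm_valN x : dcomm_val (- x) = - dcomm_val x.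
Proof. exact: (rmorphN val). Qed.

Lemma dcomm_valX x n : dcomm_val (x ^+ n) = dcomm_val x ^+ n.
Proof. exact: (rmorphXn val). Qed.

Lemma dcomm_val_sum I (r : seq I) P (F : I -> dcomm_ring) :
  dcomm_val (\sum_(i <- r | P i) F i) = \sum_(i <- r | P i) dcomm_val (F i).
Proof. exact: (rmorph_sum val). Qed.

Lemma dcomm_val_prod I (r : seq I) P (F : I -> dcomm_ring) :
  dcomm_val (\prod_(i <- r | P i) F i) = \prod_(i <- r | P i) dcomm_val (F i).
Proof. exact: (big_morph _ dcomm_valM dcomm_val1). Qed.

Lemma dcomm_mulC (x y : dcomm_ring) : x * y = y * x.
Proof.
apply: val_inj; rewrite !rmorphM /=; have /dcommP xc := dcomm_valP x.
have /dcommP yc := dcomm_valP y; apply: xc => i; apply: yc => j; exact: e_comm.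
Qed.
End DoubleCommutant.

(** * Jacobi-Trudi determinants *)

Lemma sum_negb n (T : 'I_n -> bool) : (\sum_i T i + \sum_i ~~ T i = n)%N.
Proof.
rewrite -big_split /= (eq_bigr (fun=> 1%N)); first by rewrite sum1_card card_ord.
by move=> i _; case: (T i).
Qed.

Section JacobiTrudi.
Variables (R : comNzRingType) (n : nat) (e hs : nat -> R).
Hypothesis e0 : e 0 = 1.
Hypothesis hs_rec : forall b,
  hs (b + n) = - \sum_(j < n) (-1) ^+ (n - j) * e (n - j) * hs (b + j).

(* With hs b = h_(b + 1 - n) and l_i = lambda_i + n - 1 - i, this is the
   Jacobi-Trudi determinant of the Schur function s_lambda. *)
Definition jt (l : 'I_n -> nat) : R := \det (\matrix_(j < n, i < n) hs (l i + j)).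

Lemma jtE l : jt l = \sum_(s : 'S_n) (-1) ^+ s * \prod_i hs (l i + s i).
Proof.
rewrite /jt -det_tr; apply: eq_bigr => s _.
by congr (_ * _); apply: eq_bigr => i _; rewrite !mxE.
Qed.

Lemma eq_jt l l' : l =1 l' -> jt l = jt l'.
Proof. by move=> ll'; congr (\det _); apply/matrixP => j i; rewrite !mxE ll'. Qed.

Lemma jt_eq0 l i i' : i != i' -> l i = l i' -> jt l = 0.
Proof.
move=> ii' lii'; rewrite /jt -det_tr; apply: (determinant_alternate ii') => j.
by rewrite !mxE lii'.
Qed.

(* Multiplication by the companion matrix C shifts all rows, and its
   characteristic polynomial P generates the e_j. *)
Let P : {poly R} := \poly_(j < n.+1) ((-1) ^+ (n - j) * e (n - j)).
Let C : 'M[R]_n :=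
  \matrix_(i < n, j < n) if i == n.-1 :> nat then - P`_j else (i.+1 == j :> nat)%:R.

Let char_poly_C : char_poly C = P.
Proof.
have n1 : P`_n = 1 by rewrite coef_poly ltnSn subnn expr0 mul1r e0.
have sP : size P = n.+1.
  by apply: size_poly_eq; rewrite subnn expr0 mul1r e0 oner_neq0.
have Pm : P \is monic by rewrite monicE lead_coefE sP n1.
have := companionmxK Pm; rewrite /companionmx; have -> : (size P).-1 = n by rewrite sP.
by [].
Qed.

Let C_shift (l : 'I_n -> nat) :
  C *m (\matrix_(j < n, i < n) hs (l i + j)) = \matrix_(j < n, i < n) hs (l i + j.+1).
Proof.
apply/matrixP => j i; rewrite !mxE; have [jn|jn] := eqVneq (j : nat) n.-1.
  have -> : j.+1 = n by move: (ltn_ord j) jn; lia.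
  rewrite hs_rec -sumrN; apply: eq_bigr => k _.
  rewrite !mxE jn eqxx mulNr; congr (- (_ * _)).
  by rewrite coef_poly ltnS ltnW.
have jn' : (j.+1 < n)%N by move: (ltn_ord j) jn; lia.
rewrite (bigD1 (Ordinal jn')) //= !mxE (negPf jn) eqxx mul1r big1 ?addr0// => k kj.
rewrite !mxE (negPf jn) [_ == _](_ : _ = false) ?mul0r//.
by apply/negbTE; apply: contra kj => /eqP kj; apply/eqP/val_inj.
Qed.

(** Comparison of the coefficients of X^(n - k) in det((X - C) M) = P det M. Column i of (X - C) M
    is X times column i of M minus its shift, so multilinearity sums over the set [T] of shifted
    columns. *)
Lemma jt_pieri k l : (k <= n)%N ->
  e k * jt l = \sum_(T : {ffun 'I_n -> bool} | (\sum_i T i)%N == k) jt (fun i => l i + T i)%N.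
Proof.
move=> kn; pose M := \matrix_(j < n, i < n) hs (l i + j).
have : \det (char_poly_mx C *m map_mx polyC M) = P * (jt l)%:P.
  by rewrite det_mulmx det_map_mx -/(char_poly C) char_poly_C.
have -> : char_poly_mx C *m map_mx polyC M =
    \matrix_(j, i) ('X * (hs (l i + j))%:P - (hs (l i + j.+1))%:P).
  rewrite /char_poly_mx mulmxBl -map_mxM /= /M C_shift.
  by rewrite mul_scalar_mx; apply/matrixP => j i; rewrite !mxE.
have -> : \det (\matrix_(j < n, i < n) ('X * (hs (l i + j))%:P - (hs (l i + j.+1))%:P)) =
  \sum_(T : {ffun 'I_n -> bool}) ((-1) ^+ (\sum_i T i) * jt (fun i => l i + T i)%N)%:P *
     'X ^+ (n - \sum_i T i).
  rewrite -det_tr /determinant.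
  transitivity (\sum_(s : 'S_n) \sum_(T : {ffun 'I_n -> bool})
     ((-1) ^+ (\sum_i T i) * ((-1) ^+ s * \prod_i hs (l i + T i + s i)))%:P *
       'X ^+ (n - \sum_i T i)).
    apply: eq_bigr => s _.
    rewrite (eq_bigr (fun i => \sum_(b : bool) (if b then - (hs (l i + true + s i))%:P
        else 'X * (hs (l i + false + s i))%:P))); last first.
      by move=> i _; rewrite big_bool /= !mxE addn0 addn1 addSnnS addrC.
    rewrite bigA_distr_bigA mulr_sumr; apply: eq_bigr => T _ /=.
    rewrite (eq_bigr (fun i => ((-1) ^+ T i * hs (l i + T i + s i))%:P * 'X ^+ ~~ T i)); last first.
      move=> i _; case: (T i) => /=; first by rewrite !expr1 expr0 mulr1 mulN1r polyCN.
      by rewrite expr0 mul1r expr1 mulrC.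
    rewrite big_split /= -[\prod_i _%:P]rmorph_prod /= big_split /= !prodrXr.
    rewrite [in RHS]mulrCA [in RHS]polyCM -[in RHS]mulrA.
    rewrite [X in _ = X * _](rmorph_sign (@polyC R)).
    congr (_ * (_ * 'X ^+ _)).
    by rewrite -[X in (X - _)%N](sum_negb T) addKn.
  rewrite exchange_big /=; apply: eq_bigr => T _; rewrite -mulr_suml; congr (_ * _).
  by rewrite -rmorph_sum -mulr_sumr jtE.
move=> /(congr1 (fun p : {poly R} => p`_(n - k))).
rewrite coefMC coef_poly ltnS leq_subr subKn// coef_sum.
rewrite (bigID (fun T : {ffun 'I_n -> bool} => \sum_i T i == k)%N) /= [X in _ + X]big1; last first.
  move=> T Tk; rewrite coefCM coefXn [_ == _](_ : _ = false) ?mulr0//.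
  have := leq_addr (\sum_i ~~ T i) (\sum_i T i); rewrite sum_negb.
  move: (\sum_i T i)%N Tk kn => a /eqP ? ? ?; apply/negbTE/eqP; lia.
rewrite addr0 => E; apply: (can_inj (signrMK k)); rewrite mulrA -E mulr_sumr.
apply: eq_bigr => T /eqP ->.
by rewrite coefCM coefXn eqxx mulr1.
Qed.
End JacobiTrudi.

(** * Partitions and the dominance order *)

Section Partitions.
Variable n : nat.
Implicit Types nu lam kap : 'I_n -> nat.

Definition partition_fun nu := forall i j : 'I_n, (i <= j)%N -> (nu j <= nu i)%N.

(** The sum of the first [j] parts of the conjugate partition, in a form that also applies to
    unsorted [nu], such as a code. *)
Definition col_min nu j := (\sum_i minn (nu i) j)%N.

Definition col_len nu t := (\sum_(i < n) (t < nu i))%N.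

Lemma sum_col_len nu j : (\sum_(t < j) col_len nu t)%N = col_min nu j.
Proof.
rewrite exchange_big; apply: eq_bigr => i _ /=.
elim: j => [|j IH]; first by rewrite big_ord0 minn0.
by rewrite big_ord_recr /= IH; lia.
Qed.

Lemma col_minS nu j : col_min nu j.+1 = (col_min nu j + col_len nu j)%N.
Proof. by rewrite -!sum_col_len big_ord_recr. Qed.

Lemma col_len_le nu t : (col_len nu t <= n)%N.
Proof. by rewrite -[leqRHS](sum_negb (fun i => t < nu i)%N) leq_addr. Qed.

Lemma sum_lt_ord m : (\sum_(i < n) (i < m))%N = minn m n.
Proof.
elim: n => [|k IH]; first by rewrite big_ord0 minn0.
by rewrite big_ord_recr /= IH; lia.
Qed.

Lemma col_lenP nu t (i : 'I_n) : partition_fun nu -> (t < nu i)%N = (i < col_len nu t)%N.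
Proof.
move=> nup; apply/idP/idP => ti.
  have : (\sum_(k < n) (k < i.+1) <= col_len nu t)%N.
    apply: leq_sum => k _; case: (ltnP k i.+1) => //= ki.
    by rewrite (leq_trans ti)// nup.
  by rewrite sum_lt_ord; have := ltn_ord i; lia.
rewrite ltnNge; apply: contraL ti => ti; rewrite -leqNgt.
have : (col_len nu t <= \sum_(k < n) (k < i))%N.
  apply: leq_sum => k _; case: (ltnP k i) => ki /=; first by case: (_ < _)%N.
  by rewrite leqn0 eqb0 -leqNgt (leq_trans _ ti)// nup.
by rewrite sum_lt_ord; have := ltn_ord i; lia.
Qed.

Lemma col_min_inj nu kap B : partition_fun nu -> partition_fun kap ->
  (forall i, nu i <= B)%N -> (forall i, kap i <= B)%N ->
  (forall j, (j <= B)%N -> col_min nu j = col_min kap j) -> nu =1 kap.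
Proof.
move=> nup kapp nuB kapB E i.
have lt t : (t < B)%N -> (t < nu i)%N = (t < kap i)%N.
  move=> tB; rewrite !col_lenP//; congr (_ < _)%N.
  by have := E t.+1 tB; rewrite !col_minS E 1?ltnW// => /addnI.
apply/eqP; rewrite eqn_leq; apply/andP; split; rewrite leqNgt; apply/negP.
  by move=> H; have := lt _ (leq_trans H (nuB i)); rewrite H ltnn.
by move=> H; have := lt _ (leq_trans H (kapB i)); rewrite H ltnn.
Qed.

(** Conjugation reverses dominance: the row bounds force the column sums of [nu] to be at least
    those of [lam], and the column bounds say the opposite. *)
Lemma dominance_eq nu lam : partition_fun nu -> partition_fun lam ->
  (\sum_i nu i = \sum_i lam i)%N ->
  (forall j, \sum_(i < n | (i < j)%N) nu i <= \sum_(i < n | (i < j)%N) lam i)%N ->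
  (forall j, col_min nu j <= col_min lam j)%N -> nu =1 lam.
Proof.
move=> nup lamp E rows cols.
have bound (k : 'I_n -> nat) i : (k i <= \sum_i k i)%N by rewrite (bigD1 i)//= leq_addr.
apply: (@col_min_inj _ _ (\sum_i nu i)) => // [i|j _]; first by rewrite E.
apply/eqP; rewrite eqn_leq cols/=.
have excess (k : 'I_n -> nat) : (\sum_i (k i - j) + col_min k j = \sum_i k i)%N.
  by rewrite -big_split; apply: eq_bigr => i _; rewrite /=; lia.
have : (\sum_i (nu i - j) <= \sum_i (lam i - j))%N.
  (* The rows of [nu] longer than [j] are exactly the first [m], so the row bound for [m] compares
     the cells beyond column [j]. *)
  set m := col_len nu j.
  have -> : (\sum_i (nu i - j) = \sum_(i < n | (i < m)%N) (nu i - j))%N.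
    rewrite [LHS](bigID (fun i : 'I_n => i < m)%N) /= addnC big1 // => i.
    by rewrite -col_lenP// -leqNgt -subn_eq0 => /eqP.
  apply: (@leq_trans (\sum_(i < n | (i < m)%N) (lam i - j))); last first.
    by rewrite [leqRHS](bigID (fun i : 'I_n => i < m)%N) /= leq_addr.
  rewrite -(leq_add2r (\sum_(i < n | (i < m)%N) j)) -!big_split /=.
  rewrite (eq_bigr nu); last by move=> i; rewrite -col_lenP// => /ltnW/subnK.
  by rewrite (leq_trans (rows m))//; apply: leq_sum => i _; lia.
by have := excess nu; have := excess lam; rewrite E; lia.
Qed.

Lemma sum_perm_ge (s : 'S_n) j :
  (\sum_(i < n | (i < j)%N) i <= \sum_(i < n | (i < j)%N) s i)%N.
Proof.
pose J := [set i : 'I_n | (i < j)%N]; pose A := [set s i | i in J].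
have cA : #|A| = #|J| by rewrite card_imset//; exact: perm_inj.
rewrite (eq_bigl (fun i => i \in J)); last by move=> i; rewrite inE.
rewrite [leqRHS](eq_bigl (fun i => i \in J)); last by move=> i; rewrite inE.
have -> : (\sum_(i in J) s i = \sum_(i in A) i)%N.
  by rewrite big_imset //= => x y _ _; exact: perm_inj.
rewrite (big_setID A) [leqRHS](big_setID J) /= setIC leq_add2l.
have : #|J :\: A| = #|A :\: J|.
  by apply: (@addnI #|J :&: A|); rewrite cardsID {1}setIC cardsID cA.
move=> cJA; apply: (@leq_trans (\sum_(i in J :\: A) j)%N).
  by apply: leq_sum => i; rewrite !inE => /andP [_ /ltnW].
rewrite sum_nat_const cJA -sum_nat_const; apply: leq_sum => i.
by rewrite !inE -leqNgt => /andP [].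
Qed.

End Partitions.

(* L stands for the coefficient of a permutation; L_h and L_e are what its code
   and cocode impose, and they leave only the shape lam. *)
Section Triangularity.
Variables (R : comNzRingType) (n : nat) (e h : nat -> R).
Let hs b := if (b.+1 < n)%N then 0 else h (b.+1 - n).
Hypothesis e0 : e 0 = 1.
Hypothesis hs_rec : forall b,
  hs (b + n) = - \sum_(j < n) (-1) ^+ (n - j) * e (n - j) * hs (b + j).
Variables (L : {additive R -> int}) (lam : 'I_n -> nat).
Hypothesis lam_part : partition_fun lam.
Hypothesis L_h : forall (j : nat) (b : 'I_n -> nat) Y,
  (\sum_(i < n | (i < j)%N) lam i < \sum_(i < n | (i < j)%N) b i)%N ->
  L ((\prod_(i < n | (i < j)%N) h (b i)) * Y) = 0.
Hypothesis L_e : forall (j : nat) (b : nat -> nat) Y,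
  (col_min lam j < \sum_(s < j) b s)%N -> L ((\prod_(s < j) e (b s)) * Y) = 0.

Definition schur (nu : 'I_n -> nat) : R := jt hs (fun i => nu i + (n - i.+1))%N.

Lemma eq_schur nu nu' : nu =1 nu' -> schur nu = schur nu'.
Proof. by move=> E; apply: eq_jt => i; rewrite E. Qed.

Lemma schurE nu : schur nu = \sum_(s : 'S_n) (-1) ^+ s *
  if [forall i : 'I_n, (i <= nu i + s i)%N] then \prod_i h (nu i + s i - i) else 0.
Proof.
rewrite /schur jtE; apply: eq_bigr => s _; congr (_ * _).
have hsE (i : 'I_n) : hs (nu i + (n - i.+1) + s i) =
    if (i <= nu i + s i)%N then h (nu i + s i - i) else 0.
  rewrite /hs; have i_n := ltn_ord i; case: (leqP i (nu i + s i)) => H1; case: ltnP => H2 //; try lia.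
  by congr (h _); lia.
case: forallP => [H|/forallP]; first by apply: eq_bigr => i _; rewrite hsE H.
by rewrite negb_forall => /existsP [i Hi]; rewrite (bigD1 i)//= hsE (negPf Hi) mul0r.
Qed.

(** In every Leibniz term the first [j] factors have total degree at least that of the first [j]
    rows of [nu], because distinct columns s_0, ..., s_(j-1) sum to at least 0 + ... + (j - 1). *)
Lemma schur_row_vanish nu j :
  (\sum_(i < n | (i < j)%N) lam i < \sum_(i < n | (i < j)%N) nu i)%N -> L (schur nu) = 0.
Proof.
move=> H; rewrite schurE raddf_sum big1// => s _.
case: ifPn => [/forallP Hs|_]; last by rewrite mulr0 raddf0.
rewrite mulrC (bigID (fun i : 'I_n => i < j)%N) /= -mulrA.
apply: L_h; apply: (leq_trans H).
rewrite -(leq_add2r (\sum_(i < n | (i < j)%N) i)) -[leqRHS]big_split /=.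
rewrite [leqRHS](eq_bigr (fun i => nu i + s i)%N); last by move=> i _; rewrite subnK.
by rewrite big_split leq_add2l sum_perm_ge.
Qed.

Lemma schur_pieri k nu : (k <= n)%N ->
  e k * schur nu = \sum_(T : {ffun 'I_n -> bool} | (\sum_i T i)%N == k) schur (fun i => nu i + T i)%N.
Proof.
move=> kn; rewrite /schur jt_pieri//; apply: eq_bigr => T _.
by apply: eq_jt => i; rewrite addnAC.
Qed.

Lemma schur_add_strip nu (T : 'I_n -> bool) : partition_fun nu ->
  schur (fun i => nu i + T i)%N = 0 \/ partition_fun (fun i => nu i + T i)%N.
Proof.
move=> nup; have [H|] := boolP [forall i : 'I_n, forall j : 'I_n,
    (i <= j)%N ==> (nu j + T j <= nu i + T i)%N].
  by right=> i j ij; have /forallP/(_ i)/forallP/(_ j)/implyP := H; apply.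
rewrite negb_forall => /existsP [i]; rewrite negb_forall => /existsP [j].
rewrite negb_imply => /andP [ij Tij]; left.
(* k.+1 is the first row below i whose length, once increased, exceeds that of
   its predecessor: the determinant then has two equal rows. *)
have [k ik /andP [Tk Tk1]] : exists2 k : 'I_n, (i <= k)%N &
    ~~ T k && [exists k' : 'I_n, [&& k' == k.+1 :> nat, T k' & nu k' == nu k]].
  have inu := nup _ _ ij.
  have {Tij} [Ti Tj E] : [/\ ~~ T i, T j & nu j = nu i].
    by move: Tij inu; case: (T i) (T j) => [] []; rewrite /= => ? ?; split=> //; lia.
  have [m] := ubnP (j - i)%N; elim: m i ij inu Ti E => // m IH i ij inu Ti E jm.
  have ij' : (i < j)%N.
    by rewrite ltn_neqAle ij andbT; apply: contraNneq Ti => /val_inj ->.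
  have i1n : (i.+1 < n)%N := leq_ltn_trans ij' (ltn_ord j).
  pose i1 := Ordinal i1n.
  have E1 : nu i1 = nu i.
    by have := nup i i1 (leqnSn i); have := nup i1 j ij'; rewrite E; lia.
  have [Ti1|Ti1] := boolP (T i1).
    by exists i => //; rewrite Ti; apply/existsP; exists i1; rewrite Ti1 E1 !eqxx.
  have [k ik Hk] : exists2 k : 'I_n, (i1 <= k)%N &
      ~~ T k && [exists k' : 'I_n, [&& k' == k.+1 :> nat, T k' & nu k' == nu k]].
    by apply: IH => //; rewrite ?E1 ?E//= -?E//; move: jm ij'; rewrite /=; lia.
  by exists k => //; rewrite (leq_trans _ ik)/=.
case/existsP: Tk1 => k' /and3P [/eqP k'k Tk' /eqP E].
apply: (@jt_eq0 _ _ _ _ k k').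
  by apply: contra_eqN k'k => /eqP <-; rewrite neq_ltn ltnSn.
by rewrite E k'k Tk' (negPf Tk); have := ltn_ord k'; rewrite k'k; lia.
Qed.

Let pot B (nu : 'I_n -> nat) := (\sum_(j < B) col_min nu j)%N.

(** Descending induction on the column sums. By the Pieri rule the product of the [e (b t)] over the
    columns of [nu] expands into [schur nu], with positive multiplicity, and into shapes with larger
    column sums; these exceed [lam] at [j0] as well and vanish by induction. The product itself is
    killed by [L_e], and the integers have no torsion. *)
Lemma schur_col_vanish nu j0 Y : partition_fun nu ->
  (col_min lam j0 < col_min nu j0)%N -> L (schur nu * Y) = 0.
Proof.
move=> nup; have [r] : exists r, (\sum_i nu i = r)%N by eexists.
have [K] := ubnP (r.+1 * r - pot r.+1 nu)%N.
elim: K nu nup => // K IH nu nup potK nur j0nu.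
have nu_le i : (nu i <= r)%N by rewrite -nur (bigD1 i)//= leq_addr.
pose b := col_len nu.
have colb j : col_min nu j = (\sum_(t < j) b t)%N by rewrite -sum_col_len.
have sumb : (\sum_(t < r) b t = r)%N.
  by rewrite -colb -[RHS]nur; apply: eq_bigr => i _; apply/minn_idPl.
(* [kap] is a shape reached after [s] factors, and [d] factors remain. The multiplicity is positive
   along the path of the truncations of [nu] to its first [s] columns. *)
have key d s kap : (s + d = r)%N -> partition_fun kap -> (forall i, kap i <= s)%N ->
    (forall j, (j <= s)%N -> col_min nu j <= col_min kap j)%N ->
    (\sum_i kap i = \sum_(t < s) b t)%N ->
  exists2 m : nat, L ((\prod_(s <= t < r) e (b t)) * schur kap * Y) = L (schur nu * Y) *+ m &
    kap =1 (fun i => minn (nu i) s) -> (0 < m)%N.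
  elim: d s kap => [|d IHd] s kap sdr kapp kap_le kap_col kap_sum.
    move: sdr; rewrite addn0 => sr; rewrite sr in kap_le kap_col kap_sum *.
    rewrite big_geq// mul1r.
    have [E|NE] := boolP [forall i, kap i == nu i].
      by exists 1%N => //; rewrite (eq_schur (nu' := nu))// => i; apply/eqP/(forallP E).
    exists 0%N; last first.
      move=> E; case/negP: NE; apply/forallP => i; apply/eqP.
      by rewrite E; apply/minn_idPl.
    rewrite mulr0n; have kapr : (\sum_i kap i = r)%N by rewrite kap_sum.
    have col_ge j : (col_min nu j <= col_min kap j)%N.
      have [/kap_col//|rj] := leqP j r.
      rewrite /col_min (eq_bigr nu); last by move=> i _; apply/minn_idPl; rewrite (leq_trans (nu_le i))// ltnW.
      rewrite [leqRHS](eq_bigr kap); last by move=> i _; apply/minn_idPl; rewrite (leq_trans (kap_le i))// ltnW.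
      by rewrite nur kapr.
    apply: IH => //; last exact: leq_trans (col_ge j0).
    have pot_le k : (\sum_i k i = r)%N -> (pot r.+1 k <= r.+1 * r)%N.
      move=> kr; apply: (@leq_trans (\sum_(j < r.+1) r)); last by rewrite sum_nat_const card_ord.
      by apply: leq_sum => j _; rewrite -{2}kr leq_sum// => i _; rewrite geq_minl.
    have : (pot r.+1 nu < pot r.+1 kap)%N.
      rewrite ltn_neqAle leq_sum ?andbT; last by move=> j _; exact: col_ge.
      apply: contra NE => /eqP E; apply/forallP => i; apply/eqP.
      apply: (@col_min_inj _ kap nu r) => // j jr; apply/eqP; rewrite eqn_leq col_ge andbT leqNgt.
      apply/negP => lt; have := ltnn (pot r.+1 nu); rewrite {2}E => /negP; apply.
      have jr' : (j < r.+1)%N by [].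
      rewrite /pot (bigD1 (Ordinal jr'))//= [ltnRHS](bigD1 (Ordinal jr'))//= -addSn leq_add//.
      by apply: leq_sum => k _; exact: col_ge.
    by have := pot_le _ kapr; move: potK; lia.
  have sr : (s < r)%N by move: sdr; lia.
  pose strip (T : {ffun 'I_n -> bool}) := (\sum_i T i)%N == b s.
  pose add (T : {ffun 'I_n -> bool}) (i : 'I_n) := (kap i + T i)%N.
  pose good T m := strip T ->
      L ((\prod_(s.+1 <= t < r) e (b t)) * schur (add T) * Y) = L (schur nu * Y) *+ m /\
      (partition_fun (add T) -> add T =1 (fun i => minn (nu i) s.+1) -> (0 < m)%N).
  have /fin_all_exists [m mP] : forall T, exists m, good T m.
    move=> T; rewrite /good.
    case: (boolP (strip T)) => [/eqP sT|]; last by exists 0%N.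
    have [Tp|NTp] := pselect (partition_fun (add T)).
      have [||||m Em mP] := IHd s.+1 (add T) _ Tp.
      - by rewrite addSnnS.
      - by move=> i; rewrite /add -addn1 leq_add//; case: (T i).
      - move=> j; rewrite leq_eqVlt => /orP [/eqP ->|js].
          rewrite colb big_ord_recr /= -kap_sum -sT -big_split leq_sum//= => i _.
          by rewrite /add leq_min leqnn/=; have := kap_le i; case: (T i); lia.
        by rewrite (leq_trans (kap_col _ js))// leq_sum// => i _; rewrite /add; lia.
      - by rewrite big_split /= kap_sum sT big_ord_recr.
      by exists m.
    exists 0%N; have [E|//] := schur_add_strip T kapp.
    by rewrite /add E mulr0 mul0r raddf0.
  exists (\sum_(T | strip T) m T)%N; last first.
    move=> Ekap; pose T0 := [ffun i => (s < nu i)%N].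
    have addT0 : add T0 =1 (fun i => minn (nu i) s.+1).
      by move=> i; rewrite /add ffunE Ekap; lia.
    have sT0 : strip T0 by apply/eqP/eq_bigr => i _; rewrite ffunE.
    rewrite (bigD1 T0)//= ltn_addr//; have [_] := mP _ sT0; apply => //.
    by move=> i j ij; rewrite !addT0; have := nup i j ij; lia.
  rewrite big_ltn//.
  have -> : e (b s) * \prod_(s.+1 <= i < r) e (b i) * schur kap * Y =
    \sum_(T | strip T) (\prod_(s.+1 <= i < r) e (b i)) * schur (add T) * Y.
    by rewrite -mulr_suml -mulr_sumr -schur_pieri ?col_len_le// mulrCA !mulrA.
  rewrite raddf_sum -sumrMnr; apply: eq_bigr => T sT.
  by have [->] := mP T sT.
pose kap0 := fun _ : 'I_n => 0%N.
have [||||m Em mP] := key r 0 kap0 (add0n r).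
- by [].
- by [].
- by move=> j; rewrite leqn0 => /eqP ->; rewrite /col_min leq_sum// => i _; rewrite minn0.
- by rewrite big_ord0 big1.
have m_gt0 : (0 < m)%N by apply: mP => i; rewrite minn0.
(* The product has [r] factors. A [j0] beyond [r] may be replaced by [r], where the column sums of
   [nu] have already stopped growing. *)
have j0_le : exists2 j, (j <= r)%N & (col_min lam j < \sum_(t < j) b t)%N.
  have [j0r|rj0] := leqP j0 r; first by exists j0; rewrite // -colb.
  exists r => //; rewrite -colb.
  have -> : col_min nu r = col_min nu j0.
    by apply: eq_bigr => i _; have := nu_le i; lia.
  by apply: leq_ltn_trans j0nu; apply: leq_sum => i _; lia.
case: j0_le => j jr jlt.
have : L (schur nu * Y) *+ m = 0.
  rewrite -Em (big_cat_nat (n := j))//= -!mulrA big_mkord; exact: L_e.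
by move/eqP; rewrite mulrn_eq0 eqn0Ngt m_gt0 => /eqP.
Qed.

Theorem schur_triangular nu : partition_fun nu -> (\sum_i nu i = \sum_i lam i)%N ->
  nu =1 lam \/ L (schur nu) = 0.
Proof.
move=> nup E; have [L0|NL0] := eqVneq (L (schur nu)) 0; [by right|left].
apply: dominance_eq => // j; rewrite leqNgt; apply: contra_neqN NL0 => H.
  exact: schur_row_vanish H.
by rewrite -[schur nu]mulr1; exact: schur_col_vanish H.
Qed.

(* The Leibniz terms other than the diagonal one exceed a row bound. *)
Lemma schur_diag : L (schur lam) = L (\prod_i h (lam i)).
Proof.
rewrite schurE raddf_sum (bigD1 1%g)//= [X in _ + X]big1 ?addr0.
  rewrite odd_perm1 expr0 mul1r ifT; last by apply/forallP => i; rewrite perm1 leq_addl.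
  by congr (L _); apply: eq_bigr => i _; rewrite perm1 addnK.
move=> s s1; case: ifPn => [/forallP Hs|_]; last by rewrite mulr0 raddf0.
have [j Hj] : exists j, (\sum_(i < n | (i < j)%N) i < \sum_(i < n | (i < j)%N) s i)%N.
  apply: contrapT => /forallNP H; case/eqP: s1; apply/permP => k; rewrite perm1; apply/val_inj.
  have E j : (\sum_(i < n | (i < j)%N) s i = \sum_(i < n | (i < j)%N) i)%N.
    by apply/eqP; rewrite eqn_leq sum_perm_ge andbT leqNgt; apply/negP/H.
  have := E k.+1; rewrite (bigD1 k)//= [RHS](bigD1 k)//=.
  have lt (i : 'I_n) : (i < k.+1)%N && (i != k) = (i < k)%N.
    by rewrite ltnS ltn_neqAle andbC.
  by rewrite !(eq_bigl _ _ lt) E => /addIn.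
rewrite mulrC (bigID (fun i : 'I_n => i < j)%N) /= -mulrA; apply: L_h.
rewrite -(ltn_add2r (\sum_(i < n | (i < j)%N) i)) -[ltnRHS]big_split /=.
rewrite [ltnRHS](eq_bigr (fun i => lam i + s i)%N); last by move=> i _; rewrite subnK.
by rewrite big_split ltn_add2l.
Qed.
End Triangularity.

(** * Determinants and the number of paths between shapes *)

Section DetDerivation.
Variables (K : comNzRingType) (n : nat).

(** The Leibniz term of [s] is multiplied by the sum over [k] of x_(s^-1 k) - y_k, which is the same
    for all [s]. *)
Lemma sum_det_col (A : 'M[K]_n) (x y : 'I_n -> K) :
  \sum_k \det (\matrix_(i, j) ((if j == k then x i - y j else 1) * A i j)) =
  (\sum_i x i - \sum_i y i) * \det A.
Proof.
rewrite exchange_big mulr_sumr; apply: eq_bigr => s _ /=.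
rewrite -mulr_sumr mulrCA; congr (_ * _).
transitivity (\sum_k (x (s^-1 k)%g - y k) * \prod_i A i (s i)).
  apply: eq_bigr => k _; rewrite [in LHS](bigD1 (s^-1 k)%g)//= mxE permKV eqxx.
  rewrite [in RHS](bigD1 (s^-1 k)%g)//= permKV -mulrA; congr (_ * (_ * _)).
  apply: eq_bigr => i ik; rewrite mxE ifN ?mul1r//.
  by apply: contra ik => /eqP <-; rewrite permK.
rewrite -mulr_suml sumrB; congr ((_ - _) * _).
by rewrite (reindex_inj (@perm_inj _ s)); apply: eq_bigr => i _; rewrite permK.
Qed.

Lemma sum_det_row (A : 'M[K]_n) (x y : 'I_n -> K) :
  \sum_k \det (\matrix_(i, j) ((if i == k then x i - y j else 1) * A i j)) =
  (\sum_i x i - \sum_i y i) * \det A.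
Proof.
rewrite -[\det A]det_tr -[RHS]opprK -mulNr opprB -sum_det_col -sumrN.
apply: eq_bigr => k _; rewrite -det_tr.
pose D : 'M[K]_n := diag_mx (\row_j (if j == k then -1 else 1)).
have -> : \matrix_(i, j) ((if j == k then y i - x j else 1) * A^T i j) =
   (\matrix_(i, j) ((if i == k then x i - y j else 1) * A i j))^T *m D.
  by apply/matrixP => i j; rewrite mul_mx_diag !mxE; case: eqP => _; ring.
rewrite det_mulmx det_diag (bigD1 k)//= big1 ?mxE ?eqxx; first by rewrite mulr1 mulrN1 opprK.
by move=> i ik; rewrite mxE (negPf ik).
Qed.

Lemma det_poly_Vandermonde (p : nat -> {poly K}) (x : 'I_n -> K) :
  (forall j, p j \is monic) -> (forall j, size (p j) = j.+1) ->
  \det (\matrix_(i, j) (p j).[x i]) = \prod_(i < n) \prod_(j < n | (i < j)%N) (x j - x i).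
Proof.
move=> pm ps; have := det_Vandermonde (\row_i x i).
set V := Vandermonde _ _.
under [X in _ = X]eq_bigr do under eq_bigr do rewrite !mxE.
move=> <-.
pose T := \matrix_(j < n, k < n) (p j)`_k.
have -> : \matrix_(i, j) (p j).[x i] = (T *m V)^T.
  apply/matrixP => i j; rewrite !mxE (@horner_coef_wide _ n); last by rewrite ps.
  by apply: eq_bigr => k _; rewrite !mxE.
rewrite det_tr det_mulmx det_trig.
  rewrite big1 ?mul1r// => i _; rewrite mxE.
  by have /monicP := pm i; rewrite /lead_coef ps.
by apply/is_trig_mxP => i j ij; rewrite mxE nth_default// ps.
Qed.
End DetDerivation.

Section FallingFactorial.
Variable K : fieldType.

Definition ffact_poly (j : nat) : {poly K} := \prod_(k < j) ('X - k%:R%:P).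

Lemma ffact_polyS j : ffact_poly j.+1 = ffact_poly j * ('X - j%:R%:P).
Proof. by rewrite /ffact_poly big_ord_recr. Qed.

Lemma ffact_poly_monic j : ffact_poly j \is monic.
Proof. by apply: monic_prod => k _; exact: monicXsubC. Qed.

Lemma size_ffact_poly j : size (ffact_poly j) = j.+1.
Proof. by rewrite size_prod_XsubC /index_enum -enumT size_enum_ord. Qed.

Lemma ffact_polyE m j : (ffact_poly j).[m%:R] = (m ^_ j)%:R.
Proof.
elim: j => [|j IH]; first by rewrite /ffact_poly big_ord0 hornerC.
rewrite ffact_polyS hornerM IH ffactnSr natrM.
rewrite !hornerE; have [mj|jm] := ltnP m j.
  by rewrite ffact_small// !mul0r.
by rewrite natrB.
Qed.
End FallingFactorial.

Section Paths.
Variables (R : comNzRingType) (n : nat) (e hs : nat -> R) (F : numFieldType).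
Hypothesis e0 : e 0 = 1.
Hypothesis hs_rec : forall b,
  hs (b + n) = - \sum_(j < n) (-1) ^+ (n - j) * e (n - j) * hs (b + j).
Variables (L : {additive R -> int}) (l : 'I_n -> nat).
Let decr (mu : 'I_n -> nat) := forall i j : 'I_n, (i < j)%N -> (mu j < mu i)%N.
Hypothesis l_decr : decr l.
Hypothesis L_vanish : forall mu : 'I_n -> nat, decr mu -> (\sum_i mu i = \sum_i l i)%N ->
  mu =1 l \/ L (jt hs mu) = 0.

(** The reciprocal factorial, continued by 0 to negative arguments, so that [GS] holds for all [a]
    and [b]. *)
Let G a b : F := if (b <= a)%N then ((a - b)`!)%:R^-1 else 0.

Let GS a b : G a b.+1 = (a%:R - b%:R) * G a b.
Proof.
rewrite /G; case: (ltngtP b a) => [ba|ab|->]; last by rewrite subrr mul0r.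
  rewrite -natrB ?(ltnW ba)// -[(a - b)%N]prednK ?subn_gt0// factS natrM invfM -subnS.
  by rewrite mulrA mulfV ?mul1r// pnatr_eq0.
by rewrite mulr0.
Qed.

Lemma jt_pieri1 (mu : 'I_n -> nat) : (0 < n)%N ->
  e 1 * jt hs mu = \sum_k jt hs (fun i => mu i + (i == k))%N.
Proof.
move=> n0; rewrite (jt_pieri e0 hs_rec)//.
rewrite (reindex_onto (fun k : 'I_n => [ffun i => i == k])
  (fun T : {ffun 'I_n -> bool} => odflt (Ordinal n0) [pick i | T i])) /=.
  apply: eq_big => [k|k _]; last by apply: eq_jt => i; rewrite ffunE.
  rewrite (bigD1 k)//= big1 ?ffunE ?eqxx//=; last by move=> i; rewrite ffunE => /negPf ->.
  by case: pickP => [i|/(_ k)]; rewrite ffunE ?eqxx// => /eqP ->; rewrite eqxx.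
move=> T /eqP sT; apply/ffunP => i; rewrite ffunE.
case: pickP => [k Tk|T0]; last by move: sT; rewrite big1// => k _; rewrite T0.
have [->|ik] := eqVneq i k; first by rewrite Tk.
apply/esym/negbTE/negP => Ti; move: sT.
by rewrite (bigD1 k)//= Tk (bigD1 i)//= Ti.
Qed.

(** A nonzero Leibniz term has mu_(s i) <= l_i for all i. Equal sums turn this into equalities; then
    [s] preserves the order, hence is the identity. *)
Lemma decr_det_base (mu : 'I_n -> nat) : decr mu -> (\sum_i mu i = \sum_i l i)%N ->
  \det (\matrix_(i, j) G (l i) (mu j)) = [forall i, mu i == l i]%:R.
Proof.
move=> mud E.
have term (s : 'S_n) : \prod_i G (l i) (mu (s i)) != 0 -> s = 1%g /\ mu =1 l.
  move=> P0; have le i : (mu (s i) <= l i)%N.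
    apply: contraR P0; rewrite -ltnNge => lt; rewrite (bigD1 i)//= /G ifN ?mul0r//.
    by rewrite -ltnNge.
  have E' : (\sum_i mu (s i) = \sum_i l i)%N by rewrite -E [RHS](reindex_inj (@perm_inj _ s)).
  have eq i : mu (s i) = l i.
    apply/eqP; rewrite eqn_leq le leqNgt; apply/negP => lt; have := ltnn (\sum_i l i)%N.
    rewrite -{1}E' => /negP; apply; rewrite (bigD1 i)//= [ltnRHS](bigD1 i)//= -addSn leq_add//.
    exact: leq_sum.
  have s_mono (i j : 'I_n) : (i < j)%N -> (s i < s j)%N.
    move=> ij; rewrite ltnNge; apply/negP => sji.
    have : (l j < l i)%N by exact: l_decr.
    rewrite -!eq; move: sji; rewrite leq_eqVlt => /orP [/eqP/val_inj ->|/mud]; first by rewrite ltnn.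
    by lia.
  have s_ge (i : 'I_n) : (i <= s i)%N.
    have [m] := ubnP i; elim: m i => // m IH i; rewrite ltnS => im.
    have [->//|i0] := posnP i.
    have i1n : (i.-1 < n)%N by rewrite (leq_ltn_trans (leq_pred i)).
    have := IH (Ordinal i1n); have := s_mono (Ordinal i1n) i.
    by rewrite /= prednK// => /(_ (leqnn _)) + /(_ im); lia.
  have s1 : s = 1%g.
    apply/permP => i; rewrite perm1; apply/val_inj/eqP; rewrite /= eqn_leq s_ge andbT leqNgt.
    apply/negP => lt; have := ltnn (\sum_(i < n) i)%N.
    rewrite {2}(reindex_inj (@perm_inj _ s)) /= => /negP; apply.
    by rewrite (bigD1 i)//= [ltnRHS](bigD1 i)//= -addSn leq_add// leq_sum.
  by split=> // i; rewrite -eq s1 perm1.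
rewrite /determinant (bigD1 1%g)//= [X in _ + X]big1 ?addr0; last first.
  move=> s s1; apply/eqP; rewrite mulf_eq0 signr_eq0/=; apply: contraR s1.
  under eq_bigr do rewrite mxE.
  by move=> /term [-> _].
rewrite odd_perm1 expr0 mul1r; under eq_bigr do rewrite mxE perm1.
case: forallP => [H|NH].
  by apply: big1 => i _; rewrite (eqP (H i)) /G leqnn subnn invr1.
apply/eqP; apply: contraT; under eq_bigr => i do rewrite -[i in mu i]perm1.
by move=> /term [_ E']; case: NH => i; rewrite E'.
Qed.

(** Aitken's determinant for skew standard tableaux. Both sides obey the same recursion in [m]: the
    Pieri rule for [e 1] on the left, [sum_det_col] with [GS] on the right. A step that leaves the
    strictly decreasing sequences repeats a line in both determinants. *)
Lemma L_path_det m (mu : 'I_n -> nat) : (0 < n)%N -> decr mu ->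
  (\sum_i mu i + m = \sum_i l i)%N ->
  (L (e 1 ^+ m * jt hs mu))%:~R =
    (L (jt hs l))%:~R * m`!%:R * \det (\matrix_(i, j) G (l i) (mu j)) :> F.
Proof.
move=> n0; elim: m mu => [|m IH] mu mud E.
  rewrite addn0 in E; rewrite expr0 mul1r mulr1 decr_det_base//.
  case: forallP => [H|NH]; first by rewrite mulr1; congr (L _)%:~R; apply: eq_jt => i; apply/eqP.
  have [E'|->] := L_vanish mud E; last by rewrite mulr0.
  by case: NH => i; rewrite E'.
rewrite exprSr -mulrA jt_pieri1// mulr_sumr raddf_sum rmorph_sum /=.
transitivity (\sum_k (L (jt hs l))%:~R * m`!%:R *
    \det (\matrix_(i, j) G (l i) (mu j + (j == k))) : F).
  apply: eq_bigr => k _.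
  have [mukd|] := boolP [forall i : 'I_n, forall j : 'I_n, (i < j)%N ==> (mu j + (j == k) < mu i + (i == k))%N].
    apply: IH => [i j ij|]; first by move/forallP/(_ i)/forallP/(_ j)/implyP : mukd; exact.
    have k1 : (\sum_(i < n) (i == k) = 1)%N.
      by rewrite (bigD1 k)//= eqxx big1// => i /negPf ->.
    by rewrite -E big_split /= k1 -addnA add1n.
  rewrite negb_forall => /existsP [i]; rewrite negb_forall => /existsP [j].
  rewrite negb_imply -leqNgt => /andP [ij ji].
  have ineqj : i != j by rewrite neq_ltn ij.
  have muij : (mu i + (i == k) = mu j + (j == k))%N.
    have := mud _ _ ij; move: ji ineqj; case: (eqVneq i k) => [->|] ; case: (eqVneq j k) => [->|]; rewrite ?eqxx //=; lia.
  rewrite (jt_eq0 _ ineqj)// mulr0 raddf0 -det_tr (determinant_alternate ineqj) ?mulr0// => a.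
  by rewrite !mxE muij.
rewrite -mulr_sumr factS natrM.
have m1E : m.+1%:R = \sum_i (l i)%:R - \sum_i (mu i)%:R :> F.
  by rewrite -!natr_sum -E natrD addrC addKr.
rewrite (_ : \sum_k _ = m.+1%:R * \det (\matrix_(i, j) G (l i) (mu j))); first by ring.
rewrite m1E -sum_det_col; apply: eq_bigr => k _.
congr (\det _); apply/matrixP => i j; rewrite !mxE; case: eqP => _; last by rewrite addn0 mul1r.
by rewrite addn1 GS.
Qed.

Let rho (i : 'I_n) := (n - i.+1)%N.

Lemma jt_rho : (forall b, (b.+1 < n)%N -> hs b = 0) -> hs n.-1 = 1 -> jt hs rho = 1.
Proof.
move=> hs0 hs1; rewrite /jt det_trig.
  rewrite big1// => i _; rewrite mxE /rho; have := ltn_ord i => ?.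
  by rewrite (_ : (n - i.+1 + i)%N = n.-1)//; lia.
apply/is_trig_mxP => i j ij; rewrite mxE hs0// /rho.
by have := ltn_ord j; lia.
Qed.

(** The sign of the order reversal: [rho] decreases, whereas the falling factorials are listed by
    increasing degree. *)
Definition vdm_sign : F := \det (perm_mx (perm (@rev_ord_inj n))^-1).

(** For paths from the empty shape, 1 / (l_i - rho_j)! is the falling factorial of l_i of order
    rho_j, divided by l_i!. Falling factorials are monic polynomials, so a Vandermonde product
    remains, as in Frobenius' form of the hook length formula. *)
Lemma L_path_Vandermonde m : (0 < n)%N -> (forall b, (b.+1 < n)%N -> hs b = 0) -> hs n.-1 = 1 ->
  (\sum_i rho i + m = \sum_i l i)%N ->
  (L (e 1 ^+ m))%:~R = (L (jt hs l))%:~R * m`!%:R * vdm_sign / (\prod_i (l i)`!%:R) *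
    \prod_(i < n) \prod_(j < n | (i < j)%N) ((l j)%:R - (l i)%:R) :> F.
Proof.
move=> n0 hs0 hs1 E.
have rho_decr : decr rho by move=> i j ij; rewrite /rho; have := ltn_ord j; lia.
have := L_path_det n0 rho_decr E; rewrite jt_rho// mulr1 => ->.
rewrite -!mulrA; congr (_ * (_ * _)).
rewrite -(@det_poly_Vandermonde F n (@ffact_poly F) (fun i => (l i)%:R)); last first.
- exact: size_ffact_poly.
- exact: ffact_poly_monic.
have -> : \matrix_(i, j) G (l i) (rho j) = diag_mx (\row_i ((l i)`!%:R)^-1) *m
    \matrix_(i, j) (ffact_poly F j).[(l i)%:R] *m perm_mx (perm (@rev_ord_inj n))^-1.
  rewrite -mulmxA -col_permE; apply/matrixP => i j; rewrite mul_diag_mx !mxE permE /=.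
  rewrite ffact_polyE /G /rho; case: leqP => H; last by rewrite ffact_small// mulr0.
  rewrite -(ffact_fact H) natrM invfM mulrAC mulVf ?mul1r//.
  by rewrite pnatr_eq0 -lt0n ffact_gt0.
rewrite !det_mulmx det_diag mulrC; congr (_ * (_ * _)).
by rewrite -prodfV; apply: eq_bigr => i _; rewrite mxE.
Qed.

End Paths.

(** * NilCoxeter operators on permutations *)

(** Exchanging [i] and [i.+1] preserves every comparison except the one between these two
    numbers. *)
Lemma swap_lt i a b : (a < b)%N =
  ((if a == i then i.+1 else if a == i.+1 then i else a) <
   (if b == i then i.+1 else if b == i.+1 then i else b))%N &&
    ~~ ((a == i.+1) && (b == i)) || (a == i) && (b == i.+1).
Proof.
by case: (a =P i) => ?; case: (a =P i.+1) => ?; case: (b =P i) => ?; case: (b =P i.+1) => ? /=;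
  rewrite ?andbF ?andbT ?orbF; apply/idP/idP; lia.
Qed.

Section Descents.
Variable p : nat.
Implicit Types (v w x : 'S_p.+1) (i j : nat) (a b : 'I_p.+1).

Definition pos i : 'I_p.+1 := inord i.

Lemma posK i : (i <= p)%N -> pos i = i :> nat.
Proof. exact: inordK. Qed.

Lemma pos_val a : pos a = a.
Proof. exact: inord_val. Qed.

Definition adj i : 'S_p.+1 := tperm (pos i) (pos i.+1).

Definition des v i := (i < p)%N && (v (pos i.+1) < v (pos i))%N.

(** Inversions are labelled by values: exchanging the two entries of a descent then removes one pair
    and leaves every other pair at its label, whereas labels by places would be permuted. *)
Definition invp v a b := (b < a)%N && (v^-1%g a < v^-1%g b)%N.

Lemma adjK i : (adj i * adj i = 1)%g.
Proof. exact: tperm2. Qed.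

Lemma adjMK i v : (adj i * (adj i * v) = v)%g.
Proof. by rewrite mulgA adjK mul1g. Qed.

Lemma adjE i (q : 'I_p.+1) : (i < p)%N ->
  adj i q = (if q == i :> nat then i.+1 else if q == i.+1 :> nat then i else q) :> nat.
Proof.
move=> ip; rewrite /adj; case: tpermP => [->|->|].
- by rewrite !posK ?eqxx// ltnW.
- by rewrite !posK ?(ltnW ip)// gtn_eqF// eqxx.
- move=> /eqP q1 /eqP q2; move: q1 q2; rewrite -!val_eqE /= (posK (ltnW ip)) (posK ip).
  by move=> /negPf -> /negPf ->.
Qed.

Lemma adj_pos i : (i < p)%N -> adj i (pos i) = pos i.+1.
Proof. by move=> _; rewrite /adj tpermL. Qed.

Lemma adj_posS i : (i < p)%N -> adj i (pos i.+1) = pos i.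
Proof. by move=> _; rewrite /adj tpermR. Qed.

Lemma adj_other i j : (i < p)%N -> (j <= p)%N -> j != i -> j != i.+1 -> adj i (pos j) = pos j.
Proof.
move=> ip jp ji ji1; apply: val_inj; rewrite /= adjE// posK//.
by rewrite (negPf ji) (negPf ji1).
Qed.

Lemma des_adj v i : des v i -> ~~ des (adj i * v)%g i.
Proof.
case/andP => ip lt; rewrite /des ip /= !permM adj_pos// adj_posS//.
by rewrite -leqNgt ltnW.
Qed.

Lemma invp_adj v i a b : des v i ->
  invp v a b = invp (adj i * v)%g a b || ((a == v (pos i)) && (b == v (pos i.+1))).
Proof.
case/andP => ip lt; rewrite /invp invMg tpermV !permM !adjE//.
have invE c j : (j <= p)%N -> (v^-1 c == j :> nat)%g = (c == v (pos j)).
  move=> jp; rewrite -{1}(posK jp) val_eqE; apply/eqP/eqP => [<-|->]; first by rewrite permKV.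
  by rewrite permK.
have lti c : (c == v (pos i)) = (v^-1%g c == i :> nat) by rewrite invE// ltnW.
have ltS c : (c == v (pos i.+1)) = (v^-1%g c == i.+1 :> nat) by rewrite invE.
rewrite lti ltS (swap_lt i (v^-1%g a)); case: (boolP (b < a)%N) => //= ba.
  rewrite (_ : (_ == i.+1) && (_ == i) = false) ?andbT//; apply/negP.
  by rewrite -lti -ltS => /andP [/eqP E1 /eqP E2]; move: ba; rewrite E1 E2 ltnNge ltnW.
apply/esym/negbTE/negP; rewrite -lti -ltS => /andP [/eqP E1 /eqP E2].
by case/negP: ba; rewrite E1 E2.
Qed.

Definition code v a := (\sum_b invp v a b)%N.
Definition cocode v b := (\sum_a invp v a b)%N.
Definition len v := (\sum_a code v a)%N.

Lemma len_cocode v : len v = (\sum_b cocode v b)%N.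
Proof. exact: exchange_big. Qed.

Lemma invp_adjN v i : des v i -> invp (adj i * v)%g (v (pos i)) (v (pos i.+1)) = false.
Proof.
case/andP => ip lt; rewrite /invp invMg tpermV !permM !permK adj_pos// adj_posS//.
by rewrite !posK ?(ltnW ip)//; apply/negbTE; rewrite negb_and -!leqNgt leqnSn orbT.
Qed.

Let invp_adj_nat v i a b : des v i ->
  invp v a b = (invp (adj i * v)%g a b + (a == v (pos i)) * (b == v (pos i.+1)))%N :> nat.
Proof.
move=> dvi; rewrite (invp_adj a b dvi).
have [->|_] := eqVneq a; have [->|_] := eqVneq b; rewrite ?andbF ?orbF ?addn0 ?muln0//.
by rewrite invp_adjN.
Qed.

Lemma code_adj v i a : des v i -> code v a = (code (adj i * v)%g a + (a == v (pos i)))%N.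
Proof.
move=> dvi; rewrite /code (eq_bigr _ (fun b _ => invp_adj_nat a b dvi)) big_split /=.
by congr (_ + _)%N; rewrite -big_distrr /= (bigD1 (v (pos i.+1)))//= eqxx big1 ?addn0 ?muln1// => b /negPf ->.
Qed.

Lemma cocode_adj v i b : des v i ->
  cocode v b = (cocode (adj i * v)%g b + (b == v (pos i.+1)))%N.
Proof.
move=> dvi; rewrite /cocode (eq_bigr _ (fun a _ => invp_adj_nat a b dvi)) big_split /=.
by congr (_ + _)%N; rewrite -big_distrl /= (bigD1 (v (pos i)))//= eqxx big1 ?addn0 ?mul1n// => a /negPf ->.
Qed.

Lemma len_adj v i : des v i -> len v = (len (adj i * v)%g).+1.
Proof.
move=> dvi; rewrite /len (eq_bigr _ (fun a _ => code_adj a dvi)) big_split /=.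
have -> : (\sum_a (a == v (pos i)) = 1)%N.
  by rewrite (bigD1 (v (pos i)))//= eqxx big1 ?addn0// => a /negPf ->.
by rewrite addn1.
Qed.

Lemma perm_increasing v : (forall i, (i < p)%N -> ~~ des v i) -> v = 1%g.
Proof.
move=> nd.
have mono i : (i < p)%N -> (v (pos i) < v (pos i.+1))%N.
  move=> ip; have := nd i ip; rewrite /des ip /= -leqNgt leq_eqVlt => /orP [/eqP/val_inj/perm_inj|//].
  by move/(congr1 val); rewrite /= !posK// ?(ltnW ip)// => /eqP; rewrite ltn_eqF.
have ge i : (i <= p)%N -> (i <= v (pos i))%N.
  elim: i => // i IH ip; exact: leq_ltn_trans (IH (ltnW ip)) (mono i ip).
apply/permP => a; rewrite perm1; apply/val_inj.
have gea (c : 'I_p.+1) : (c <= v c)%N by have := ge c; rewrite pos_val; apply; rewrite -ltnS.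
apply/eqP; rewrite eqn_leq gea andbT leqNgt; apply/negP => lt.
have := ltnn (\sum_(c < p.+1) c)%N.
rewrite {2}(reindex_inj (@perm_inj _ v)) /= => /negP; apply.
by rewrite (bigD1 a)//= [ltnRHS](bigD1 a)//= -addSn leq_add// leq_sum.
Qed.

Lemma len_eq0 v : len v = 0%N -> v = 1%g.
Proof.
move=> l0; apply: perm_increasing => i _; apply/negP => /len_adj; by rewrite l0.
Qed.

Lemma exists_des v : v != 1%g -> exists2 i, (i < p)%N & des v i.
Proof.
move=> v1; have [H|] := boolP [forall i : 'I_p, ~~ des v i].
  by case/eqP: v1; apply: perm_increasing => i ip; exact: (forallP H (Ordinal ip)).
by rewrite negb_forall => /existsP [i]; rewrite negbK; exists i.
Qed.

(* Ranking the permutations turns operators on functions into square matrices;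
   the successor form of their size makes these a nonzero ring. *)
Definition dim := #|{: 'S_p.+1}|.-1.

Lemma dimE : #|{: 'S_p.+1}| = dim.+1.
Proof. by rewrite /dim prednK//; apply/card_gt0P; exists 1%g. Qed.

Definition rk v : 'I_dim.+1 := cast_ord dimE (enum_rank v).
Definition unrk (r : 'I_dim.+1) : 'S_p.+1 := enum_val (cast_ord (esym dimE) r).

Lemma rkK : cancel rk unrk.
Proof. by move=> v; rewrite /unrk /rk cast_ordK enum_rankK. Qed.

Lemma unrkK : cancel unrk rk.
Proof. by move=> r; rewrite /unrk /rk enum_valK cast_ordKV. Qed.

Definition act (M : 'M[int]_dim.+1) (f : 'S_p.+1 -> int) v : int :=
  \sum_w M (rk v) (rk w) * f w.

Lemma actM A B f v : act (A * B) f v = act A (act B f) v.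
Proof.
rewrite /act; under eq_bigr do rewrite mxE mulr_suml.
rewrite exchange_big /= (reindex rk) /=; last by exists unrk => ? _; rewrite ?rkK ?unrkK.
apply: eq_bigr => w _; rewrite mulr_sumr; apply: eq_bigr => x _; by rewrite mulrA.
Qed.

Lemma actD A B f v : act (A + B) f v = act A f v + act B f v.
Proof. by rewrite /act -big_split /=; apply: eq_bigr => w _; rewrite mxE mulrDl. Qed.

Lemma act1 f v : act 1 f v = f v.
Proof.
rewrite /act (bigD1 v)//= mxE eqxx mul1r big1 ?addr0// => w wv.
by rewrite mxE (inj_eq (can_inj rkK)) eq_sym (negPf wv) mul0r.
Qed.

Lemma act0 f v : act 0 f v = 0.
Proof. by rewrite /act big1// => w _; rewrite mxE mul0r. Qed.

Lemma act_delta A v w : act A (fun x => (x == w)%:R) v = A (rk v) (rk w).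
Proof.
by rewrite /act (bigD1 w)//= eqxx mulr1 big1 ?addr0// => x /negPf ->; rewrite mulr0.
Qed.

Lemma act_inj A B : (forall f v, act A f v = act B f v) -> A = B.
Proof.
move=> E; apply/matrixP => r c.
by rewrite -(unrkK r) -(unrkK c) -!act_delta E.
Qed.

(* [adj i * v] exchanges the values of v at i and i.+1. *)
Definition peel i : 'M[int]_dim.+1 :=
  \matrix_(r, c) (des (unrk r) i && (unrk c == (adj i * unrk r)%g))%:R.

Lemma act_peel i f v : act (peel i) f v = if des v i then f (adj i * v)%g else 0.
Proof.
rewrite /act (bigD1 (adj i * v)%g)//= mxE !rkK eqxx andbT big1 ?addr0.
  by case: (des v i); rewrite ?mul1r ?mul0r.
by move=> w /negPf wv; rewrite mxE !rkK wv andbF mul0r.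
Qed.

Lemma peel_nil i : peel i * peel i = 0.
Proof.
apply: act_inj => f v; rewrite actM act_peel act0; case: ifPn => // /des_adj.
by rewrite act_peel => /negPf ->.
Qed.

Lemma adj_far i j : (i.+1 < j)%N -> (j < p)%N -> (adj i * adj j = adj j * adj i)%g.
Proof.
move=> ij jp; apply/permP => q; rewrite !permM; apply/val_inj.
have ip : (i < p)%N by lia.
rewrite /= !adjE//; case: (q =P i :> nat) => ?; case: (q =P i.+1 :> nat) => ?;
case: (q =P j :> nat) => ?; case: (q =P j.+1 :> nat) => ? //=; rewrite ?eqxx //=;
  repeat case: eqP => //=; lia.
Qed.

Lemma peel_far i j : (i.+1 < j)%N -> peel i * peel j = peel j * peel i.
Proof.
move=> ij; apply: act_inj => f v; rewrite !actM !act_peel.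
have [jp|pj] := ltnP j p; last first.
  by rewrite /des [(j < p)%N]ltnNge pj /=; case: ifP.
have ip : (i < p)%N by lia.
have -> : des (adj i * v)%g j = des v j.
  by rewrite /des !permM !adj_other//; lia.
have -> : des (adj j * v)%g i = des v i.
  by rewrite /des !permM !adj_other//; lia.
rewrite !mulgA (adj_far ij jp); by case: (des v i); case: (des v j).
Qed.

Lemma adj_braid i : (i.+1 < p)%N ->
  (adj i * adj i.+1 * adj i = adj i.+1 * adj i * adj i.+1)%g.
Proof.
move=> ip; apply/permP => q; rewrite !permM; apply/val_inj.
rewrite /= !adjE//; try lia; case: (q =P i :> nat) => ?; case: (q =P i.+1 :> nat) => ?;
case: (q =P i.+2 :> nat) => ? //=; rewrite ?eqxx //=;
  repeat case: eqP => //=; lia.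
Qed.

Lemma peel_braid i : peel i * peel i.+1 * peel i = peel i.+1 * peel i * peel i.+1.
Proof.
apply: act_inj => f v; rewrite !actM !act_peel.
have [ip|pi] := ltnP i.+1 p; last first.
  rewrite /des [(i.+1 < p)%N]ltnNge pi /=.
  by repeat case: ifP.
rewrite /des ip (ltnW ip) /= !permM.
have E1 := adj_pos (ltnW ip); have E2 := adj_posS (ltnW ip).
have E3 : adj i (pos i.+2) = pos i.+2 by apply: adj_other; lia.
have E4 : adj i.+1 (pos i) = pos i by apply: adj_other; lia.
have E5 := adj_pos ip; have E6 := adj_posS ip.
rewrite !(E1, E2, E3, E4, E5, E6) !mulgA adj_braid//.
by case: (ltnP (v (pos i.+1)) (v (pos i))); case: (ltnP (v (pos i.+2)) (v (pos i.+1)));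
  case: (ltnP (v (pos i.+2)) (v (pos i))) => // *; lia.
Qed.

Let D := desc_sum peel.
Let A := asc_sum peel.

Lemma perm_agree m x w : (forall a : 'I_p.+1, (m < a)%N -> x a = w a) ->
  forall c t, (m <= t)%N -> (t < x^-1%g c)%N = (t < w^-1%g c)%N.
Proof.
move=> xw c t mt; apply/idP/idP => tc.
  by rewrite (_ : w^-1%g c = x^-1%g c)//; apply: (@perm_inj _ w); rewrite permKV -xw ?permKV ?(leq_ltn_trans mt).
by rewrite (_ : x^-1%g c = w^-1%g c)//; apply: (@perm_inj _ x); rewrite permKV xw ?permKV ?(leq_ltn_trans mt).
Qed.

(** The leftmost operator acts on the permutation before the others, so a descending product makes
    exchanges at decreasing places. The larger value of each exchange lands where the later ones do
    not reach; hence it is the larger one only once, and no entry of the code drops by more than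
    1. *)
Lemma desc_support m j f w : act (D m j) f w != 0 -> exists x,
  [/\ f x != 0, forall a : 'I_p.+1, (m < a)%N -> x a = w a, len w = (len x + j)%N &
    forall a, (code x a <= code w a <= code x a + 1)%N].
Proof.
elim: m j w => [|m IH] [|j] w /=.
- by rewrite act1 => fw; exists w; split=> // [|a]; rewrite ?addn0// leqnn leq_addr.
- by rewrite act0 eqxx.
- rewrite addr0 => /IH [x [fx xw lx cx]]; exists x; split=> // a ma; apply: xw; exact: ltnW.
rewrite actD; have [->|/IH [x [fx xw lx cx]] _] := eqVneq (act (D m j.+1) f w) 0; last first.
  by exists x; split=> // a ma; apply: xw; exact: ltnW.
rewrite add0r actM act_peel; case: ifPn; rewrite ?eqxx// => dw /IH [x [fx xw lx cx]].
have /andP [mp _] := dw.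
set w1 := (adj m * w)%g in xw lx cx *.
have w1S : w1 (pos m.+1) = w (pos m) by rewrite /w1 permM adj_posS.
exists x; split=> // [a ma|| a].
- rewrite xw ?(ltnW ma)// /w1 permM -[a]pos_val adj_other//; last 2 first.
  + by rewrite gtn_eqF// ltnW.
  + by rewrite gtn_eqF.
  + by rewrite -ltnS.
- by rewrite (len_adj dw) lx addnS.
- rewrite (code_adj a dw) -/w1; have [aw|_] := eqVneq; last by rewrite addn0.
  have -> : code w1 a = code x a; last by rewrite leqnn leq_addr.
  have xS : x (pos m.+1) = a by rewrite xw ?posK// w1S aw.
  have wa : w1^-1%g a = pos m.+1 by rewrite aw -w1S permK.
  have xa : x^-1%g a = pos m.+1 by rewrite -xS permK.
  apply: eq_bigr => b _; rewrite /invp wa xa posK//.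
  by congr (_ && _ : nat); apply/esym; exact: (perm_agree xw).
Qed.

(** The mirror image: exchanges at increasing places leave the smaller value behind for good, so it
    is the cocode that drops by at most 1. *)
Lemma asc_support m j f w : act (A m j) f w != 0 -> exists x,
  [/\ f x != 0, forall a : 'I_p.+1, (m < a)%N -> x a = w a, len w = (len x + j)%N &
    forall a, (cocode x a <= cocode w a <= cocode x a + 1)%N].
Proof.
elim: m j f w => [|m IH] [|j] f w /=.
- by rewrite act1 => fw; exists w; split=> // [|a]; rewrite ?addn0// leqnn leq_addr.
- by rewrite act0 eqxx.
- rewrite addr0 => /IH [x [fx xw lx cx]]; exists x; split=> // a ma; apply: xw; exact: ltnW.
rewrite actD; have [->|/IH [x [fx xw lx cx]] _] := eqVneq (act (A m j.+1) f w) 0; last first.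
  by exists x; split=> // a ma; apply: xw; exact: ltnW.
rewrite add0r actM => /IH [y [+ yw ly cy]].
rewrite act_peel; case: ifPn; rewrite ?eqxx// => dy fx.
have /andP [mp _] := dy.
exists (adj m * y)%g; split=> // [a ma|| b].
- rewrite permM -[a]pos_val adj_other//; last 3 first.
  + by rewrite -ltnS.
  + by rewrite gtn_eqF// ltnW.
  + by rewrite gtn_eqF.
  by rewrite pos_val yw// ltnW.
- by rewrite ly (len_adj dy) addnS addSn.
- have := cy b; rewrite (cocode_adj b dy); have [by_|_] := eqVneq; last by rewrite addn0.
  move=> _; have -> : cocode w b = cocode y b.
    have wS : w (pos m.+1) = b by rewrite -yw ?posK.
    have wb : w^-1%g b = pos m.+1 by rewrite -wS permK.
    have yb : y^-1%g b = pos m.+1 by rewrite by_ permK.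
    apply: eq_bigr => a _; rewrite /invp wb yb posK// ![(_ < m.+1)%N]ltnNge.
    by congr (_ && ~~ _ : nat); apply/esym; exact: (perm_agree yw).
  by rewrite (cocode_adj b dy) by_ eqxx leq_addr leqnn.
Qed.

End Descents.

(** * Code bounds and the commutative ring of the e_j and h_j *)

Section Runs.
Variable p : nat.
Notation D := (desc_sum (@peel p) p).
Notation A := (asc_sum (@peel p) p).
Implicit Types (w : 'S_p.+1) (a : 'I_p.+1).

Lemma sum_code_runs k (c c' : 'I_p.+1 -> nat) t :
  (forall a, c' a <= c a <= c' a + k)%N -> (\sum_a c a = \sum_a c' a + t)%N ->
  (t <= \sum_a minn (c a) k)%N.
Proof.
move=> cc E; rewrite -(leq_add2l (\sum_a c' a)) -E -big_split leq_sum//= => a _.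
by have := cc a; lia.
Qed.

(** Each of the [size bs] runs lowers an entry of the code by at most 1, and an entry cannot drop
    below 0. *)
Lemma desc_runs (bs : seq nat) Y f w : act ((\prod_(b <- bs) D b) * Y) f w != 0 ->
  (sumn bs <= \sum_a minn (code w a) (size bs))%N.
Proof.
move=> H; suff [x lx cx] : exists2 x : 'S_p.+1, len w = (len x + sumn bs)%N &
    forall a, (code x a <= code w a <= code x a + size bs)%N.
  exact: sum_code_runs cx lx.
elim: bs w H => [|b bs IH] w.
  by move=> _; exists w => [|a]; rewrite /= ?addn0 ?leqnn.
rewrite big_cons -mulrA actM => /desc_support [y [/IH [x lx cx] _ ly cy]].
exists x => [|a]; first by rewrite ly lx /= addnAC addnA.
by have := cx a; have := cy a; rewrite /=; lia.
Qed.

Lemma asc_runs (bs : seq nat) Y f w : act ((\prod_(b <- bs) A b) * Y) f w != 0 ->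
  (sumn bs <= \sum_a minn (cocode w a) (size bs))%N.
Proof.
move=> H; suff [x lx cx] : exists2 x : 'S_p.+1, len w = (len x + sumn bs)%N &
    forall a, (cocode x a <= cocode w a <= cocode x a + size bs)%N.
  by apply: sum_code_runs cx _; rewrite -!len_cocode.
elim: bs w H => [|b bs IH] w.
  by move=> _; exists w => [|a]; rewrite /= ?addn0 ?leqnn.
rewrite big_cons -mulrA actM => /asc_support [y [/IH [x lx cx] _ ly cy]].
exists x => [|a]; first by rewrite ly lx /= addnAC addnA.
by have := cx a; have := cy a; rewrite /=; lia.
Qed.

Let D_comm i j : D i * D j = D j * D i.
Proof. exact: (desc_sum_comm (@peel_nil p) (@peel_far p) (@peel_braid p)). Qed.

Definition nc_ring := dcomm_ring (fun j => D j).
HB.instance Definition _ := GRing.NzRing.on nc_ring.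
HB.instance Definition _ := GRing.PzSemiRing_hasCommutativeMul.Build nc_ring (dcomm_mulC D_comm).

(** The convolution identity expresses each h_k through the e_j and the earlier h_j, so the h_k are
    polynomials in the e_j. *)
Lemma asc_dcomm k : A k \in dcomm (fun j => D j).
Proof.
have [m] := ubnP k; elim: m k => // m IH [|k] km; first by rewrite asc_sum0 rpred1.
have := desc_asc_conv (@peel_nil p) p (ltn0Sn k).
rewrite big_ord_recl desc_sum0 mul1r subn0 => /eqP; rewrite addr_eq0 => /eqP E.
rewrite -[A _](signrMK k.+1) E rpredM ?rpredX ?rpredN ?rpred1// rpred_sum// => i _.
rewrite rpredM ?dcomm_gen//= rpredM ?rpredX ?rpredN ?rpred1//.
by rewrite IH// subSS (leq_ltn_trans (leq_subr _ _)).
Qed.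

Definition nc_e j : nc_ring := DcommRing (dcomm_gen (fun j => D j) j).
Definition nc_h j : nc_ring := DcommRing (asc_dcomm j).

(** A matrix entry that counts: for a product of e_j and h_j it is the number of ways in which the
    product leads from [w] down to the identity. *)
Definition nc_coef w (z : nc_ring) : int := dcomm_val z (rk w) (rk 1%g).

Lemma nc_coef_additive w : zmod_morphism (nc_coef w).
Proof. by move=> x y; rewrite /nc_coef dcomm_valB !mxE. Qed.

HB.instance Definition _ w := GRing.isZmodMorphism.Build nc_ring int (nc_coef w) (nc_coef_additive w).

Lemma nc_coefE w z : nc_coef w z = act (dcomm_val z) (fun x => (x == 1%g)%:R) w.
Proof. by rewrite act_delta. Qed.

Lemma big_seq_filter (R : Type) (idx : R) (op : R -> R -> R) (I : finType) (P : pred I)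
    (F : nat -> R) (b : I -> nat) :
  \big[op/idx]_(i | P i) F (b i) = \big[op/idx]_(x <- [seq b i | i <- index_enum I & P i]) F x.
Proof. by rewrite big_map big_filter. Qed.

(** The cocode supplies the row bounds of the triangularity argument, as [asc_runs] limits the
    degree of a product of at most [j] ascending sums. *)
Lemma nc_coef_h w (lam : 'I_p.+1 -> nat) :
  (forall j, \sum_a minn (cocode w a) j = \sum_(i < p.+1 | (i < j)%N) lam i)%N ->
  forall j (b : 'I_p.+1 -> nat) Y,
  (\sum_(i < p.+1 | (i < j)%N) lam i < \sum_(i < p.+1 | (i < j)%N) b i)%N ->
  nc_coef w ((\prod_(i < p.+1 | (i < j)%N) nc_h (b i)) * Y) = 0.
Proof.
move=> E j b Y H; rewrite nc_coefE dcomm_valM dcomm_val_prod /=; apply/eqP.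
apply: contraTT H; rewrite -leqNgt -E (big_seq_filter _ _ _ (fun k => A k)) => /asc_runs.
rewrite size_map sumnE -(big_seq_filter 0%N addn _ (fun k => k)) => /leq_trans; apply.
apply: leq_sum => a _; rewrite leq_min geq_minl geq_min/=; apply/orP; right.
by rewrite -sum1_size big_filter big_mkcond /= sum_lt_ord geq_minl.
Qed.

Lemma nc_coef_e w (lam : 'I_p.+1 -> nat) :
  (forall j, \sum_a minn (code w a) j = col_min lam j)%N ->
  forall j (b : nat -> nat) Y, (col_min lam j < \sum_(s < j) b s)%N ->
  nc_coef w ((\prod_(s < j) nc_e (b s)) * Y) = 0.
Proof.
move=> E j b Y H; rewrite nc_coefE dcomm_valM dcomm_val_prod /=; apply/eqP.
apply: contraTT H; rewrite -leqNgt -E (big_seq_filter _ _ _ (fun k => D k)) => /desc_runs.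
rewrite size_map sumnE -(big_seq_filter 0%N addn _ (fun k => k)) => /leq_trans; apply.
by rewrite -sum1_size big_filter sum1_card card_ord.
Qed.

Definition nc_hs b := if (b.+1 < p.+1)%N then 0 else nc_h (b.+1 - p.+1).

Lemma nc_e0 : nc_e 0 = 1.
Proof. by apply: val_inj; exact: etrans (desc_sum0 _ _) (esym (dcomm_val1 _)). Qed.

Lemma nc_h0 : nc_h 0 = 1.
Proof. by apply: val_inj; exact: etrans (asc_sum0 _ _) (esym (dcomm_val1 _)). Qed.

Lemma nc_e_gt j : (p < j)%N -> nc_e j = 0.
Proof. by move=> pj; apply: val_inj; rewrite /= desc_sum_gt//. Qed.

Lemma nc_conv k : (0 < k)%N -> \sum_(i < k.+1) (-1) ^+ i * nc_e i * nc_h (k - i) = 0.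
Proof.
move=> k0; apply: (can_inj (signrMK k)); rewrite mulr0 mulr_sumr; apply: val_inj.
rewrite [LHS]dcomm_val_sum -[RHS](desc_asc_conv (@peel_nil p) p k0).
apply: eq_bigr => i _; have ik : (i <= k)%N by rewrite -ltnS.
have -> : (-1) ^+ k * ((-1) ^+ i * nc_e i * nc_h (k - i)) =
    nc_e i * ((-1) ^+ (k - i) * nc_h (k - i)) :> nc_ring.
  rewrite -{1}(subnK ik) exprD -!mulrA [X in _ * X]mulrA -expr2 sqrr_sign mul1r.
  by rewrite mulrCA.
by rewrite !dcomm_valM dcomm_valX dcomm_valN dcomm_val1.
Qed.

(** This is [nc_conv] in degree [b.+1], with [nc_hs] storing degrees shifted by [p]. The terms with
    e_i for i > p, or with h of negative degree, vanish, so both sums extend to one common range. *)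
Lemma nc_hs_rec b : nc_hs (b + p.+1) =
  - \sum_(j < p.+1) (-1) ^+ (p.+1 - j) * nc_e (p.+1 - j) * nc_hs (b + j).
Proof.
rewrite /nc_hs ltnNge leqW ?leq_addl//= -addSn addnK.
have /eqP := nc_conv (ltn0Sn b); rewrite big_ord_recl expr0 mul1r nc_e0 mul1r subn0.
rewrite addr_eq0 => /eqP ->; congr (- _).
pose G i : nc_ring := (-1) ^+ i.+1 * nc_e i.+1 * (if (i <= b)%N then nc_h (b - i) else 0).
transitivity (\sum_(i < b.+1) G i).
  by apply: eq_bigr => i _; rewrite /G -ltnS ltn_ord subSS.
have -> : \sum_(j < p.+1) (-1) ^+ (p.+1 - j) * nc_e (p.+1 - j) *
    (if ((b + j).+1 < p.+1)%N then 0 else nc_h ((b + j).+1 - p.+1)) = \sum_(i < p.+1) G i.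
  rewrite (reindex_inj rev_ord_inj) /=; apply: eq_bigr => i _.
  have ip := ltn_ord i; rewrite /G; have -> : (p.+1 - (p.+1 - i.+1) = i.+1)%N by lia.
  congr (_ * _); have [ib|bi] := leqP i b; case: ltnP => H //; try lia.
  by congr nc_h; lia.
have wide M N : (forall i, (N <= i)%N -> G i = 0) -> (N <= M)%N ->
    \sum_(i < N) G i = \sum_(i < M) G i.
  move=> G0 NM; rewrite -!(big_mkord xpredT) [RHS](big_cat_nat (leq0n N) NM)/=.
  by rewrite [X in _ + X]big_nat_cond [X in _ + X]big1 ?addr0// => i /andP [/andP [/G0]].
transitivity (\sum_(i < b + p.+2) G i); [apply: wide|apply/esym/wide].
- by move=> i bi; rewrite /G leqNgt bi mulr0.
- lia.
- by move=> i pi; rewrite /G (nc_e_gt (leqW pi)) mulr0 mul0r.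
- lia.
Qed.

Lemma nc_coef_expand w m :
  nc_coef w (nc_e 1 ^+ m) = act ((\sum_(i < p) peel p i) ^+ m) (fun x => (x == 1%g)%:R) w.
Proof. by rewrite nc_coefE dcomm_valX /= desc_sum1. Qed.

End Runs.

(** * Reduced words of the permutations below the reversal *)

Section Staircase.
Variable p : nat.
Implicit Types (s : seq nat) (w v : 'S_p.+1).

Definition far_apart i j := ((i.+1 < j) || (j.+1 < i))%N.
Definition separated s := pairwise far_apart s && all (fun i => i < p)%N s.

Definition adjs s : 'S_p.+1 := (\prod_(i <- s) adj p i)%g.
Definition rev0 : 'S_p.+1 := perm (@rev_ord_inj p.+1).
Definition stair s : 'S_p.+1 := (adjs s * rev0)%g.

Lemma adjsE s (q : 'I_p.+1) : separated s ->
  adjs s q = (if (q : nat) \in s then q.+1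
              else if (0 < q)%N && (q.-1 \in s) then q.-1 else q) :> nat.
Proof.
rewrite /adjs; elim: s q => [|i s IH] q; first by rewrite big_nil perm1 andbF.
rewrite /separated /= => /andP [/andP [/allP far sep_s] /andP [ip lt_s]].
have {}IH q' := IH q' (introT andP (conj sep_s lt_s)).
have notin j : ~~ far_apart i j -> j \notin s by apply: contra => /far.
have i_s : i \notin s by apply: notin; rewrite /far_apart; lia.
have iS_s : i.+1 \notin s by apply: notin; rewrite /far_apart; lia.
have iP_s : (0 < i)%N -> i.-1 \notin s by move=> ?; apply: notin; rewrite /far_apart; lia.
rewrite big_cons permM IH !adjE//; rewrite !inE.
case: (eqVneq (q : nat) i) => [->|qi] /=; first by rewrite (negPf iS_s) (negPf i_s) .
case: (eqVneq (q : nat) i.+1) => [->|qi1] /=.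
  rewrite (negPf i_s) (negPf iS_s) eqxx /=; case: posnP => //= i0.
  by rewrite (negPf (iP_s i0)).
case: posnP => //= q0; rewrite [q.-1 == i](_ : _ = false)//.
by apply/negbTE; apply: contra qi1 => /eqP <-; rewrite prednK.
Qed.

Lemma separated_succ s i : separated s -> i \in s -> i.+1 \notin s.
Proof.
case/andP => /(pairwiseP 0%N) pw _ is_; apply/negP => iS.
have si : (index i s < size s)%N by rewrite index_mem.
have si1 : (index i.+1 s < size s)%N by rewrite index_mem.
have [lt|lt|/(congr1 (nth 0%N s))] := ltngtP (index i s) (index i.+1 s).
- by have := pw _ _ si si1 lt; rewrite /far_apart !nth_index//; lia.
- by have := pw _ _ si1 si lt; rewrite /far_apart !nth_index//; lia.
- by rewrite !nth_index//; lia.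
Qed.

Lemma adjsK s : separated s -> (adjs s * adjs s = 1)%g.
Proof.
move=> sep; apply/permP => q; rewrite permM perm1; apply/val_inj => /=.
rewrite [LHS]adjsE//; have := adjsE q sep; case: ifPn => qs.
  by move=> ->; rewrite (negPf (separated_succ sep qs)) /= qs.
case: (ifP ((0 < q)%N && (q.-1 \in s))) => [/andP [q0 q1s]|H] ->; first by rewrite q1s prednK.
by rewrite (negPf qs) H.
Qed.

(** The staircase p, p - 1, ..., 0 with the corner cell removed from each row in [s]. *)
Definition lam s (i : 'I_p.+1) := (p - i - ((i : nat) \in s))%N.

Lemma rev0E q : rev0 q = rev_ord q.
Proof. by rewrite permE. Qed.

Lemma stairV s x : separated s -> ((stair s)^-1 (rev_ord x) = adjs s x)%g.
Proof.
move=> sep; apply: (@perm_inj _ (stair s)); rewrite permKV /stair permM.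
by have := congr1 (fun f : 'S_p.+1 => f x) (adjsK sep); rewrite permM perm1 => ->; rewrite rev0E.
Qed.

(** In the reversal all pairs are inverted. A swap in [s] restores the order of its own pair and, as
    the swaps are disjoint and not adjacent, of no other. *)
Lemma invp_stair s x y : separated s ->
  invp (stair s) (rev_ord x) (rev_ord y) = (x < y)%N && ~~ ((y == x.+1 :> nat) && ((x : nat) \in s)).
Proof.
move=> sep; rewrite /invp !stairV//=.
have xp := ltn_ord x; have yp := ltn_ord y.
have -> : (p.+1 - y.+1 < p.+1 - x.+1)%N = (x < y)%N by apply/idP/idP; lia.
case: ltnP => //= xy.
have [/andP [/eqP yx xs]|H] := boolP ((y == x.+1 :> nat) && ((x : nat) \in s)).
  rewrite !adjsE// xs yx (negPf (separated_succ sep xs)) /= xs.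
  by apply/negbTE; rewrite -leqNgt.
have : (adjs s x <= x.+1)%N /\ ((x : nat) \notin s -> adjs s x <= x)%N.
  by rewrite adjsE//; case: ifP => // _; case: ifP => _; split=> //; lia.
have : (y.-1 <= adjs s y)%N /\ (y.-1 \notin s -> y <= adjs s y)%N.
  rewrite adjsE//; case: ifP => [_|_]; first by split=> //; lia.
  by case: ifP => [/andP [_ ->]|_]; split=> //; lia.
move=> [y1 y2] [x1 x2]; rewrite /=; apply/idP => /=.
case: (boolP ((x : nat) \in s)) => xs; last first.
  have {}x2 := x2 xs; case: (eqVneq (y : nat) x.+1) => yx; last by lia.
  by have := y2 _; rewrite yx /= => /(_ xs); lia.
have yx : y != x.+1 :> nat by move: H; rewrite xs andbT.
case: (eqVneq (y : nat) x.+2) => yx2; last by lia.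
by have := y2 _; rewrite yx2 /= => /(_ (separated_succ sep xs)); lia.
Qed.

Lemma rev_ordM (F : 'I_p.+1 -> nat) : (\sum_a F a = \sum_x F (rev_ord x))%N.
Proof. by rewrite (reindex_inj rev_ord_inj). Qed.

Lemma sum_gt_ord x : (\sum_(y < p.+1) (x < y) = p - x)%N.
Proof.
have := sum_negb (fun y : 'I_p.+1 => x < y)%N.
rewrite [X in (_ + X)%N](eq_bigr (fun y : 'I_p.+1 => (y < x.+1)%N : nat)); last first.
  by move=> y _; rewrite -leqNgt ltnS.
rewrite sum_lt_ord => /(canRL (addnK _)) ->; lia.
Qed.

Lemma code_stair s x : separated s -> code (stair s) (rev_ord x) = lam s x.
Proof.
move=> sep; rewrite /code rev_ordM (eq_bigr _ (fun y _ => congr1 nat_of_bool (invp_stair x y sep))).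
rewrite /lam -sum_gt_ord; case: (boolP ((x : nat) \in s)) => xs; last first.
  by rewrite subn0; apply: eq_bigr => y _; rewrite andbF andbT.
have xp : (x.+1 < p.+1)%N by case/andP: sep => _ /allP/(_ _ xs).
rewrite [in RHS](bigD1 (Ordinal xp))//= ltnSn [in LHS](bigD1 (Ordinal xp))//= eqxx andbF add0n addKn.
by apply: eq_bigr => y yx; rewrite -val_eqE /= in yx; rewrite (negPf yx) /= andbT.
Qed.

Lemma cocode_stair s y : separated s ->
  cocode (stair s) (rev_ord y) = (y - ((0 < y) && (y.-1 \in s)))%N.
Proof.
move=> sep; rewrite /cocode rev_ordM (eq_bigr _ (fun x _ => congr1 nat_of_bool (invp_stair x y sep))).
have -> : (y - ((0 < y) && (y.-1 \in s)) = \sum_(x < p.+1) (x < y)%N - ((0 < y)%N && (y.-1 \in s)))%N.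
  by rewrite sum_lt_ord (minn_idPl _)// ltnW.
case: (boolP ((0 < y)%N && (y.-1 \in s))) => [/andP [y0 ys]|H]; last first.
  rewrite subn0; apply: eq_bigr => x _; have [yx|] := eqVneq (y : nat) x.+1; last by rewrite andbT.
  by move: H; rewrite yx /= => /negPf ->; rewrite andbT.
have yp : (y.-1 < p.+1)%N by rewrite (leq_ltn_trans (leq_pred _)).
rewrite [in RHS](bigD1 (Ordinal yp))//= [in LHS](bigD1 (Ordinal yp))//= prednK// leqnn eqxx ys addKn.
apply: eq_bigr => x yx; rewrite -val_eqE /= in yx.
by rewrite [_ == _](_ : _ = false) ?andbT//; apply/negbTE; apply: contra yx => /eqP ->.
Qed.

Lemma lam_partition s : separated s -> partition_fun (lam s).
Proof.
move=> sep i j; rewrite leq_eqVlt => /orP [/eqP/val_inj ->//|ij]; rewrite /lam.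
by case: (_ \in s); case: (_ \in s); lia.
Qed.

Lemma code_stair_col s j : separated s ->
  (\sum_a minn (code (stair s) a) j)%N = col_min (lam s) j.
Proof. by move=> sep; rewrite rev_ordM; apply: eq_bigr => x _; rewrite code_stair. Qed.

(** The cocode, once sorted, is the conjugate of [lam s], while the code is [lam s] itself. Code and
    cocode thus bound one shape from both sides of the dominance order. *)
Lemma cocode_stair_row s j : separated s ->
  (\sum_a minn (cocode (stair s) a) j = \sum_(i < p.+1 | (i < j)%N) lam s i)%N.
Proof.
move=> sep; have sp := allP (andP sep).2.
pose c (y : 'I_p.+1) := (y - ((0 < y) && (y.-1 \in s)))%N.
rewrite rev_ordM (eq_bigr (fun y => minn (c y) j)) -/(col_min c j); last first.
  by move=> y _; rewrite cocode_stair.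
have clen t : col_len c t = if (t < p.+1)%N then (p - t - (t \in s))%N else 0%N.
  rewrite /col_len; case: ltnP => tp; last first.
    by apply: big1 => y _; have := ltn_ord y; rewrite /c => ?; rewrite ltnNge; apply/eqP; rewrite eqb0 negbK; lia.
  rewrite -sum_gt_ord; case: (boolP (t \in s)) => ts; last first.
    rewrite subn0; apply: eq_bigr => y _; congr nat_of_bool; rewrite /c.
    have [y1|y1] := eqVneq (y : nat) t.+1; last by apply/idP/idP; lia.
    by rewrite y1 /= (negPf ts) subn0.
  have tp1 : (t.+1 < p.+1)%N by have := sp _ ts.
  rewrite [in RHS](bigD1 (Ordinal tp1))//= ltnSn [in LHS](bigD1 (Ordinal tp1))//= /c /= ts subn1 [(t.+1 - true)%N]subn1 /= ltnn add0n.
  by apply: eq_bigr => y; rewrite -val_eqE /= => y1; congr nat_of_bool; apply/idP/idP; lia.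
rewrite -sum_col_len; under eq_bigr do rewrite clen.
rewrite -big_mkcond /=.
pose M := maxn j p.+1.
rewrite (big_ord_widen_cond M (fun t => t < p.+1)%N (fun t => p - t - (t \in s))%N) ?leq_maxl//.
rewrite (big_ord_widen_cond M (fun t => t < j)%N (fun t => p - t - (t \in s))%N) ?leq_maxr//.
by apply: eq_bigl => t; rewrite andbC.
Qed.

Notation step := (\sum_(i < p) peel p i).

Definition red_words m w : int := act (step ^+ m) (fun x => (x == 1%g)%:R) w.

Lemma act_sum I (r : seq I) (F : I -> 'M[int]_((dim p).+1)) f v :
  act (\sum_(i <- r) F i) f v = \sum_(i <- r) act (F i) f v.
Proof.
by apply: (big_morph (fun M => act M f v)) => [M N|]; [exact: actD|exact: act0].
Qed.

Lemma red_words0 w : red_words 0 w = (w == 1%g)%:R.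
Proof. by rewrite /red_words expr0 act1. Qed.

Lemma red_wordsS m w : red_words m.+1 w =
  \sum_(i < p) if des w i then red_words m (adj p i * w)%g else 0.
Proof.
by rewrite /red_words exprS actM act_sum; apply: eq_bigr => i _; rewrite act_peel.
Qed.

Lemma red_words_gt0 w : 0 < red_words (len w) w.
Proof.
have [m] := ubnP (len w); elim: m w => // m IH w lm.
case lw: (len w) => [|k]; first by rewrite red_words0 (len_eq0 lw) eqxx.
have w1 : w != 1%g.
  apply: contra_eqN lw => /eqP ->; rewrite /len big1// => a _; rewrite /code big1// => b _.
  by rewrite /invp invg1 !perm1; case: ltngtP.
have pos_term i : des w i -> 0 < red_words k (adj p i * w)%g.
  move=> dw; have := len_adj dw; rewrite lw => -[E]; rewrite {1}E; apply: IH.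
  by rewrite -E -ltnS -lw.
have [i ip dw] := exists_des w1.
rewrite red_wordsS (bigD1 (Ordinal ip))//= dw ltr_wpDr ?pos_term//.
by apply: sumr_ge0 => j _; case: ifP => // /pos_term/ltW.
Qed.

Definition row_end s (i : 'I_p.+1) := (lam s i + (p.+1 - i.+1))%N.

Lemma len_stair s : separated s -> len (stair s) = (\sum_i lam s i)%N.
Proof. by move=> sep; rewrite /len rev_ordM; apply: eq_bigr => x _; rewrite code_stair. Qed.

Lemma row_end_decr s (i j : 'I_p.+1) : separated s -> (i < j)%N -> (row_end s j < row_end s i)%N.
Proof.
move=> sep ij; have := lam_partition sep (ltnW ij); rewrite /row_end.
by have := ltn_ord j; lia.
Qed.

Section Coefficient.
Variable F : numFieldType.

(** The multiplicity of the only surviving shape, that is, the coefficient of its Schur function at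
    [stair s]. *)
Definition stair_coef s : int := nc_coef (stair s) (jt (nc_hs p) (row_end s)).

(** An instance of [L_path_Vandermonde]. Its vanishing hypothesis is triangularity, after strictly
    decreasing sequences [mu] are rewritten as partitions [nu] plus the staircase. *)
Lemma red_words_stair s : separated s ->
  (red_words (len (stair s)) (stair s))%:~R = (stair_coef s)%:~R * (len (stair s))`!%:R *
    vdm_sign p.+1 F / (\prod_i (row_end s i)`!%:R) *
    \prod_(i < p.+1) \prod_(j < p.+1 | (i < j)%N) ((row_end s j)%:R - (row_end s i)%:R) :> F.
Proof.
move=> sep; rewrite /red_words -nc_coef_expand.
have := @L_path_Vandermonde _ _ _ _ F (nc_e0 p) (@nc_hs_rec p) (nc_coef (stair s)) (row_end s); apply => //.
- by move=> i j ij; exact: row_end_decr.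
- move=> mu mud E.
  pose nu i := (mu i - (p.+1 - i.+1))%N.
  have mu_ge (i : 'I_p.+1) : (p - i <= mu i)%N.
    have [d] : exists d, (p - i = d)%N by eexists.
    elim: d i => [|d IHd] i E'; first by rewrite E'.
    have ip : (i.+1 < p.+1)%N by lia.
    have := IHd (Ordinal ip); have := mud i (Ordinal ip) (leqnn _).
    by rewrite /=; lia.
  have muE (i : 'I_p.+1) : mu i = (nu i + (p.+1 - i.+1))%N by rewrite /nu subSS subnK.
  have nup : partition_fun nu.
    move=> i j; rewrite leq_eqVlt => /orP [/eqP/val_inj ->//|ij].
    have [d] : exists d, (j - i = d)%N by eexists.
    elim: d i ij => [|d IHd] i ij E'; first by lia.
    have ip : (i.+1 < p.+1)%N by have := ltn_ord j; lia.
    have i1 : (nu (Ordinal ip) <= nu i)%N.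
      have := mud i (Ordinal ip) (leqnn _); rewrite !muE /=.
      by have := ltn_ord j; lia.
    have [->|ji] := eqVneq j (Ordinal ip); first exact: i1.
    by rewrite (leq_trans _ i1)//; apply: IHd; rewrite -val_eqE /= in ji *; lia.
  have [||||E'|E'] := @schur_triangular _ _ (nc_e p) (nc_h p) (nc_e0 p) (@nc_hs_rec p)
    (nc_coef (stair s)) (lam s) _ _ _ nu nup.
  + exact: lam_partition.
  + exact: nc_coef_h (fun j => cocode_stair_row j sep).
  + exact: nc_coef_e (fun j => code_stair_col j sep).
  + move: E; rewrite (eq_bigr _ (fun i _ => muE i)) /row_end !big_split /=; exact: addIn.
  + by left=> i; rewrite muE E'.
  + right; rewrite -[RHS]E'; congr (nc_coef _ _); apply: eq_jt => i.
    by rewrite muE.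
- by move=> b bp; rewrite /nc_hs bp.
- by rewrite /nc_hs /= ltnn subnn nc_h0.
- by rewrite len_stair// /row_end big_split addnC.
Qed.

End Coefficient.

(* The arrangement k-1, ..., 0, k, k+1, ... after the i first peels, which have
   moved the largest of the reversed values i places to the right. *)
Definition cyc k i (x : nat) : nat :=
  if (x < i)%N then (k.-1 - x)%N else if x == i then k else if (x <= k)%N then (k - x)%N else x.

(** The only ascending product of [k] among the first [k] operators uses all of them; it carries the
    largest reversed value from the front to place [k]. *)
Lemma asc_sum_cyc k f v : (k <= p)%N -> (forall x : 'I_p.+1, v x = cyc k 0 x :> nat) ->
  exists2 v' : 'S_p.+1, (forall x : 'I_p.+1, v' x = cyc k k x :> nat) & act (asc_sum (@peel p) k k) f v = f v'.
Proof.
move=> kp vE.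
have key i : (i <= k)%N -> exists2 v' : 'S_p.+1, (forall x : 'I_p.+1, v' x = cyc k i x :> nat) &
    forall g, act (asc_sum (@peel p) i i) g v = g v'.
  elim: i => [_|i IH ik]; first by exists v => // g; rewrite /= act1.
  have [y yE yact] := IH (ltnW ik).
  have ip : (i < p)%N by exact: leq_trans ik kp.
  exists (adj p i * y)%g => [x|g].
    rewrite permM yE adjE// /cyc.
    case: (eqVneq (x : nat) i) => [->|xi] /=.
      by rewrite ltnSn [(i.+1 < i)%N]ltnNge leqnSn /= gtn_eqF// ik; lia.
    case: (eqVneq (x : nat) i.+1) => [->|xi1] /=; first by rewrite !ltnn !eqxx.
    by rewrite ltnS [in RHS]leq_eqVlt (negPf xi).
  rewrite /= asc_sum_gt// add0r actM yact act_peel ifT//.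
  rewrite /des ip/= !yE !posK ?(ltnW ip)//.
  have -> : cyc k i i = k by rewrite /cyc ltnn eqxx.
  have -> : cyc k i i.+1 = (k - i.+1)%N.
    by rewrite /cyc [(i.+1 < i)%N]ltnNge leqnSn /= gtn_eqF// ik.
  by rewrite ltn_subrL (leq_ltn_trans _ ik).
by have [v' v'E v'act] := key k (leqnn k); exists v'.
Qed.

(** An operator of index m >= k at the end of the product would need a descent at m while all values
    above m are fixed: the value at m would have to be one of these. *)
Lemma asc_sum_cyc_full k f v : (k <= p)%N -> (forall x : 'I_p.+1, v x = cyc k 0 x :> nat) ->
  act (asc_sum (@peel p) p k) f v = act (asc_sum (@peel p) k k) f v.
Proof.
move=> kp vE.
suff key d : act (asc_sum (@peel p) (k + d) k) f v = act (asc_sum (@peel p) k k) f v.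
  by rewrite -(key (p - k)%N) subnKC.
elim: d => [|d IH]; first by rewrite addn0.
rewrite addnS /= actD IH; case: k kp vE IH => [|k] kp vE IH; first by rewrite act0 addr0.
rewrite [X in _ + X](_ : _ = 0) ?addr0// actM; apply/eqP; apply: contraT => /asc_support.
case=> x [+ xv _ _]; rewrite act_peel; case: ifPn; rewrite ?eqxx// => dx _.
set m := (k.+1 + d)%N in xv dx; have /andP [mp lt] := dx.
have fixed (c : 'I_p.+1) : (m < c)%N -> x c = c.
  move=> mc; apply/val_inj; rewrite /= xv// vE /cyc /=.
  by rewrite [_ == 0]gtn_eqF 1?(leq_ltn_trans _ mc)// leqNgt (leq_ltn_trans _ mc)// /m; lia.
have lt' : (m.+1 < x (pos p m))%N by move: lt; rewrite fixed posK.
have := fixed (x (pos p m)) (ltnW lt') => /perm_inj E.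
by move: lt'; rewrite E posK ?(ltnW mp)//; lia.
Qed.

(** By [schur_diag] this is the coefficient of h_p h_(p-1) ... h_0 at the reversal. Each h_k acts in
    a single way: it brings the largest remaining value to its place and leaves a shorter
    reversal. *)
Lemma stair_coef_nil : stair_coef [::] = 1.
Proof.
have sep : separated [::] by [].
have -> : stair_coef [::] = nc_coef (stair [::]) (schur (nc_h p) (lam [::])) by [].
rewrite (@schur_diag _ _ (nc_h p) (nc_coef (stair [::])) (lam [::])); last first.
  exact: nc_coef_h (fun j => cocode_stair_row j sep).
rewrite -[LHS]/(nc_coef (stair [::]) _) nc_coefE dcomm_val_prod /=.
have key k v : (k <= p)%N -> (forall x : 'I_p.+1, v x = cyc k 0 x :> nat) ->
    act (\prod_(j < k.+1) asc_sum (@peel p) p (k - j)) (fun x => (x == 1%g)%:R) v = 1.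
  elim: k v => [|k IH] v kp vE; rewrite big_ord_recl actM subn0;
    set g := act (\prod_(i < _) _) _; rewrite asc_sum_cyc_full//;
    have [v' v'E ->] := asc_sum_cyc g kp vE; rewrite {}/g.
    rewrite big_ord0 act1; case: eqP => // [[]]; apply/permP => x; rewrite perm1; apply/val_inj.
    by rewrite /= v'E /cyc; case: (x : nat).
  rewrite (eq_bigr (fun j : 'I_k.+1 => asc_sum (@peel p) p (k - j))) // IH ?(ltnW kp)// => x.
  rewrite v'E /cyc /=; case: (posnP x) => [->|x0]; first by rewrite /= subn0.
  by rewrite ltnS; case: (leqP x k) => // kx; case: eqVneq => [->//|xk]; rewrite ifN// -ltnNge ltn_neqAle eq_sym xk.
rewrite (eq_bigr (fun j : 'I_p.+1 => asc_sum (@peel p) p (p - j))); last first.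
  by move=> j _; rewrite /lam subn0.
apply: key => // x; rewrite /stair /adjs big_nil mul1g rev0E /cyc /=.
by rewrite -ltnS ltn_ord subSS; case: eqP => // ->; rewrite subn0.
Qed.

End Staircase.

(** * Vandermonde ratios and the law of one swap *)

Section Vandermonde.
Variables (K : realFieldType) (n : nat).
Implicit Types (x : 'I_n -> K) (b : 'I_n -> bool).

Definition vdm x : K := \prod_(i < n) \prod_(j < n | (i < j)%N) (x j - x i).

(** The factor by which the difference of [x i] and [x j] changes when [x i] alone is lowered by
    1. *)
Definition drop_factor x (i j : 'I_n) : K := 1 - (x i - x j)^-1.

Definition drop_prod x (k : 'I_n) : K := \prod_(j | j != k) drop_factor x k j.

Lemma prod_pairs (F : 'I_n -> 'I_n -> K) :
  \prod_i \prod_(j | j != i) F i j = \prod_(i < n) \prod_(j < n | (i < j)%N) (F i j * F j i).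
Proof.
under [RHS]eq_bigr do rewrite big_split /=.
rewrite [RHS]big_split /= [X in _ * X](exchange_big_dep xpredT)//= -big_split /=.
apply: eq_bigr => i _; rewrite (bigID (fun j : 'I_n => i < j)%N) /=; congr (_ * _).
  by apply: eq_bigl => j; rewrite -val_eqE /=; lia.
by apply: eq_bigl => j; rewrite -val_eqE /=; lia.
Qed.

Lemma vdm_drop x b : injective x ->
  vdm (fun i => x i - (b i)%:R) =
  vdm x * \prod_(i < n) \prod_(j < n | (i < j)%N) (1 - ((b j)%:R - (b i)%:R) / (x j - x i)).
Proof.
move=> xI; rewrite /vdm -big_split /=; apply: eq_bigr => i _; rewrite -big_split /=.
apply: eq_bigr => j ij; rewrite mulrBr mulr1 mulrCA mulfV ?mulr1; first by ring.
by rewrite subr_eq0 (inj_eq xI) -val_eqE /= gtn_eqF.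
Qed.

Lemma vdm_drop1 x k : injective x ->
  vdm (fun i => x i - (i == k)%:R) = vdm x * drop_prod x k.
Proof.
move=> xI; rewrite vdm_drop//; congr (_ * _).
pose F i j := if i == k then drop_factor x i j else 1.
transitivity (\prod_i \prod_(j | j != i) F i j).
  rewrite prod_pairs; apply: eq_bigr => i _; apply: eq_bigr => j ij.
  rewrite /F /drop_factor; have ji : j != i by rewrite -val_eqE /= gtn_eqF.
  have [ik|ik] := eqVneq i k; have [jk|jk] := eqVneq j k.
  - by rewrite ik jk eqxx in ji.
  - by rewrite /= mulr0n mulr1n mulr1 sub0r mulN1r -invrN opprB opprK.
  - by rewrite /= mulr0n mulr1n mul1r subr0 mul1r.
  - by rewrite subrr mul0r subr0 mulr1.
rewrite (bigD1 k)//= [X in _ * X]big1 ?mulr1.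
  by apply: eq_bigr => j _; rewrite /F eqxx.
by move=> i /negPf ik; apply: big1 => j _; rewrite /F ik.
Qed.

Lemma vdm_neq0 x : injective x -> vdm x != 0.
Proof.
move=> xI; apply/prodf_neq0 => i _; apply/prodf_neq0 => j ij.
by rewrite subr_eq0 (inj_eq xI) -val_eqE /= gtn_eqF.
Qed.

(** With ffact_j the falling factorial, x ffact_j(x - 1) = (x - j) ffact_j(x). So lowering [x k] and
    multiplying by [x k] is what [sum_det_row] does to row [k], with y_j = j. *)
Lemma sum_drop_prod x : injective x ->
  \sum_k x k * drop_prod x k = \sum_i x i - \sum_(j < n) j%:R.
Proof.
move=> xI; apply: (mulIf (vdm_neq0 xI)).
have vE y : vdm y = \det (\matrix_(i < n, j < n) (ffact_poly K j).[y i]).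
  by rewrite det_poly_Vandermonde//; [exact: ffact_poly_monic|exact: size_ffact_poly].
rewrite [in RHS]vE -sum_det_row mulr_suml; apply: eq_bigr => k _.
rewrite -mulrA [_ * vdm x]mulrC -vdm_drop1// vE.
pose d : 'rV_n := \row_i (if i == k then x i else 1).
have -> : x k = \det (diag_mx d).
  rewrite det_diag (bigD1 k)//= mxE eqxx big1 ?mulr1// => i /negPf ik.
  by rewrite mxE ik.
rewrite -det_mulmx; congr (\det _); apply/matrixP => i j; rewrite mul_diag_mx !mxE.
case: eqP => [_|_]; last by rewrite subr0.
elim: (j : nat) => [|m IH]; first by rewrite /ffact_poly big_ord0 !hornerC mulr1 subr0 mulr1.
rewrite ffact_polyS !hornerM mulrA IH !hornerE -[m.+1%:R]natr1 mulr1n /=; ring.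
Qed.

(** The two sides differ only in pairs that are lowered together: such a pair keeps its difference
    on the right and contributes 1 - z^2 on the left. Gaps above 1 make all factors positive. *)
Lemma vdm_drop_ge x b : injective x -> (forall i j, i != j -> 1 < `|x i - x j|) ->
  \prod_(k | b k) drop_prod x k <= vdm (fun i => x i - (b i)%:R) / vdm x.
Proof.
move=> xI xgap; rewrite vdm_drop// mulrAC mulfV ?vdm_neq0// mul1r.
pose F i j := if b i then drop_factor x i j else 1.
have f0 i j : i != j -> 0 < drop_factor x i j.
  move=> ij; rewrite /drop_factor subr_gt0.
  apply: (le_lt_trans (ler_norm _)); rewrite normfV invf_lt1 ?xgap//.
  by rewrite (lt_trans ltr01)// xgap.
have -> : \prod_(k | b k) drop_prod x k = \prod_i \prod_(j | j != i) F i j.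
  rewrite big_mkcond; apply: eq_bigr => i _; rewrite /F /drop_prod.
  by case: (b i) => //; rewrite big1.
rewrite prod_pairs; apply: ler_prod => i _; apply/andP; split.
  apply: prodr_ge0 => j ij; have ji : j != i by rewrite -val_eqE /= gtn_eqF.
  by rewrite mulr_ge0// /F; case: ifP => // _; rewrite ltW// f0// eq_sym.
apply: ler_prod => j ij; have ji : j != i by rewrite -val_eqE /= gtn_eqF.
apply/andP; split.
  by rewrite mulr_ge0// /F; case: ifP => // _; rewrite ltW// f0// eq_sym.
rewrite /F /drop_factor; case: (b i); case: (b j) => /=.
- rewrite subrr mul0r subr0 -[x j - x i]opprB invrN opprK.
  by set z := (_)^-1; have := sqr_ge0 z; rewrite expr2; nra.
- by rewrite mulr0n mulr1n mulr1 sub0r mulN1r -invrN opprB opprK.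
- by rewrite mulr0n mulr1n mul1r subr0 mul1r.
- by rewrite subrr mul0r subr0 mulr1.
Qed.

End Vandermonde.

Lemma ffact_le_exp n k : (n ^_ k <= n ^ k)%N.
Proof.
elim: k => [|k IH]; first by rewrite ffactn0.
by rewrite ffactnSr expnSr leq_mul// leq_subr.
Qed.

Section Swaps.
Variables (F : realFieldType) (p : nat).
Implicit Types s : seq nat.

(** The row ends of the full staircase: p - i cells in row i, shifted by p - i. *)
Let x (i : 'I_p.+1) : F := (2 * (p - i))%:R.

Let x_inj : injective x.
Proof.
move=> i j /eqP; rewrite /x eqr_nat => /eqP E; apply/val_inj => /=.
by have := ltn_ord i; have := ltn_ord j; lia.
Qed.

Let xE (i : 'I_p.+1) : x i = 2 * (p%:R - i%:R).
Proof. by rewrite /x natrM natrB// -ltnS. Qed.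

Let x_gap i j : i != j -> 1 < `|x i - x j|.
Proof.
move=> ij; rewrite !xE.
have -> : 2 * (p%:R - i%:R) - 2 * (p%:R - j%:R) = 2 * (j%:R - i%:R) :> F by ring.
have le1 : 1 <= `|j%:R - i%:R : F|.
  case: (ltngtP i j) => [lt|lt|/val_inj E]; last by rewrite E eqxx in ij.
    by rewrite ger0_norm -?natrB ?ler0n ?ler1n ?subn_gt0// ltnW.
  by rewrite distrC ger0_norm -?natrB ?ler0n ?ler1n ?subn_gt0// ltnW.
by rewrite normrM [`|2|]ger0_norm//; lra.
Qed.

Definition wallis (m : nat) : F := \prod_(t < m) ((2 * t + 3)%:R / (2 * t + 2)%:R).

(* Probability that the first swap of a uniform network on p + 1 particles is at
   the location indexed by k < p. *)
Definition swap_prob (k : nat) : F := wallis k * wallis (p.-1 - k) / 'C(p.+1, 2)%:R.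

Lemma wallis_shift m :
  (2 * m.+1)%:R * \prod_(t < m.+1) ((2 * t + 1)%:R / (2 * t + 2)%:R) = wallis m :> F.
Proof.
elim: m => [|m IH]; first by rewrite /wallis big_ord1 big_ord0 muln1 mulrCA mulfV ?mulr1// pnatr_eq0.
rewrite /wallis [RHS]big_ord_recr -/(wallis m) -IH [in LHS]big_ord_recr /=.
have -> : (2 * m.+2 = 2 * m.+1 + 2)%N by lia.
have -> : (2 * m + 3 = 2 * m.+1 + 1)%N by lia.
have -> : (2 * m + 2 = 2 * m.+1)%N by lia.
have m1 : (2 * m.+1)%:R != 0 :> F by rewrite pnatr_eq0.
have m2 : (2 * m.+1 + 2)%:R != 0 :> F by rewrite pnatr_eq0 addn2.
move: m1 m2; move: (\prod_(_ < _) _) (2 * m.+1)%:R (2 * m.+1 + 2)%:R (2 * m.+1 + 1)%:R => P a b c a0 b0.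
by field; rewrite a0 b0.
Qed.

(** The points before [k] give factors (2t + 3)/(2t + 2), those after [k] give (2t + 1)/(2t + 2). By
    [wallis_shift] the factor [x k] turns the second product into a Wallis product too. *)
Lemma drop_prodE (k : 'I_p.+1) : (k < p)%N ->
  x k * drop_prod x k = wallis k * wallis (p.-1 - k).
Proof.
move=> kp; rewrite /drop_prod (bigID (fun j : 'I_p.+1 => j < k)%N) /= mulrCA; congr (_ * _).
  pose G (j : nat) : F := (2 * (k - j.+1) + 3)%:R / (2 * (k - j.+1) + 2)%:R.
  transitivity (\prod_(j < p.+1 | (j < k)%N) G j).
    apply: eq_big => [j|j /andP [_ jk]].
      by rewrite -val_eqE /=; lia.
    rewrite /drop_factor !xE /G.
    have -> : (2 * (k - j.+1) + 3 = 2 * (k - j) + 1)%N by lia.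
    have -> : (2 * (k - j.+1) + 2 = 2 * (k - j))%N by lia.
    rewrite natrD natrM natrB ?(ltnW jk)//.
    have d0 : k%:R - j%:R != 0 :> F by rewrite subr_eq0 eqr_nat gtn_eqF.
    have -> : 2 * (p%:R - k%:R) - 2 * (p%:R - j%:R) = - (2 * (k%:R - j%:R)) :> F by ring.
    by move: d0; move: (k%:R - j%:R) => a a0; field; rewrite a0.
  rewrite -(big_ord_widen p.+1 G) 1?ltnW// (reindex_inj rev_ord_inj) /=.
  apply: eq_bigr => j _; rewrite /G; have jk := ltn_ord j.
  by have -> : (k - (k - j.+1).+1 = j)%N by lia.
have -> : (p.-1 - k = (p - k).-1)%N by lia.
rewrite -wallis_shift prednK ?subn_gt0//; congr (_ * _).
pose G (j : nat) : F := (2 * (j - k.+1) + 1)%:R / (2 * (j - k.+1) + 2)%:R.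
transitivity (\prod_(j < p.+1 | true && (k.+1 <= j)%N) G j).
  apply: eq_big => [j|j /andP [jk /negbTE jk']].
    by rewrite -val_eqE /=; lia.
  have {jk jk'} kj : (k < j)%N by move: jk jk'; rewrite -val_eqE /=; lia.
  rewrite /drop_factor !xE /G.
  have -> : (2 * (j - k.+1) + 2 = 2 * (j - k))%N by lia.
  have d1 : j%:R - k%:R != 0 :> F by rewrite subr_eq0 eqr_nat gtn_eqF.
  have -> : (2 * (j - k.+1) + 1)%:R = 2 * (j%:R - k%:R) - 1 :> F.
    by rewrite natrD natrM natrB// -[k.+1%:R]natr1; ring.
  rewrite natrM natrB ?(ltnW kj)//.
  have -> : 2 * (p%:R - k%:R) - 2 * (p%:R - j%:R) = 2 * (j%:R - k%:R) :> F by ring.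
  by move: d1; move: (j%:R - k%:R) => a a0; field; rewrite a0.
rewrite -(big_geq_mkord k.+1 p.+1 xpredT G) -[X in \big[_/_]_(X <= _ < _ | _) _]add0n big_addn subSS big_mkord; apply: eq_bigr => j _.
by rewrite /G addnK.
Qed.

(** In [sum_drop_prod] the row ends sum to twice C(p + 1, 2) and the indices to C(p + 1, 2). The
    last row end is 0, which leaves the p locations. *)
Lemma sum_swap_prob : (0 < p)%N -> \sum_(k < p) swap_prob k = 1.
Proof.
move=> p0; have N0 : 'C(p.+1, 2)%:R != 0 :> F.
  by rewrite pnatr_eq0 -lt0n bin_gt0; lia.
rewrite -mulr_suml; apply: (canLR (mulfK N0)); rewrite mul1r.
have := sum_drop_prod x_inj; rewrite big_ord_recr /= [x ord_max](_ : _ = 0) ?mul0r ?addr0; last first.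
  by rewrite /x /= subnn.
rewrite (eq_bigr (fun k : 'I_p => wallis k * wallis (p.-1 - k))) => [->|k _]; last first.
  by rewrite drop_prodE /=.
rewrite (eq_bigr _ (fun i _ => xE i)) -mulr_sumr sumrB.
have -> : \sum_(i < p.+1) i%:R = 'C(p.+1, 2)%:R :> F by rewrite -natr_sum -bin2_sum big_mkord.
rewrite sumr_const card_ord -[p%:R *+ _]mulr_natr.
have E : p%:R * p.+1%:R = 2 * 'C(p.+1, 2)%:R :> F.
  by rewrite -!natrM -mul_bin_diag bin1 mulnC.
by rewrite mulrBr E; ring.
Qed.

Lemma len_stair_nil : len (stair p [::]) = 'C(p.+1, 2).
Proof.
rewrite len_stair// -bin2_sum big_mkord (reindex_inj rev_ord_inj) /=.
by apply: eq_bigr => i _; rewrite /lam /= subn0; have := ltn_ord i; lia.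
Qed.

Let sep_lt s : separated p s -> all (fun k => k < p)%N s.
Proof. by case/andP. Qed.

Let sep_uniq s : separated p s -> uniq s.
Proof.
case/andP => pw _; rewrite uniq_pairwise; apply: sub_pairwise pw => i j.
by rewrite /far_apart => H; apply/eqP => E; move: H; rewrite E; lia.
Qed.

Let big_sep (T : Type) (idx : T) (op : Monoid.com_law idx) s (G : nat -> T) : separated p s ->
  \big[op/idx]_(k <- s) G k = \big[op/idx]_(i < p.+1 | (i : nat) \in s) G i.
Proof.
move=> sep; rewrite -(big_mkord (fun i => i \in s)) -[RHS]big_filter.
apply: perm_big; apply: uniq_perm; rewrite ?filter_uniq ?iota_uniq ?sep_uniq// => k.
rewrite mem_filter mem_index_iota /=; case: (boolP (k \in s)) => //= ks.
by rewrite ltnS ltnW//; exact: (allP (sep_lt sep)).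
Qed.

Lemma len_stair_sub s : separated p s -> (len (stair p s) + size s = 'C(p.+1, 2))%N.
Proof.
move=> sep; rewrite -len_stair_nil !len_stair//.
have -> : size s = (\sum_(i < p.+1 | (i : nat) \in s) 1)%N.
  by rewrite -sum1_size; exact: big_sep.
rewrite [X in (_ + X)%N]big_mkcond -big_split.
apply: eq_bigr => i _; rewrite /lam /= subn0; case: ifP => is_; last by rewrite subn0 addn0.
by have := allP (sep_lt sep) _ is_; lia.
Qed.

Notation words s := (red_words (len (stair p s)) (stair p s)).

Let row_endE s i : separated p s ->
  (row_end s i)%:R = x i - ((i : nat) \in s)%:R :> F.
Proof.
move=> sep; rewrite /x -natrB.
  congr _%:R; rewrite /row_end /lam; case: (boolP (_ \in s)) => is_; last by lia.
  by have := allP (sep_lt sep) _ is_; lia.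
by case: (boolP (_ \in s)) => //= is_; have := allP (sep_lt sep) _ is_; lia.
Qed.

Let words_formula s : separated p s ->
  (words s)%:~R = (stair_coef p s)%:~R * ((len (stair p s))`!%:R *
    vdm_sign p.+1 F / (\prod_i (@row_end p s i)`!%:R) * vdm x) *
    (vdm (fun i => x i - ((i : nat) \in s)%:R) / vdm x) :> F.
Proof.
move=> sep; rewrite red_words_stair//.
have -> : vdm (fun i => x i - ((i : nat) \in s)%:R) =
   \prod_(i < p.+1) \prod_(j < p.+1 | (i < j)%N) ((@row_end p s j)%:R - (@row_end p s i)%:R).
  by apply: eq_bigr => i _; apply: eq_bigr => j _; rewrite !row_endE.
have := vdm_neq0 x_inj; move: (vdm x) (_^-1) => v Ri v0.
move: (\prod_(i < _) \prod_(j < _ | _) _) => V.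
by field.
Qed.

Let fact_prod s : separated p s -> \prod_i (@row_end p [::] i)`!%:R =
  (\prod_(i < p.+1 | (i : nat) \in s) x i) * \prod_i (@row_end p s i)`!%:R :> F.
Proof.
move=> sep; rewrite [X in X * _]big_mkcond -big_split; apply: eq_bigr => i _ /=.
rewrite /row_end /lam; case: (boolP ((i : nat) \in s)) => is_; last by rewrite mul1r.
have ip := allP (sep_lt sep) _ is_; rewrite /x -natrM; congr _%:R.
have -> : (2 * (p - i) = (p - i - true + (p.+1 - i.+1)).+1)%N by lia.
by rewrite -factS; congr (_ `!); rewrite subn0; lia.
Qed.

(** In the ratio of the two formulas the factorials of the row ends leave the product of the [x i],
    the Vandermonde products are handled by [vdm_drop_ge], and N! / m! is at most N^(size s). *)
Lemma red_words_ge s : separated p s ->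
  (words [::])%:~R * \prod_(k <- s) swap_prob k <= (words s)%:~R :> F.
Proof.
move=> sep; have sep0 : separated p [::] by [].
have s_lt := allP (sep_lt sep).
set N := 'C(p.+1, 2).
have := words_formula sep; have := words_formula sep0.
rewrite stair_coef_nil mul1r.
have -> : vdm (fun i => x i - ((i : nat) \in [::])%:R) = vdm x.
  by apply: eq_bigr => i _; apply: eq_bigr => j _; rewrite !subr0.
rewrite mulfV ?vdm_neq0// mulr1 (fact_prod sep) len_stair_nil.
set Rs := \prod_i (@row_end p s i)`!%:R; set V := vdm x; set sg := vdm_sign p.+1 F.
set X := \prod_(i < p.+1 | _) x i; set m := len (stair p s).
have Rs0 : 0 < Rs by apply: prodr_gt0 => i _; rewrite ltr0n fact_gt0.
have X0 : 0 < X.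
  by apply: prodr_gt0 => i is_; rewrite /x ltr0n muln_gt0 subn_gt0 s_lt.
set r := _ / V => E0 Es.
have r_ge : \prod_(k < p.+1 | (k : nat) \in s) drop_prod x k <= r by exact: vdm_drop_ge.
set Q := \prod_(k < p.+1 | _) drop_prod x k in r_ge.
have Q0 : 0 <= Q.
  apply: prodr_ge0 => i _; apply: prodr_ge0 => j ji; rewrite /drop_factor subr_ge0.
  apply: (le_trans (ler_norm _)); rewrite normfV invf_le1 ?ltW ?x_gap 1?eq_sym//.
  by rewrite (lt_trans ltr01)// x_gap// eq_sym.
have pE : \prod_(k <- s) swap_prob k = X * Q / N%:R ^+ size s.
  have -> : N%:R ^+ size s = \prod_(i < p.+1 | (i : nat) \in s) N%:R :> F.
    by rewrite -[in LHS](sum1_size s) -prodrXr; exact: big_sep.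
  have -> : \prod_(k <- s) swap_prob k = \prod_(i < p.+1 | (i : nat) \in s) swap_prob i.
    exact: big_sep.
  rewrite /X /Q -big_split -prodf_div /=; apply: eq_bigr => i is_.
  by rewrite /swap_prob -drop_prodE ?s_lt.
have N_fact : (N`!%:R : F) <= m`!%:R * N%:R ^+ size s.
  rewrite -natrX -natrM ler_nat /N -(len_stair_sub sep) -/m.
  have := ffact_fact (leq_addl m (size s)); rewrite addnK => <-.
  by rewrite mulnC leq_mul// ffact_le_exp.
have G0 : 0 < (words [::])%:~R :> F by rewrite ltr0z red_words_gt0.
have Gs : 0 < (words s)%:~R :> F by rewrite ltr0z red_words_gt0.
have Nf0 : 0 < N`!%:R :> F by rewrite ltr0n fact_gt0.
have mf0 : 0 < m`!%:R :> F by rewrite ltr0n fact_gt0.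
have Nk0 : 0 < N%:R ^+ size s :> F.
  by rewrite lt0r exprn_ge0// andbT; apply: contraTneq N_fact => ->; rewrite mulr0 -ltNge.
(* All that is common to the two formulas, sign included; [WE] makes it positive through the count
   for the empty word. *)
pose W := m`!%:R * sg / Rs * V.
have WE : W = (words [::])%:~R * m`!%:R * X / N`!%:R.
  by rewrite len_stair_nil E0 /W; field; rewrite !gt_eqF.
have W0 : 0 < W by rewrite WE divr_gt0// !mulr_gt0.
have Es' : (words s)%:~R = (stair_coef p s)%:~R * W * r by [].
have r0 : 0 < r.
  by rewrite lt0r (le_trans Q0 r_ge) andbT; apply: contraTneq Gs => rE; rewrite Es' rE mulr0 ltxx.
(* The count and the other factors are positive, hence so is this integer. *)
have c1 : 1 <= (stair_coef p s)%:~R :> F.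
  by rewrite ler1z -gtz0_ge1 -(ltr0z F) -(pmulr_lgt0 _ (mulr_gt0 W0 r0)) mulrA -Es'.
rewrite Es' pE; apply: (@le_trans _ _ (W * Q)); last first.
  apply: (@le_trans _ _ (W * r)); first by rewrite ler_pM2l.
  by rewrite -mulrA ler_peMl// mulr_ge0// ltW.
rewrite len_stair_nil in WE G0; rewrite WE; set g := (red_words _ _)%:~R in G0 *.
have -> : g * (X * Q / N%:R ^+ size s) = g * X * Q * (N%:R ^+ size s)^-1 by rewrite !mulrA.
have -> : g * m`!%:R * X / N`!%:R * Q = g * X * Q * (m`!%:R / N`!%:R) by ring.
apply: ler_wpM2l; first by rewrite !mulr_ge0// ltW.
by rewrite ler_pdivlMr// mulrC ler_pdivrMr.
Qed.
End Swaps.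

(** * Prefixes of uniform networks *)

Lemma sum_tuple_cons (V : nmodType) (T : finType) m (Q : seq T -> V) :
  \sum_(w : m.+1.-tuple T) Q w = \sum_(i : T) \sum_(w : m.-tuple T) Q (i :: w).
Proof.
rewrite pair_big /= (reindex (fun iw : T * m.-tuple T => [tuple of iw.1 :: iw.2])) //=.
exists (fun w => (thead w, [tuple of behead w])) => [[i w] _ | w _] /=.
  by rewrite theadE; congr (_, _); apply/val_inj.
by apply/val_inj => /=; rewrite [in RHS](tuple_eta w).
Qed.

Section Networks.
Variable p : nat.
Notation N := 'C(p.+1, 2).
Implicit Types (s : seq 'I_p) (v : 'S_p.+1).

Definition word_prod s : 'S_p.+1 := (\prod_(i <- s) adj p i)%g.

Lemma adj_transpE (i : 'I_p.+1.-1) : adj_transp i = adj p i.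
Proof.
rewrite /adj_transp /adj; have ip : (i < p)%N := ltn_ord i.
by congr tperm; apply/val_inj; rewrite /= posK// ltnW.
Qed.

(** Reversing a word inverts its product, and the reversal permutation is its own inverse. *)
Lemma is_networkE (w : N.-tuple 'I_p.+1.-1) : is_network w = (word_prod w == rev0 p).
Proof.
have rv : ((rev0 p)^-1 = rev0 p)%g.
  by apply/eqP; rewrite eq_invg_mul; apply/eqP/permP => x; rewrite permM !rev0E rev_ordK perm1.
rewrite /is_network -[rev_perm p.+1]/(rev0 p) (_ : (\prod_(s <- rev w) adj_transp s)%g = (word_prod w)^-1%g).
  by rewrite -[X in _ == X]rv (inj_eq invg_inj).
rewrite /word_prod; elim: (tval w) => [|i s IH]; first by rewrite !big_nil invg1.
by rewrite rev_cons -cats1 big_cat big_seq1 IH big_cons invMg tpermV adj_transpE.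
Qed.

Definition count_words m v : int := \sum_(w : m.-tuple 'I_p) (word_prod w == v)%:R.

Lemma count_words0 v : count_words 0 v = (v == 1%g)%:R.
Proof.
rewrite /count_words (big_pred1 [tuple]) => [|w]; last by apply/esym/eqP; exact: tuple0.
by rewrite /word_prod big_nil eq_sym.
Qed.

Lemma count_wordsS m v : count_words m.+1 v = \sum_(i < p) count_words m (adj p i * v)%g.
Proof.
rewrite /count_words (sum_tuple_cons _ (fun w => (word_prod w == v)%:R)); apply: eq_bigr => i _; apply: eq_bigr => w _.
rewrite /word_prod big_cons; congr (_ : bool)%:R; apply/eqP/eqP => [<-|->].
  by rewrite adjMK.
by rewrite adjMK.
Qed.

Lemma des_adjN v i : (i < p)%N -> ~~ des v i -> des (adj p i * v)%g i.
Proof.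
move=> ip; rewrite /des ip /= !permM adj_pos// adj_posS// -leqNgt => le.
rewrite ltn_neqAle le andbT; apply/eqP => /val_inj/perm_inj/(congr1 val).
by rewrite /= !posK// 1?ltnW// => /eqP; rewrite ltn_eqF.
Qed.

Lemma len_adjN v i : (i < p)%N -> ~~ des v i -> len (adj p i * v)%g = (len v).+1.
Proof. by move=> ip dv; rewrite (len_adj (des_adjN ip dv)) adjMK. Qed.

Lemma count_words_gt m v : (m < len v)%N -> count_words m v = 0.
Proof.
elim: m v => [|m IH] v mv.
  rewrite count_words0; case: eqP => // v1; move: mv; rewrite v1 /len big1// => a _.
  by rewrite /code big1// => b _; rewrite /invp invg1 !perm1; case: ltngtP.
rewrite count_wordsS big1// => i _; apply: IH.
have [dv|dv] := boolP (des v i); first by move: mv; rewrite (len_adj dv).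
by rewrite len_adjN// (leq_trans (ltnW mv)).
Qed.

(** A letter that is not a descent raises the length, and then too few letters remain. *)
Lemma count_words_len m v : len v = m -> count_words m v = red_words m v.
Proof.
elim: m v => [|m IH] v lv; first by rewrite count_words0 red_words0.
rewrite count_wordsS red_wordsS; apply: eq_bigr => i _.
case: ifPn => dv; first by apply: IH; move: lv; rewrite (len_adj dv) => -[].
by rewrite count_words_gt// len_adjN// lv leqW.
Qed.

Lemma count_prefix M s v :
  \sum_(w : (size s + M).-tuple 'I_p) ((take (size s) w == s) && (word_prod w == v))%:R =
  count_words M ((word_prod s)^-1 * v)%g.
Proof.
elim: s v => [|i s IH] v.
  rewrite [in RHS]/word_prod big_nil invg1 mul1g; apply: eq_bigr => w _.
  by rewrite take0.
rewrite (sum_tuple_cons _ (fun w => ((take (size (i :: s)) w == i :: s) && (word_prod w == v))%:R)).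
rewrite (bigD1 i)//= [X in _ + X]big1 ?addr0; last first.
  by move=> j ji; apply: big1 => w _; rewrite eqseq_cons (negPf ji).
have -> : ((word_prod (i :: s))^-1 * v = (word_prod s)^-1 * (adj p i * v))%g.
  by rewrite /word_prod big_cons invMg tpermV mulgA.
rewrite -IH; apply: eq_bigr => w _; rewrite eqseq_cons eqxx /=; congr (_ && _)%:R.
rewrite /word_prod big_cons; apply/eqP/eqP => [<-|->]; by rewrite adjMK.
Qed.

Lemma sum_network (V : nmodType) (G : seq 'I_p -> V) :
  \sum_(w : network p.+1) G (val (val w)) = \sum_(w : N.-tuple 'I_p | word_prod w == rev0 p) G w.
Proof.
rewrite [RHS](eq_bigl (fun w : N.-tuple 'I_p => @is_network p.+1 w)); last first.
  by move=> w; rewrite is_networkE.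
rewrite [RHS](reindex_omap (val : network p.+1 -> _) insub) /=; last first.
  by move=> w Pw; rewrite insubT.
by apply: eq_bigl => -[w wP] /=; rewrite insubT wP /= eqxx.
Qed.

Notation sep s := (separated p [seq val i | i <- s]).

Lemma network_prefix s : sep s ->
  \sum_(w : network p.+1) (take (size s) (val (val w)) == s)%:R =
  red_words (len (stair p [seq val i | i <- s])) (stair p [seq val i | i <- s]) :> int.
Proof.
move=> ss; set s' := [seq val i | i <- s] in ss *.
have := len_stair_sub ss; rewrite size_map addnC; set M := len _ => E.
rewrite (sum_network (fun w => (take (size s) w == s)%:R : int)) big_mkcond /=.
transitivity (\sum_(w : N.-tuple 'I_p) ((take (size s) w == s) && (word_prod w == rev0 p))%:R : int).
  by apply: eq_bigr => w _; case: eqP; case: eqP.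
move: N E => N' <-; rewrite count_prefix -count_words_len//; congr count_words.
rewrite /stair; congr (_ * _)%g; apply/eqP; rewrite eq_invg_mul.
have -> : word_prod s = adjs p s' by rewrite /word_prod /adjs big_map.
by rewrite adjsK.
Qed.

Lemma card_network : (#|{: network p.+1}|%:R : int) = red_words (len (stair p [::])) (stair p [::]).
Proof.
rewrite -(@network_prefix [::])//= -sumr_const; apply: eq_bigr => w _.
by rewrite take0.
Qed.

Definition rotate s := if s is i :: s' then rcons s' (rev_ord i) else [::].

Lemma size_rotate s : size (rotate s) = size s.
Proof. by case: s => //= i s; rewrite size_rcons. Qed.

Lemma rotate_inj : injective rotate.
Proof.
case=> [|i s] [|j t] //=; [by case: t|by case: s|].
by move=> /rcons_inj [-> E]; rewrite (@rev_ord_inj p i j)//; exact: val_inj.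
Qed.

(** Conjugation by the reversal takes the transposition at [i] to the one at [rev_ord i]. *)
Lemma word_prod_rotate s : (word_prod (rotate s) == rev0 p) = (word_prod s == rev0 p).
Proof.
case: s => //= i s; rewrite /word_prod big_cons -cats1 big_cat big_seq1 /=.
have E : (rev0 p * adj p (rev_ord i) = adj p i * rev0 p)%g.
  rewrite [RHS]conjgC; congr (_ * _)%g; rewrite /adj tpermJ tpermC !rev0E.
  have ip := ltn_ord i.
  by congr tperm; apply/val_inj; rewrite /= !posK//; lia.
apply/eqP/eqP => H.
  rewrite (_ : \prod_(_ <- _) _ = adj p i * rev0 p)%g ?adjMK//.
  by rewrite -E -H -mulgA adjK mulg1.
rewrite (_ : \prod_(_ <- _) _ = rev0 p * adj p (rev_ord i))%g; first by rewrite -mulgA adjK mulg1.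
by rewrite E -H adjMK.
Qed.

Lemma sum_network_rotate (V : nmodType) (G : seq 'I_p -> V) k :
  \sum_(w : network p.+1) G (iter k rotate (val (val w))) = \sum_(w : network p.+1) G (val (val w)).
Proof.
elim: k G => // k IH G; rewrite -[RHS](IH G) (sum_network (fun w => G (iter k.+1 rotate w))).
rewrite (sum_network (fun w => G (iter k rotate w))).
have szP (w : N.-tuple 'I_p) : size (rotate w) == N by rewrite size_rotate size_tuple.
rewrite [RHS](reindex_inj (h := fun w : N.-tuple 'I_p => Tuple (szP w))) /=; last first.
  by move=> w w' /(congr1 val) /rotate_inj /val_inj.
by apply: eq_big => [w|w _]; [rewrite word_prod_rotate|rewrite -iterSr].
Qed.

Lemma take_rotate m k s : (k + m <= size s)%N -> take m (iter k rotate s) = take m (drop k s).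
Proof.
elim: k s => [|k IH] s H; first by rewrite drop0.
case: s H => // i s H; rewrite iterSr IH ?size_rotate ?(ltnW H)//= -cats1 drop_cat.
have ks : (k + m <= size s)%N by [].
case: ltnP => ks'; first by rewrite takel_cat// size_drop; lia.
have -> : m = 0%N by lia.
by rewrite !take0.
Qed.

(** A window at [k] is a prefix after [k] rotations; the bound on [k + m] keeps it clear of the
    reflected letters. *)
Lemma network_shift (V : nmodType) (G : seq 'I_p -> V) k m : (k + m <= N)%N ->
  \sum_(w : network p.+1) G (take m (drop k (val (val w)))) =
  \sum_(w : network p.+1) G (take m (val (val w))).
Proof.
move=> km; rewrite -[RHS](sum_network_rotate (fun s => G (take m s)) k).
by apply: eq_bigr => w _; rewrite take_rotate// size_tuple.
Qed.

End Networks.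

(** * Concentration of window averages *)

Section IidWords.
Variables (R : realFieldType) (T : finType) (pr : T -> R).
Hypothesis pr_ge0 : forall i, 0 <= pr i.
Hypothesis pr_sum : \sum_i pr i = 1.

Definition iid m (Q : seq T -> R) : R :=
  \sum_(s : m.-tuple T) (\prod_(i <- s) pr i) * Q s.

Lemma iid0 Q : iid 0 Q = Q [::].
Proof.
rewrite /iid (big_pred1 [tuple]) => [|s]; last by apply/esym/eqP; exact: tuple0.
by rewrite /= big_nil mul1r.
Qed.

Lemma iidS m Q : iid m.+1 Q = \sum_i pr i * iid m (fun s => Q (i :: s)).
Proof.
rewrite /iid (sum_tuple_cons _ (fun s => (\prod_(i <- s) pr i) * Q s)).
apply: eq_bigr => i _; rewrite mulr_sumr; apply: eq_bigr => s _.
by rewrite big_cons mulrA.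
Qed.

Lemma iid_cst m c : iid m (fun=> c) = c.
Proof.
elim: m => [|m IH]; first by rewrite iid0.
by rewrite iidS IH -mulr_suml pr_sum mul1r.
Qed.

Lemma iidD m Q Q' : iid m (fun s => Q s + Q' s) = iid m Q + iid m Q'.
Proof. by rewrite /iid -big_split; apply: eq_bigr => s _; rewrite mulrDr. Qed.

Lemma iidZ m c Q : iid m (fun s => c * Q s) = c * iid m Q.
Proof. by rewrite /iid mulr_sumr; apply: eq_bigr => s _; rewrite mulrCA. Qed.

Lemma le_iid m Q Q' : (forall s, size s = m -> Q s <= Q' s) -> iid m Q <= iid m Q'.
Proof.
move=> QQ; apply: ler_sum => s _; apply: ler_wpM2l; last by rewrite QQ ?size_tuple.
by apply: prodr_ge0.
Qed.

Lemma iid_sum m h : \sum_i pr i * h i = 0 -> iid m (fun s => \sum_(i <- s) h i) = 0.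
Proof.
move=> h0; elim: m => [|m IH]; first by rewrite iid0 big_nil.
rewrite iidS -[RHS]h0; apply: eq_bigr => i _; congr (_ * _).
transitivity (iid m (fun s => h i + \sum_(j <- s) h j)).
  by apply: eq_bigr => s _; rewrite big_cons.
by rewrite iidD iid_cst IH addr0.
Qed.

Lemma iid_variance m h : \sum_i pr i * h i = 0 ->
  iid m (fun s => (\sum_(i <- s) h i) ^+ 2) = m%:R * \sum_i pr i * h i ^+ 2.
Proof.
move=> h0; elim: m => [|m IH]; first by rewrite iid0 big_nil expr0n mul0r.
rewrite iidS -natr1 mulrDl mul1r -IH addrC.
transitivity (\sum_i (pr i * h i ^+ 2 + pr i * iid m (fun s => (\sum_(j <- s) h j) ^+ 2))).
  apply: eq_bigr => i _; rewrite -mulrDr; congr (_ * _).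
  transitivity (iid m (fun s => (h i ^+ 2 + 2 * h i * \sum_(j <- s) h j) + (\sum_(j <- s) h j) ^+ 2)).
    by apply: eq_bigr => s _; rewrite big_cons; congr (_ * _); ring.
  by rewrite iidD iidD iid_cst iidZ iid_sum// mulr0 addr0.
by rewrite big_split /= -mulr_suml pr_sum mul1r.
Qed.

(** From |x| <= e + x^2 / e, applied to the deviation of the mean, whose variance is at most B^2 /
    m. *)
Lemma iid_deviation m h B e : (0 < m)%N -> 0 < e -> (forall i, `|h i| <= B) ->
  iid m (fun s => `|(\sum_(i <- s) h i) / m%:R - \sum_i pr i * h i|) <=
    e + B ^+ 2 / (e * m%:R).
Proof.
move=> m0 e0 hB; set mu := \sum_i _.
pose k i := h i - mu.
have k0 : \sum_i pr i * k i = 0.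
  rewrite /k; under eq_bigr do rewrite mulrBr.
  by rewrite sumrB -mulr_suml pr_sum mul1r subrr.
have mR : 0 < m%:R :> R by rewrite ltr0n.
have var_le : \sum_i pr i * k i ^+ 2 <= B ^+ 2.
  have -> : \sum_i pr i * k i ^+ 2 = \sum_i pr i * h i ^+ 2 - mu ^+ 2.
    transitivity (\sum_i (pr i * h i ^+ 2 - 2 * mu * (pr i * h i) + mu ^+ 2 * pr i)).
      by apply: eq_bigr => i _; rewrite /k; ring.
    by rewrite big_split sumrB /= -!mulr_sumr pr_sum -/mu; ring.
  rewrite lerBlDr ler_wpDr ?sqr_ge0//.
  apply: (@le_trans _ _ (\sum_i pr i * B ^+ 2)); last by rewrite -mulr_suml pr_sum mul1r.
  apply: ler_sum => i _; apply: ler_wpM2l => //; rewrite -real_normK ?num_real//.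
  by rewrite lerXn2r ?nnegrE ?normr_ge0// (le_trans (normr_ge0 _) (hB i)).
apply: (@le_trans _ _ (iid m (fun s => e + (e^-1 / m%:R ^+ 2) * (\sum_(i <- s) k i) ^+ 2))).
  apply: le_iid => s sm.
  have -> : (\sum_(i <- s) h i) / m%:R - mu = (\sum_(i <- s) k i) / m%:R.
    have E : \sum_(i <- s) mu = mu * m%:R.
      by rewrite big_const_seq count_predT sm iter_addr_0 mulr_natr.
    by rewrite /k sumrB E mulrBl mulfK// gt_eqF.
  set y := \sum_(i <- s) k i; set x := y / m%:R.
  have -> : e^-1 / m%:R ^+ 2 * y ^+ 2 = e^-1 * x ^+ 2 by rewrite /x; field; rewrite !gt_eqF.
  rewrite -(ler_pM2l e0) mulrDr mulrA mulfV ?gt_eqF// mul1r -[x ^+ 2]real_normK ?num_real//.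
  by have := sqr_ge0 (`|x| - e); have := normr_ge0 x; move: (`|x|) => z; rewrite !expr2; nra.
rewrite iidD iid_cst iidZ iid_variance// lerD2l.
have -> : e^-1 / m%:R ^+ 2 * (m%:R * \sum_i pr i * k i ^+ 2) = (\sum_i pr i * k i ^+ 2) / (e * m%:R).
  by field; rewrite !gt_eqF.
by rewrite ler_wpM2r// invr_ge0 mulr_ge0// ltW.
Qed.

Lemma iid_has m (P : pred T) c : 0 <= c -> \sum_(i | P i) pr i <= c ->
  iid m (fun s => (has P s)%:R) <= m%:R * c.
Proof.
move=> c0 Pc; elim: m => [|m IH]; first by rewrite iid0 mul0r.
rewrite iidS -natr1 mulrDl mul1r.
apply: (@le_trans _ _ (\sum_i (pr i * (m%:R * c) + (if P i then pr i else 0)))); last first.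
  by rewrite big_split /= -mulr_suml pr_sum mul1r -big_mkcond lerD2l.
apply: ler_sum => i _; case: ifP => Pi; last first.
  by rewrite addr0 ler_wpM2l// (le_trans _ IH)//; apply: le_iid => s _; rewrite /= Pi.
rewrite ler_wpDl ?mulr_ge0// -[leRHS]mulr1 ler_wpM2l// -[leRHS](iid_cst m).
by apply: le_iid => s _; case: (has _ _); rewrite ?ler0n ?lexx.
Qed.

Lemma iid_pairwise m (r : rel T) c : 0 <= c -> (forall i, \sum_(j | ~~ r i j) pr j <= c) ->
  iid m (fun s => (~~ pairwise r s)%:R) <= (m * m)%:R * c.
Proof.
move=> c0 rc; elim: m => [|m IH]; first by rewrite iid0 mul0r.
apply: (@le_trans _ _ (m%:R * c + (m * m)%:R * c)); last first.
  by rewrite -mulrDl ler_wpM2r// -natrD ler_nat; lia.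
rewrite iidS; set rhs := (X in _ <= X).
have -> : rhs = \sum_i pr i * rhs by rewrite -mulr_suml pr_sum mul1r.
rewrite {}/rhs; apply: ler_sum => i _; apply: ler_wpM2l => //.
have H := @iid_has m (fun j => ~~ r i j) c c0 (rc i).
apply: (@le_trans _ _ _ _ _ _ (lerD H IH)); rewrite -iidD.
apply: le_iid => s _ /=; rewrite negb_and -has_predC.
by case: has; case: pairwise; rewrite /= ?lerDl ?lerDr ?addr0 ?add0r ?lexx ?ler01.
Qed.
End IidWords.

Lemma wallis_ge0 (R : realFieldType) m : 0 <= wallis R m.
Proof. by apply: prodr_ge0 => t _; rewrite divr_ge0. Qed.

Lemma wallis_sq_le (R : realFieldType) m : wallis R m ^+ 2 <= (2 * m + 1)%:R.
Proof.
elim: m => [|m IH]; first by rewrite /wallis big_ord0 expr1n.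
rewrite /wallis big_ord_recr -/(wallis R m) exprMn.
apply: (le_trans (ler_wpM2r (sqr_ge0 _) IH)).
rewrite expr_div_n mulrA ler_pdivrMr ?exprn_gt0 ?ltr0n ?addn_gt0 ?orbT// !expr2 -!natrM ler_nat /=; nia.
Qed.

Section NetworkConcentration.
Variables (R : realFieldType) (p : nat).
Hypothesis p_gt0 : (0 < p)%N.
Notation N := 'C(p.+1, 2).
Let pr (i : 'I_p) : R := swap_prob R p i.

Let pr_sum : \sum_i pr i = 1.
Proof. exact: sum_swap_prob. Qed.

Let pr_ge0 i : 0 <= pr i.
Proof. by rewrite /pr /swap_prob divr_ge0// mulr_ge0// wallis_ge0. Qed.

(** The squares of the two Wallis factors are at most 2i + 1 and 2(p - 1 - i) + 1, with sum 2p, so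
    their product is at most p; division by p(p + 1)/2 gives the bound. *)
Lemma swap_prob_le (i : nat) : (i < p)%N -> swap_prob R p i <= 2 / p.+1%:R.
Proof.
move=> ip; have N0 : 0 < N%:R :> R by rewrite ltr0n bin_gt0; lia.
have NE : 2 * N%:R = p.+1%:R * p%:R :> R.
  by rewrite -!natrM -mul_bin_diag bin1.
rewrite /swap_prob ler_pdivrMr// mulrAC NE [_ * p%:R]mulrC mulfK ?pnatr_eq0//.
have := wallis_sq_le R i; have := wallis_sq_le R (p.-1 - i).
have E : (2 * i + 1)%:R + (2 * (p.-1 - i) + 1)%:R = 2 * p%:R :> R.
  by rewrite -natrD -natrM; congr _%:R; lia.
have := sqr_ge0 (wallis R i - wallis R (p.-1 - i)).
move: E; move: (wallis R i) (wallis R _) (_%:R) (_%:R) (p%:R) => a b c d q; nra.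
Qed.

Let far (i j : 'I_p) := far_apart i j.

Let far_sum i : \sum_(j | ~~ far i j) pr j <= 6 / p.+1%:R.
Proof.
apply: (@le_trans _ _ (\sum_(j | ~~ far i j) 2 / p.+1%:R)).
  by apply: ler_sum => j _; apply: swap_prob_le.
rewrite sumr_const -[X in X <= _]mulr_natr.
(* Only [i] and its neighbours fail to be far from [i], whence 6 = 3 * 2. *)
have card3 : (#|[pred j | ~~ far i j]| <= 3)%N.
  rewrite cardE -(size_map val).
  apply: (@uniq_leq_size _ _ [:: i.-1; (i : nat); i.+1]).
    by rewrite map_inj_uniq ?enum_uniq//; exact: val_inj.
  move=> _ /mapP [j + ->]; rewrite mem_enum !inE /far /far_apart /=; lia.
apply: (@le_trans _ _ (2 / p.+1%:R * 3%:R)); last by rewrite mulrAC -natrM.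
by apply: ler_wpM2l; rewrite ?divr_ge0 ?ler_nat.
Qed.

Definition net_avg (G : seq 'I_p -> R) : R :=
  (\sum_(w : network p.+1) G (val (val w))) / #|{: network p.+1}|%:R.

(** The law of the prefix dominates the independent law on words with far apart letters. As both
    have mass 1, the excess there plus the mass of all other words equals the independent
    probability of the other words, and [F] is at most [B] on it. *)
Lemma net_avg_prefix_le m F B : (m <= N)%N -> (forall s, size s = m -> 0 <= F s <= B) ->
  net_avg (fun s => F (take m s)) <= iid pr m F + B * iid pr m (fun s => (~~ pairwise far s)%:R).
Proof.
move=> mN FB; rewrite /net_avg; set M : R := #|_|%:R.
pose C (s : seq 'I_p) : R := \sum_(w : network p.+1) (take m (val (val w)) == s)%:R.
have split_prefix G : \sum_(w : network p.+1) G (take m (val (val w))) = \sum_(s : m.-tuple 'I_p) C s * G s.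
  under [RHS]eq_bigr do rewrite mulr_suml.
  rewrite exchange_big; apply: eq_bigr => w _ /=.
  have szP : size (take m (val (val w))) == m.
    by rewrite size_takel ?size_tuple.
  rewrite (bigD1 (Tuple szP))//= eqxx mul1r big1 ?addr0// => s sw.
  by rewrite [_ == _](_ : _ = false) ?mul0r//; apply/negbTE; rewrite eq_sym.
have C_ge0 s : 0 <= C s by apply: sumr_ge0 => w _; case: (_ == _).
have C_sum : \sum_(s : m.-tuple 'I_p) C s = M.
  rewrite (eq_bigr (fun s : m.-tuple 'I_p => C s * 1)); last by move=> s _; rewrite mulr1.
  by rewrite -(split_prefix (fun=> 1)) sumr_const.
have ME : M = (red_words (len (stair p [::])) (stair p [::]))%:~R.
  by rewrite -card_network rmorph_nat.
have C_sep (s : m.-tuple 'I_p) : pairwise far s -> M * \prod_(i <- s) pr i <= C s.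
  move=> sfar; have ss : separated p [seq val i | i <- s].
    rewrite /separated pairwise_map; apply/andP; split; first exact: sfar.
    by apply/allP => _ /mapP [i _ ->]; exact: ltn_ord.
  rewrite ME; have := red_words_ge R ss; rewrite big_map => /le_trans; apply.
  rewrite -network_prefix// rmorph_sum /C size_tuple le_eqVlt; apply/orP; left; apply/eqP.
  by apply: eq_bigr => w _; case: (_ == _).
have M_gt0 : 0 < M by rewrite ME ltr0z red_words_gt0.
rewrite ler_pdivrMr// (split_prefix F) mulrDl.
pose q (s : seq 'I_p) := \prod_(i <- s) pr i.
have q_ge0 s : 0 <= q s by apply: prodr_ge0.
apply: (@le_trans _ _ (\sum_(s : m.-tuple 'I_p)
    (M * (q s * F s) + B * (C s - M * q s + M * (q s * (~~ pairwise far s)%:R))))).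
  apply: ler_sum => s _; have /andP [F0 F1] := FB s (size_tuple s).
  have := C_ge0 s; have := q_ge0 s; have := ltW M_gt0; have := C_sep s.
  case: (pairwise far s) => /= [/(_ isT)|_] H1 H2 H3.
    have : 0 <= (C s - M * q s) * (B - F s) by rewrite mulr_ge0// subr_ge0.
    by rewrite mulr0 mulr0 addr0; nra.
  rewrite mulr1 subrK; have : 0 <= M * (q s * F s) by rewrite !mulr_ge0.
  have : 0 <= C s * (B - F s) by rewrite mulr_ge0// subr_ge0.
  by nra.
rewrite big_split /= -!mulr_sumr big_split /= sumrB C_sum -!mulr_sumr.
have -> : \sum_(s : m.-tuple 'I_p) q s = 1.
  by rewrite -[RHS](iid_cst pr_sum m); apply: eq_bigr => s _; rewrite mulr1.
rewrite mulr1 subrr add0r le_eqVlt; apply/orP; left; apply/eqP.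
have -> : iid pr m F = \sum_(s : m.-tuple 'I_p) q s * F s by [].
have -> : iid pr m (fun s => (~~ pairwise far s)%:R) =
  \sum_(s : m.-tuple 'I_p) q s * (~~ pairwise far s)%:R by [].
by ring.
Qed.

Lemma window_deviation m k (h : 'I_p -> R) B e : (0 < m)%N -> (k + m <= N)%N -> 0 < e ->
  (forall i, `|h i| <= B) ->
  net_avg (fun s => `|(\sum_(i <- take m (drop k s)) h i) / m%:R - \sum_i pr i * h i|) <=
    e + B ^+ 2 / (e * m%:R) + 2 * B * ((m * m)%:R * (6 / p.+1%:R)).
Proof.
move=> m0 kmN e0 hB; pose F s := `|(\sum_(i <- s) h i) / m%:R - \sum_i pr i * h i|.
have -> : net_avg (fun s => F (take m (drop k s))) = net_avg (fun s => F (take m s)).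
  by rewrite /net_avg network_shift.
have mN : (m <= N)%N by rewrite (leq_trans _ kmN)// leq_addl.
have mR : 0 < m%:R :> R by rewrite ltr0n.
have B0 : 0 <= B by apply: le_trans (hB (Ordinal p_gt0)).
apply: (le_trans (@net_avg_prefix_le m F (2 * B) mN _)) => [s sm|].
  rewrite normr_ge0 /= /F mulr_natl mulr2n (le_trans (ler_normB _ _))// lerD//.
    rewrite normrM normfV (ger0_norm (ltW mR)) ler_pdivrMr//.
    apply: (le_trans (ler_norm_sum _ _ _)); rewrite -sm -sum1_size natr_sum mulr_sumr.
    by apply: ler_sum => i _; rewrite mulr1.
  apply: (le_trans (ler_norm_sum _ _ _)); rewrite -[leRHS]mul1r -{1}pr_sum mulr_suml.
  by apply: ler_sum => i _; rewrite normrM (ger0_norm (pr_ge0 i)) ler_wpM2l.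
apply: lerD; first exact: iid_deviation.
apply: ler_wpM2l; first by rewrite mulr_ge0.
by apply: iid_pairwise => //; rewrite divr_ge0.
Qed.

End NetworkConcentration.

(** * From windows to averages over all times *)

Section BlockAverages.
Variables (R : realFieldType) (M : R).

Lemma shifted_sum_le (F : nat -> R) N m t : (forall j, `|F j| <= M) -> (t <= m)%N -> (m <= N)%N ->
  `|\sum_(j < N) F j - \sum_(k < N - m) F (k + t)%N| <= m%:R * M.
Proof.
move=> FM tm mN.
have E : \sum_(j < N) F j = \sum_(j < t) F j + (\sum_(k < N - m) F (k + t)%N + \sum_(j < m - t) F (j + (t + (N - m)))%N).
  rewrite -!(big_mkord xpredT F) (big_cat_nat (n := t)) //=; last lia.
  congr (_ + _); rewrite (big_cat_nat (n := (t + (N - m))%N)) //=; [|lia|lia].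
  rewrite -{1}[t]add0n big_addn addKn big_mkord -{1}[(t + (N - m))%N]add0n big_addn big_mkord.
  by congr (_ + _); have -> : (N - (t + (N - m)) = m - t)%N by lia.
have -> : \sum_(j < N) F j - \sum_(k < N - m) F (k + t)%N =
    \sum_(j < t) F j + \sum_(j < m - t) F (j + (t + (N - m)))%N by rewrite E; ring.
rewrite (le_trans (ler_normD _ _)) // -[leRHS](_ : t%:R * M + (m - t)%:R * M = _); last by rewrite -mulrDl -natrD subnKC.
rewrite lerD //.
all: rewrite (le_trans (ler_norm_sum _ _ _)) // (le_trans (ler_sum _ (fun i _ => FM _))) //.
all: by rewrite sumr_const card_ord mulr_natl.
Qed.

Lemma block_sum_le (F : nat -> R) N m : (forall j, `|F j| <= M) -> (0 < m)%N -> (m <= N)%N ->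
  `|\sum_(j < N) F j - m%:R^-1 * \sum_(k < N - m) \sum_(t < m) F (k + t)%N| <= m%:R * M.
Proof.
move=> FM m0 mN; have m0' : 0 < m%:R :> R by rewrite ltr0n.
have -> : \sum_(j < N) F j - m%:R^-1 * \sum_(k < N - m) \sum_(t < m) F (k + t)%N =
   m%:R^-1 * \sum_(t < m) (\sum_(j < N) F j - \sum_(k < N - m) F (k + t)%N).
  rewrite sumrB sumr_const card_ord mulrBr exchange_big /= -[(\sum_(j < N) F j) *+ m]mulr_natl mulKf //.
  by rewrite gt_eqF.
rewrite normrM ger0_norm ?invr_ge0 ?ler0n // ler_pdivrMl //.
apply: (le_trans (ler_norm_sum _ _ _)).
apply: (@le_trans _ _ (\sum_(t < m) m%:R * M)).
  by apply: ler_sum => t _; apply: shifted_sum_le => //; have := ltn_ord t; lia.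
by rewrite sumr_const card_ord [leRHS]mulr_natl.
Qed.
End BlockAverages.

Lemma network_gt0 p : (0 < #|{: network p.+1}|)%N.
Proof. by have := red_words_gt0 (stair p [::]); rewrite -card_network ltr0n. Qed.

Section NetworkAverages.
Variables (R : realFieldType) (p : nat).
Hypothesis p_gt0 : (0 < p)%N.
Notation N := 'C(p.+1, 2).

Lemma le_net_avg (G G' : seq 'I_p -> R) : (forall s, size s = N -> G s <= G' s) ->
  net_avg G <= net_avg G'.
Proof.
move=> GG; rewrite /net_avg ler_wpM2r ?invr_ge0 ?ler0n //.
by apply: ler_sum => w _; apply: GG; rewrite size_tuple.
Qed.

Lemma net_avgD (G G' : seq 'I_p -> R) : net_avg (fun s => G s + G' s) = net_avg G + net_avg G'.
Proof. by rewrite /net_avg -mulrDl -big_split. Qed.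

Lemma net_avg_cst (c : R) : net_avg (fun _ : seq 'I_p => c) = c.
Proof.
by rewrite /net_avg sumr_const -[c *+ _]mulr_natr mulfK // pnatr_eq0 -lt0n network_gt0.
Qed.

Lemma net_avgZ (c : R) (G : seq 'I_p -> R) : net_avg (fun s => c * G s) = c * net_avg G.
Proof. by rewrite /net_avg -mulr_sumr mulrA. Qed.

Lemma net_avg_sum (I : finType) (G : I -> seq 'I_p -> R) :
  net_avg (fun s => \sum_i G i s) = \sum_i net_avg (G i).
Proof. by rewrite /net_avg exchange_big mulr_suml. Qed.

Lemma take_drop_sum (h : 'I_p -> R) (i0 : 'I_p) s k m : (k + m <= size s)%N ->
  \sum_(i <- take m (drop k s)) h i = \sum_(t < m) h (nth i0 s (k + t)).
Proof.
move=> km; rewrite (big_nth i0) size_takel ?size_drop ?leq_subRL //; last by lia.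
rewrite big_mkord; apply: eq_bigr => t _.
by rewrite nth_take // nth_drop.
Qed.

(** The sum over times is replaced by a sum of window averages. The ends cost 2 M m / N, freezing
    the time in [G] within a window costs [d], and the remaining terms are the mean deviation in one
    window, which linearity of the average carries over to all of them. *)
Lemma network_average (G : nat -> 'I_p -> R) (i0 : 'I_p) (M d e : R) m :
  (forall k i, `|G k i| <= M) -> (0 < m)%N -> (m <= N)%N -> 0 < e ->
  (forall k t i, (t < m)%N -> `|G (k + t)%N i - G k i| <= d) ->
  net_avg (fun s => `|N%:R^-1 * \sum_(k < N) G k (nth i0 s k) -
                      N%:R^-1 * \sum_(k < N) \sum_(i < p) swap_prob R p i * G k i|) <=
    2 * M * m%:R / N%:R + d + (e + M ^+ 2 / (e * m%:R) + 2 * M * ((m * m)%:R * (6 / p.+1%:R))).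
Proof.
move=> GM m0 mN e0 Gd.
have N0 : 0 < N%:R :> R by rewrite ltr0n bin_gt0; lia.
have m0' : 0 < m%:R :> R by rewrite ltr0n.
set D := e + _ + _.
pose Q k := \sum_(i < p) swap_prob R p i * G k i.
pose dev k s := `|(\sum_(i <- take m (drop k s)) G k i) / m%:R - Q k|.
have M0 : 0 <= M by apply: le_trans (GM 0%N i0).
have d0 : 0 <= d by apply: le_trans (Gd 0%N 0%N i0 m0).
have QM k : `|Q k| <= M.
  rewrite /Q (le_trans (ler_norm_sum _ _ _)) // -[leRHS]mul1r -(sum_swap_prob R p_gt0) mulr_suml.
  apply: ler_sum => i _; have P0 : 0 <= swap_prob R p i.
    by rewrite /swap_prob divr_ge0 // mulr_ge0 // wallis_ge0.
  by rewrite normrM (ger0_norm P0) ler_wpM2l.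
apply: (@le_trans _ _ (net_avg (fun s => (2 * M * m%:R / N%:R + d) +
    N%:R^-1 * \sum_(k < N - m) dev k s))); last first.
  rewrite net_avgD net_avg_cst lerD2l net_avgZ net_avg_sum ler_pdivrMl //.
  have D0 : 0 <= D.
    have e1 := ltW e0; rewrite /D !addr_ge0 //. 
      by apply: divr_ge0; [exact: sqr_ge0|exact: mulr_ge0].
    by apply: mulr_ge0; apply: mulr_ge0 => //; exact: divr_ge0.
  apply: (@le_trans _ _ ((N - m)%:R * D)); last by rewrite ler_wpM2r // ler_nat leq_subr.
  rewrite mulr_natl -[X in _ *+ X]card_ord -sumr_const; apply: ler_sum => k _.
  by apply: (window_deviation p_gt0 m0 _ e0 (GM k)); have := ltn_ord k; lia.
apply: le_net_avg => s sN.
pose F j := G j (nth i0 s j).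
have B1 := @block_sum_le R M F N m (fun j => GM _ _) m0 mN.
have B2 : `|m%:R^-1 * \sum_(k < N - m) \sum_(t < m) F (k + t)%N -
    \sum_(k < N - m) (\sum_(i <- take m (drop k s)) G k i) / m%:R| <= N%:R * d.
  rewrite mulr_sumr -sumrB (le_trans (ler_norm_sum _ _ _)) //.
  apply: (@le_trans _ _ (\sum_(k < N - m) d)); last first.
    by rewrite sumr_const card_ord -[d *+ _]mulr_natl ler_wpM2r // ler_nat leq_subr.
  apply: ler_sum => k _; rewrite (take_drop_sum _ i0); last by rewrite sN; have := ltn_ord k; lia.
  rewrite [X in _ - X]mulrC -mulrBr normrM ger0_norm ?invr_ge0 ?ler0n // ler_pdivrMl // -sumrB.
  rewrite (le_trans (ler_norm_sum _ _ _)) // mulr_natl -[X in _ *+ X]card_ord -sumr_const.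
  by apply: ler_sum => t _; exact: Gd.
have B3 : `|\sum_(k < N - m) (\sum_(i <- take m (drop k s)) G k i) / m%:R - \sum_(k < N - m) Q k| <=
    \sum_(k < N - m) dev k s by rewrite -sumrB ler_norm_sum.
have B4 : `|\sum_(k < N) Q k - \sum_(k < N - m) Q k| <= m%:R * M.
  have := @shifted_sum_le R M Q N m 0 QM (leq0n _) mN.
  by under [X in `|_ - X|]eq_bigr do rewrite addn0.
rewrite -mulrBr normrM ger0_norm ?invr_ge0 ?ler0n // ler_pdivrMl // !mulrDr mulVKf ?gt_eqF //.
have -> : N%:R * (2 * M * m%:R / N%:R) = 2 * (m%:R * M) by field; rewrite gt_eqF.
rewrite -/Q -/F.
move: B1 B2 B3 B4; rewrite !ler_norml => /andP[? ?] /andP[? ?] /andP[? ?] /andP[? ?].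
apply/andP; split; lra.
Qed.
End NetworkAverages.

From mathcomp Require Import all_classical all_reals all_analysis.
From mathcomp Require Import measurable_realfun.

Import numFieldNormedType.Exports.

Local Open Scope classical_set_scope.
Local Open Scope ring_scope.

(** * The semicircle law *)

Lemma Rintegral_oscillation d (T : measurableType d) (R : realType)
    (mu : {measure set T -> \bar R}) (A : set T) (f : T -> R) (m c e : R) :
  measurable A -> mu A = m%:E -> measurable_fun A f ->
  (forall x, A x -> `|f x - c| <= e) ->
  `|\int[mu]_(x in A) f x - c * m| <= e * m.
Proof.
move=> mA muA mf osc.
have cst_m k : \int[mu]_(x in A) (cst k) x = k * m by rewrite Rintegral_cst // muA.
have intA (g : T -> R) (M : R) : measurable_fun A g -> (forall x, A x -> `|g x| <= M) -> mu.-integrable A (EFin \o g).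
  move=> mg gM; apply: measurable_bounded_integrable => //; first by rewrite muA ltry.
  exists M; split; first exact: num_real.
  by move=> K MK x /gM; move/le_trans; apply; exact: ltW.
have intf : mu.-integrable A (EFin \o f).
  apply: (intA _ (`|c| + e)) => // x /osc fe.
  by rewrite -(subrK c (f x)) addrC (le_trans (ler_normD _ _)) // lerD2l.
have intc k : mu.-integrable A (EFin \o cst k) by apply: (intA _ `|k|).
have H1 : \int[mu]_(x in A) f x <= (c + e) * m.
  rewrite -cst_m; apply: le_Rintegral => // x /osc.
  rewrite ler_norml /= => /andP[]; lra.
have H2 : (c - e) * m <= \int[mu]_(x in A) f x.
  rewrite -cst_m; apply: le_Rintegral => // x /osc.
  rewrite ler_norml /= => /andP[]; lra.
rewrite ler_norml; apply/andP; split; lra.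
Qed.

Section Semicircle.
Context (R : realType).
Let mu := @lebesgue_measure R.

(** Outside the interval the argument of the root is at most 0, where [Num.sqrt] is 0. *)
Lemma semi_pdfE (y : R) : semi_pdf y = 2 / pi * Num.sqrt (1 - y ^+ 2).
Proof.
rewrite /semi_pdf indicE mem_setE in_itv /=.
have [y1|y1] := boolP (-1 < y < 1); first by rewrite mulr1.
rewrite mulr0; suff -> : Num.sqrt (1 - y ^+ 2) = 0 by rewrite mulr0.
apply: ler0_sqrtr; move: y1; rewrite negb_and -!leNgt => /orP[]; nra.
Qed.

Lemma continuous_sqrt_circle : continuous (fun y : R => Num.sqrt (1 - y ^+ 2)).
Proof.
move=> y; apply: (@continuous_comp _ _ _ (fun y : R => 1 - y ^+ 2)); last exact: sqrt_continuous.
by apply: cvgB; [exact: cvg_cst|exact: exprn_continuous].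
Qed.

Lemma integral_sqrt_circle :
  (\int[mu]_(y in `[(-1)%R, 1%R]) (Num.sqrt (1 - y ^+ 2))%:E = (pi / 2 : R)%:E)%E.
Proof.
have pi0 := @pi_gt0 R.
have ab : - (pi / 2) < pi / 2 :> R by lra.
have d1 : derive1 (@sin R) = @cos R.
  by apply/funext => x; rewrite derive1E; apply: derive_val.
have csin x : derivable (@sin R) x 1 by apply: ex_derive.
have -> : `[(-1)%R, 1%R]%classic = `[sin (- (pi / 2)) : R, sin (pi / 2)]%classic.
  by rewrite sinN sin_pihalf.
rewrite (@integration_by_substitution_increasing _ sin (fun y : R => Num.sqrt (1 - y ^+ 2))); first last.
- by apply: continuous_subspaceT; exact: continuous_sqrt_circle.
- split.
  + by move=> x _; exact: csin.
  + by apply: cvg_at_right_filter; exact: continuous_sin.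
  + by apply: cvg_at_left_filter; exact: continuous_sin.
- rewrite d1; apply/cvg_ex; exists (cos (pi/2) : R); apply: cvg_at_left_filter; exact: continuous_cos.
- rewrite d1; apply/cvg_ex; exists (cos (-(pi/2)) : R); apply: cvg_at_right_filter; exact: continuous_cos.
- by rewrite d1 => x _; exact: continuous_cos.
- by move=> x y xi yi xy; rewrite ltr_sin.
- exact: ltW.
transitivity (\int[mu]_(x in `[(- (pi/2))%R, (pi/2)%R]) ((cos x ^+ 2)%:E))%E.
  apply: eq_integral => x; rewrite inE /= in_itv /= => /andP[x1 x2].
  rewrite d1 /= /GRing.mul/= -cos2sin2 sqrtr_sqr ger0_norm ?expr2 //.
  by apply: cos_ge0_pihalf; rewrite x1.
(* An antiderivative of the squared cosine. *)
pose F (t : R) := (t + sin t * cos t) / 2.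
have dF (x : R) : is_derive x (1 : R) F (cos x ^+ 2).
  apply: is_derive_eq; rewrite /GRing.scale /=.
  have := cos2Dsin2 x; nra.
have cF : continuous F.
  by move=> x; apply: differentiable_continuous; apply/derivable1_diffP; apply: ex_derive.
rewrite (@continuous_FTC2 _ _ F) //.
- rewrite /F sinN cosN sin_pihalf cos_pihalf -EFinB; congr EFin; lra.
- apply: continuous_subspaceT => x; apply: (@continuous_comp _ _ _ cos (fun y : R => y ^+ 2)); first exact: continuous_cos.
  exact: exprn_continuous.
- split.
  + by move=> x _; apply: ex_derive.
  + by apply: cvg_at_right_filter; exact: cF.
  + by apply: cvg_at_left_filter; exact: cF.
- by move=> x _; rewrite derive1E; apply: derive_val.
Qed.

(** The squared difference of two roots is at most the difference of their squares, here z^2 - y^2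
    up to sign, which is at most 2 (z - y) in absolute value. *)
Lemma sqrt_circle_modulus (y z e : R) : -1 <= y -> y <= z -> z <= 1 -> z - y <= e ->
  `|Num.sqrt (1 - y ^+ 2) - Num.sqrt (1 - z ^+ 2)| <= Num.sqrt (2 * e).
Proof.
move=> y1 yz z1 zy.
set a := Num.sqrt _; set b := Num.sqrt (1 - z ^+ 2).
have a0 : 0 <= a by apply: sqrtr_ge0.
have b0 : 0 <= b by apply: sqrtr_ge0.
have a2 : a ^+ 2 = 1 - y ^+ 2 by rewrite sqr_sqrtr //; nra.
have b2 : b ^+ 2 = 1 - z ^+ 2 by rewrite sqr_sqrtr //; nra.
rewrite -ler_sqr ?nnegrE ?sqrtr_ge0 //; rewrite sqr_sqrtr; last nra.
rewrite real_normK ?num_real //.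
have : `|a ^+ 2 - b ^+ 2| <= 2 * e.
  rewrite a2 b2 ler_norml; apply/andP; split; nra.
rewrite ler_norml => /andP[H1 H2].
have [ab|ba] := leP a b; nra.
Qed.

Let mpdf : measurable_fun setT (@semi_pdf R).
Proof.
have -> : @semi_pdf R = (fun y => 2 / pi * Num.sqrt (1 - y ^+ 2)) by apply/funext => y; rewrite semi_pdfE.
apply: continuous_measurable_fun => y; apply: cvgM; [exact: cvg_cst|exact: continuous_sqrt_circle].
Qed.

Lemma semi_itv : @semi R `]-1, 1] = 1%E.
Proof.
rewrite /semi /density integral_itv_obnd_cbnd; last exact/measurable_EFinP/measurable_funTS.
transitivity (\int[mu]_(y in `[(-1)%R, 1%R]) ((2 / pi)%:E * (Num.sqrt (1 - y ^+ 2))%:E))%E.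
  by apply: eq_integral => y _; rewrite semi_pdfE EFinM.
rewrite ge0_integralZl //=.
- rewrite integral_sqrt_circle -EFinM; congr EFin.
  have := @pi_gt0 R; move=> ?; field; lra.
- apply/measurable_EFinP/measurable_funTS.
  by apply: continuous_measurable_fun; exact: continuous_sqrt_circle.
- by rewrite lee_fin divr_ge0 ?pi_ge0.
Qed.

Lemma semi_out : @semi R (~` `]-1, 1]) = 0%E.
Proof.
rewrite /semi /density; apply: integral0_eq => y /= /negP; rewrite in_itv /= => y1.
rewrite semi_pdfE ler0_sqrtr ?mulr0 //.
move: y1; rewrite negb_and -!leNgt -ltNge => /orP[]; nra.
Qed.

Lemma lebesgue_measure_itvoc (a b : R) : a <= b -> @lebesgue_measure R `]a, b] = (b - a)%:E.
Proof.
rewrite le_eqVlt => /predU1P[->|ab]; first by rewrite set_itvoc0 measure0 subrr.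
by have := lebesgue_measure_itv `]a, b]; rewrite /= lte_fin ab -EFinB => <-.
Qed.

Lemma Leb_itv (a b : R) : 0 <= a -> a <= b -> b <= 1 -> @Leb R `]a, b] = (b - a)%:E.
Proof.
move=> a0 ab b1; rewrite /Leb /density.
transitivity (\int[mu]_(x in `]a, b]) (cst 1%:E) x)%E.
  apply: eq_integral => x; rewrite inE /= in_itv /= => /andP[x1 x2].
  rewrite indicE mem_set //= in_itv /=; apply/andP; split; lra.
by rewrite integral_cst // mul1e; exact: lebesgue_measure_itvoc.
Qed.

Lemma Leb_out : @Leb R (~` `]0, 1]) = 0%E.
Proof.
rewrite /Leb /density.
rewrite integral_indic //; last exact: measurableC.
apply/eqP; rewrite -measure_le0 -(lebesgue_measure_set1 (0 : R)).
apply: le_measure; rewrite ?inE //; first by apply: measurableI => //; exact: measurableC.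
move=> x [/=]; rewrite !in_itv /= => /andP[x0 x1] /negP; rewrite x1 andbT -leNgt => x0'.
by apply/eqP; rewrite eq_le x0 x0'.
Qed.

Lemma semi_cell (a b : R) : -1 <= a -> a <= b -> b <= 1 ->
  `|fine (@semi R `]a, b]) - (b - a) * semi_pdf b| <= (b - a) * (2 / pi * Num.sqrt (2 * (b - a))).
Proof.
move=> a1 ab b1; rewrite /semi /density.
set e := 2 / pi * _.
have pi0 := @pi_gt0 R.
have osc y : `]a, b]%classic y -> `|semi_pdf y - semi_pdf b| <= e.
  rewrite /= in_itv /= => /andP[ay yb].
  rewrite !semi_pdfE -mulrBr normrM ger0_norm ?divr_ge0 ?pi_ge0 // ler_wpM2l ?divr_ge0 ?pi_ge0 //.
  by apply: sqrt_circle_modulus; lra.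
have := Rintegral_oscillation _ (lebesgue_measure_itvoc ab) (measurable_funTS mpdf) osc.
by rewrite [_ * (b - a)]mulrC [e * _]mulrC; apply.
Qed.
End Semicircle.

(** This serves twice: for Riemann sums of the limit measure, and with [e] = 0 for a function of the
    random network, which is constant on each of finitely many events. *)
Lemma Rintegral_step d (T : measurableType d) (R : realType)
    (mu : {measure set T -> \bar R}) (I : finType) (C : I -> set T)
    (m c : I -> R) (f : T -> R) (M e : R) :
  measurable_fun setT f -> (forall x, `|f x| <= M) -> (mu setT < +oo)%E ->
  (forall i, measurable (C i)) -> trivIset setT C ->
  (forall i, mu (C i) = (m i)%:E) -> mu (~` \big[setU/set0]_i C i) = 0%E ->
  (forall i x, C i x -> `|f x - c i| <= e) ->
  `|\int[mu]_x f x - \sum_i c i * m i| <= e * \sum_i m i.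
Proof.
move=> mf fM muT mC tC muC muD osc.
set D := \big[setU/set0]_i C i in muD.
have mD : measurable D by apply: bigsetU_measurable.
have intf : mu.-integrable setT (EFin \o f).
  apply: measurable_bounded_integrable => //.
  exists M; split; first exact: num_real.
  by move=> K MK x _; apply: (le_trans (fM x)); exact: ltW.
have intC i : mu.-integrable (C i) (EFin \o f) by apply: integrableS intf.
have -> : \int[mu]_x f x = \sum_i \int[mu]_(x in C i) f x.
  rewrite /Rintegral (negligible_integral (N := ~` D)) //; last exact: measurableC.
  rewrite setDE setCK setTI /D integral_bigsetU_EFin //.
  - rewrite (eq_bigr (fun i => (\int[mu]_(x in C i) f x)%:E)) => [|i _].
      by rewrite sumEFin.
    by rewrite fineK // integrable_fin_num.
  - exact: index_enum_uniq.
  - exact: sub_trivIset tC.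
  - by apply/measurable_EFinP; exact: measurable_funTS.
rewrite -sumrB mulr_sumr; apply: (le_trans (ler_norm_sum _ _ _)); apply: ler_sum => i _.
apply: Rintegral_oscillation => //; [exact: measurable_funTS|exact: osc].
Qed.

(** * Riemann sums for the limit measure *)

Section Grid.
Context (R : realType) (a h : R).

(** Closed on the right, because times k/N and heights 2s/n - 1 are right ends of grid cells. *)
Definition cell (i : nat) : set R := `]a + i%:R * h, a + i.+1%:R * h].

Lemma trivIset_cell n : trivIset setT (fun i : 'I_n => cell i).
Proof.
apply/trivIsetP => i j _ _ /eqP ij; apply/seteqP; split => // x [] /=.
have {}ij : nat_of_ord i <> j by move=> /val_inj.
rewrite /cell /= !in_itv /= => /andP[x1 x2] /andP[x3 x4].
have [lij|lij|//] := ltngtP i j.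
- have : (i.+1%:R : R) <= j%:R by rewrite ler_nat. nra.
- have : (j.+1%:R : R) <= i%:R by rewrite ler_nat. nra.
Qed.

Lemma cell_cover n x : 0 < h -> a < x <= a + n%:R * h -> exists i : 'I_n, cell i x.
Proof.
move=> h0; elim: n => [|n IH] /andP[x1 x2]; first by move: x2; rewrite mul0r addr0 leNgt x1.
have [xn|xn] := leP x (a + n%:R * h).
  have [|i ci] := IH; first by rewrite x1.
  by exists (widen_ord (leqnSn n) i).
by exists ord_max; rewrite /cell /= in_itv /= xn.
Qed.

Lemma bigsetU_cell n : 0 < h ->
  \big[setU/set0]_(i < n) cell i = `]a, a + n%:R * h]%classic.
Proof.
move=> h0; rewrite -bigcup_seq; apply/seteqP; split => x.
  move=> [i _]; rewrite /cell /= !in_itv /= => /andP[x1 x2].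
  have : (i.+1%:R : R) <= n%:R by rewrite ler_nat.
  have : (0 : R) <= i%:R by rewrite ler0n.
  by move=> ? ?; apply/andP; split; nra.
rewrite /= in_itv /= => xn.
have [i ci] : exists i : 'I_n, cell i x by apply: cell_cover.
by exists i; rewrite //= mem_index_enum.
Qed.
End Grid.

Lemma bigsetU_prod (I J : finType) S T (A : I -> set S) (B : J -> set T) :
  \big[setU/set0]_(p : I * J) (A p.1 `*` B p.2) =
  (\big[setU/set0]_i A i) `*` (\big[setU/set0]_j B j).
Proof.
rewrite -!bigcup_seq; apply/seteqP; split => [[x y] /=|[x y] /= [[i _ Ai] [j _ Bj]]].
  by move=> [[i j] _ /= [Ax By]]; split; [exists i|exists j] => //=; rewrite mem_index_enum.
by exists (i, j) => //=; rewrite mem_index_enum.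
Qed.

Section LebSemi.
Context (R : realType).

Definition semi_mass n i : R := fine (@semi R (cell (-1) (2 / n%:R) i)).

Lemma semi_massE n i : @semi R (cell (-1) (2 / n%:R) i) = (semi_mass n i)%:E.
Proof. by rewrite /semi_mass fineK // fin_num_measure //; exact: measurable_itv. Qed.

Lemma semi_mass_ge0 n i : 0 <= semi_mass n i.
Proof. by rewrite /semi_mass fine_ge0 // measure_ge0. Qed.

Lemma cells_semi n : (0 < n)%N ->
  \big[setU/set0]_(i < n) cell (-1) (2 / n%:R) i = `](-1) : R, 1]%classic.
Proof.
move=> n0; rewrite bigsetU_cell ?divr_gt0 ?ltr0n //.
have n0' : n%:R != 0 :> R by rewrite pnatr_eq0 -lt0n.
by rewrite (_ : -1 + n%:R * (2 / n%:R) = 1 :> R) //; field.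
Qed.

Lemma cells_Leb n : (0 < n)%N ->
  \big[setU/set0]_(i < n) cell 0 n%:R^-1 i = `](0 : R), 1]%classic.
Proof. by move=> n0; rewrite bigsetU_cell ?invr_gt0 ?ltr0n // add0r divff // pnatr_eq0 -lt0n. Qed.

Lemma sum_semi_mass n : (0 < n)%N -> \sum_(i < n) semi_mass n i = 1.
Proof.
move=> n0; apply: EFin_inj; rewrite -sumEFin -semi_itv -(cells_semi n0).
rewrite measure_bigsetU_ord //.
- by apply: eq_bigr => i _; rewrite -semi_massE.
- by move=> i; exact: measurable_itv.
- exact: trivIset_cell.
Qed.

Lemma Leb_cell n (i : 'I_n) : @Leb R (cell 0 n%:R^-1 i) = (n%:R^-1)%:E.
Proof.
have n0 : (0 : R) < n%:R by rewrite ltr0n (leq_trans _ (ltn_ord i)).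
rewrite /cell !add0r Leb_itv; first by congr EFin; rewrite -mulrBl -natrB // subSnn mul1r.
- by rewrite divr_ge0.
- by rewrite ler_pM2r ?invr_gt0 // ler_nat.
- by rewrite ler_pdivrMr // mul1r ler_nat.
Qed.

Lemma Leb_semi_step (f : R * R -> R) (M e : R) (q n : nat) :
  measurable_fun setT f -> (forall z, `|f z| <= M) -> (0 < q)%N -> (0 < n)%N ->
  (forall x x' y y' : R, `|x - x'| <= q%:R^-1 -> `|y - y'| <= 2 / n%:R -> `|f (x, y) - f (x', y')| <= e) ->
  `|\int[Leb_semi R]_z f z -
     q%:R^-1 * \sum_(k < q) \sum_(i < n) semi_mass n i * f (k.+1%:R / q%:R, 2 * i.+1%:R / n%:R - 1)| <= e.
Proof.
move=> mf fM q0 n0 osc.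
have q0' : q%:R != 0 :> R by rewrite pnatr_eq0 -lt0n.
have n0' : n%:R != 0 :> R by rewrite pnatr_eq0 -lt0n.
pose C (p : 'I_q * 'I_n) := cell (0:R) q%:R^-1 p.1 `*` cell (-1 : R) (2 / n%:R) p.2.
pose m (p : 'I_q * 'I_n) := q%:R^-1 * semi_mass n p.2.
pose c (p : 'I_q * 'I_n) := f (p.1.+1%:R / q%:R, 2 * p.2.+1%:R / n%:R - 1).
have sum_m : \sum_p m p = 1.
  rewrite /m -(pair_bigA _ (fun (_ : 'I_q) (i : 'I_n) => q%:R^-1 * semi_mass n i)) /= sumr_const card_ord.
  by rewrite -mulr_sumr sum_semi_mass // mulr1 -(mulr_natr _^-1) mulVf.
have := @Rintegral_step _ _ R (Leb_semi R) _ C m c f M e mf fM.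
rewrite sum_m mulr1.
have -> : \sum_p c p * m p = q%:R^-1 * \sum_(k < q) \sum_(i < n) semi_mass n i * f (k.+1%:R / q%:R, 2 * i.+1%:R / n%:R - 1).
  rewrite pair_bigA /= mulr_sumr; apply: eq_bigr => p _; rewrite /c /m; ring.
apply.
- have -> : Leb_semi R setT = (@Leb R setT * @semi R setT)%E.
    by rewrite -setXTT; exact: product_measure1E.
  by rewrite lte_mul_pinfty // ?fin_num_measure // -ge0_fin_numE // fin_num_measure.
- by move=> p; apply: measurableX; exact: measurable_itv.
- apply/trivIsetP => -[k i] [k' i'] _ _ ne; apply/seteqP; split => // -[x y] [] [/= Cx Cy] [/= Cx' Cy'].
  case/eqP: ne; congr pair.
    by apply: (@trivIset_cell R 0 q%:R^-1 q k k') => //; exists x.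
  by apply: (@trivIset_cell R (-1) (2 / n%:R) n i i') => //; exists y.
- move=> p; rewrite /C /=.
  transitivity (@Leb R (cell 0 q%:R^-1 p.1) * @semi R (cell (-1) (2 / n%:R) p.2))%E.
    by apply: product_measure1E; exact: measurable_itv.
  by rewrite Leb_cell semi_massE.
- have -> : \big[setU/set0]_p C p = (\big[setU/set0]_(k < q) cell (0:R) q%:R^-1 k) `*` (\big[setU/set0]_(i < n) cell (-1 : R) (2 / n%:R) i).
    exact: (bigsetU_prod (fun k : 'I_q => cell (0:R) q%:R^-1 k)).
  rewrite cells_semi // cells_Leb //.
  have sub : ~` (`](0 : R), 1] `*` `](-1 : R), 1]) `<=`
      (~` `](0 : R), 1] `*` [set: R]) `|` ([set: R] `*` ~` `](-1 : R), 1]).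
    move=> [x y] /= H; have [x01|x01] := pselect (`]0, 1]%classic x); last by left.
    by right; split=> // y01; apply: H.
  have nullL : Leb_semi R (~` `](0 : R), 1] `*` [set: R]) = 0%E.
    transitivity (@Leb R (~` `]0%R, 1%R]) * @semi R setT)%E; last by rewrite Leb_out mul0e.
    by apply: product_measure1E => //; exact: measurableC.
  have nullR : Leb_semi R ([set: R] `*` ~` `](-1 : R), 1]) = 0%E.
    transitivity (@Leb R setT * @semi R (~` `](-1)%R, 1%R]))%E; last by rewrite semi_out mule0.
    by apply: product_measure1E => //; exact: measurableC.
  apply: (subset_measure0 _ _ sub).
  - by apply: measurableC; exact: measurableX.
  - by apply: measurableU; apply: measurableX => //; exact: measurableC.
  - apply: null_set_setU => //; by apply: measurableX => //; exact: measurableC.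
- move=> [k i] [x y] [/=]; rewrite /cell /= !in_itv /= => /andP[x1 x2] /andP[y1 y2].
  have E1 : k.+1%:R = k%:R + 1 :> R by rewrite natr1.
  have E2 : i.+1%:R = i%:R + 1 :> R by rewrite natr1.
  have q1 : 0 <= q%:R^-1 :> R by [].
  have n1 : 0 <= 2 / n%:R :> R by [].
  rewrite /c; apply: osc => /=.
    rewrite ler_norml; apply/andP; split; move: x1 x2; rewrite E1; nra.
  rewrite (_ : 2 * i.+1%:R / n%:R - 1 = (-1) + i.+1%:R * (2 / n%:R)); last by ring.
  rewrite ler_norml; apply/andP; split; move: y1 y2; rewrite E2; nra.
Qed.
End LebSemi.

(** * Asymptotics of the law of one swap *)

Section SwapProbAsymptotics.
Context (R : realType).

Definition wallis_ratio (m : nat) : R := wallis R m / Num.sqrt m.+1%:R.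

Lemma wallis_ratio_ge0 m : 0 <= wallis_ratio m.
Proof. by rewrite divr_ge0 ?wallis_ge0 ?sqrtr_ge0. Qed.

Lemma wallis_ratioE m : wallis R m = wallis_ratio m * Num.sqrt m.+1%:R.
Proof. by rewrite /wallis_ratio divfK // sqrtr_eq0 -ltNge ltr0n. Qed.

Lemma wallis_ratio_le2 m : wallis_ratio m <= 2.
Proof.
rewrite -ler_sqr ?nnegrE ?wallis_ratio_ge0 //.
rewrite /wallis_ratio expr_div_n sqr_sqrtr ?ler0n // ler_pdivrMr ?ltr0n //.
apply: (le_trans (wallis_sq_le _ _)).
by rewrite -(natrX _ 2 2) -natrM ler_nat; lia.
Qed.

(** The squared step amounts to (2m + 3)^2 >= 4(m + 1)(m + 2). *)
Lemma wallis_ratio_nondecreasing : nondecreasing_seq wallis_ratio.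
Proof.
apply/nondecreasing_seqP => m.
rewrite -ler_sqr ?nnegrE ?wallis_ratio_ge0 // /wallis_ratio !expr_div_n !sqr_sqrtr ?ler0n //.
have -> : wallis R m.+1 = wallis R m * ((2 * m + 3)%:R / (2 * m + 2)%:R).
  by rewrite /wallis big_ord_recr.
have W : 0 <= wallis R m ^+ 2 by rewrite sqr_ge0.
rewrite exprMn -[leRHS]mulrA; apply: ler_wpM2l => //; rewrite expr_div_n.
have p2 : 0 < (2 * m + 2)%:R ^+ 2 :> R by rewrite exprn_gt0 // ltr0n; lia.
rewrite ler_pdivlMr ?ltr0n // mulrC ler_pdivrMr ?ltr0n // mulrAC ler_pdivlMr //.
by rewrite -!natrX -!natrM ler_nat; lia.
Qed.

Lemma cvg_wallis_ratio : exists g : R, wallis_ratio @ \oo --> g.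
Proof.
apply/cvg_ex; apply: nondecreasing_is_cvgn; first exact: wallis_ratio_nondecreasing.
by exists 2 => _ [m _ <-]; exact: wallis_ratio_le2.
Qed.

Definition height (p i : nat) : R := 2 * i.+1%:R / p.+1%:R - 1.
Definition arc (p i : nat) : R := Num.sqrt (1 - height p i ^+ 2).

Lemma arc_ge0 p i : 0 <= arc p i. Proof. exact: sqrtr_ge0. Qed.

Lemma arc_le1 p i : arc p i <= 1.
Proof. by rewrite -[leRHS]sqrtr1 ler_wsqrtr // gerBl sqr_ge0. Qed.

Lemma arc_last p : arc p p = 0.
Proof. by rewrite /arc /height mulfK ?pnatr_eq0 // (_ : 1 - (2 - 1) ^+ 2 = 0 :> R) ?sqrtr0 //; ring. Qed.

(** At height y the identity 1 - y^2 = 4(i + 1)(p - i)/(p + 1)^2 is exact, so the two square roots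
    combine into the semicircle. *)
Lemma swap_prob_arc p i : (i < p)%N ->
  swap_prob R p i = wallis_ratio i * wallis_ratio (p.-1 - i) * arc p i / p%:R.
Proof.
move=> ip; have p0 : (0 < p)%N by case: p ip.
have p0' : p%:R != 0 :> R by rewrite pnatr_eq0 -lt0n.
have n0' : p.+1%:R != 0 :> R by rewrite pnatr_eq0.
rewrite /swap_prob !wallis_ratioE.
have -> : (p.-1 - i).+1 = (p - i)%N by lia.
have -> : 'C(p.+1, 2)%:R = p.+1%:R * p%:R / 2 :> R.
  have : 2 * 'C(p.+1, 2)%:R = p.+1%:R * p%:R :> R by rewrite -!natrM -mul_bin_diag bin1.
  by move=> <-; rewrite [2 * _]mulrC mulfK.
have -> : arc p i = 2 / p.+1%:R * (Num.sqrt i.+1%:R * Num.sqrt (p - i)%:R).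
  rewrite -sqrtrM ?ler0n // /arc -[X in X * _]ger0_norm ?divr_ge0 // -sqrtr_sqr -sqrtrM ?sqr_ge0 //.
  congr Num.sqrt; rewrite /height natrB; last by lia.
  have Ep : p.+1%:R = p%:R + 1 :> R by rewrite natr1.
  have Ei : i.+1%:R = i%:R + 1 :> R by rewrite natr1.
  by move: n0'; rewrite Ep Ei => n0'; field.
by field; rewrite p0' addrC natr1.
Qed.

Lemma semi_mass_arc p i : (i <= p)%N ->
  `|semi_mass R p.+1 i - 4 / (pi * p.+1%:R) * arc p i| <= 4 / (pi * p.+1%:R) * Num.sqrt (4 / p.+1%:R).
Proof.
move=> ip; have n0' : p.+1%:R != 0 :> R by rewrite pnatr_eq0.
have pi0 := @pi_gt0 R; have pi0' : pi != 0 :> R by lra.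
have top : -1 + i.+1%:R * (2 / p.+1%:R) = height p i by rewrite /height; ring.
have i1 : (i.+1%:R : R) <= p.+1%:R by rewrite ler_nat.
have n0 : 0 < p.+1%:R :> R by rewrite ltr0n.
have i0 : (0 : R) <= i%:R by [].
have h0 : 0 < 2 / p.+1%:R :> R by rewrite divr_gt0.
have E : i.+1%:R = i%:R + 1 :> R by rewrite natr1.
have := @semi_cell R (-1 + i%:R * (2 / p.+1%:R)) (-1 + i.+1%:R * (2 / p.+1%:R)).
rewrite -/(semi_mass R p.+1 i) top.
have -> : height p i - (-1 + i%:R * (2 / p.+1%:R)) = 2 / p.+1%:R by rewrite -top E; ring.
rewrite semi_pdfE -/(arc p i).
have -> : 2 * (2 / p.+1%:R) = 4 / p.+1%:R :> R by ring.
have cst (c P : R) : P != 0 -> 2 / p.+1%:R * (2 / P * c) = 4 / (P * p.+1%:R) * c.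
  by move=> P0; field; rewrite addrC natr1 n0' P0.
rewrite !cst //; apply.
- by rewrite lerDl mulr_ge0 // ltW.
- by rewrite -top lerD2l ler_wpM2r ?ler_nat // ltW.
- by rewrite /height lerBlDr ler_pdivrMr //; lra.
Qed.

(** [Y] and [Z] are multiples of one profile, so their l^1 distance is the difference of their sums.
    Both sums are near 1: [Y] is within 4A of the law of a swap and [Z] within [b] of the semicircle
    masses. Here A is a mean of |wallis_ratio - g|, and 4A comes from |uv - g^2| <= 2|u - g| + 2|v -
    g|. *)
Lemma swap_prob_semi_le (g : R) p : (0 < p)%N -> 0 <= g <= 2 ->
  \sum_(i < p) `|swap_prob R p i - semi_mass R p.+1 i| + semi_mass R p.+1 p <=
  8 * (p%:R^-1 * \sum_(i < p) `|wallis_ratio i - g|) + 2 * (4 / pi * Num.sqrt (4 / p.+1%:R)).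
Proof.
move=> p0 /andP[g0 g2]; have pi0 := @pi_gt0 R.
have p0' : 0 < p%:R :> R by rewrite ltr0n.
have n0' : 0 < p.+1%:R :> R by rewrite ltr0n.
set A := p%:R^-1 * _; set b := 4 / pi * _.
pose Y i := g ^+ 2 / p%:R * arc p i; pose Z i := 4 / (pi * p.+1%:R) * arc p i.
have XY : \sum_(i < p) `|swap_prob R p i - Y i| <= 4 * A.
  pose dev i := `|wallis_ratio i - g|.
  have -> : 4 * A = \sum_(i < p) p%:R^-1 * (2 * dev i + 2 * dev (p.-1 - i)%N).
    have H : \sum_(i < p) dev (p.-1 - i)%N = \sum_(i < p) dev i.
      rewrite (reindex_inj rev_ord_inj) /=; apply: eq_bigr => i _; congr dev.
      have := ltn_ord i; lia.
    by rewrite -mulr_sumr big_split /= -!mulr_sumr H /A /dev; ring.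
  apply: ler_sum => i _; rewrite (swap_prob_arc (ltn_ord i)) /Y.
  set u := wallis_ratio i; set v := wallis_ratio (p.-1 - i).
  have -> : u * v * arc p i / p%:R - g ^+ 2 / p%:R * arc p i = p%:R^-1 * ((u * v - g ^+ 2) * arc p i).
    by ring.
  rewrite normrM ger0_norm ?invr_ge0 // ler_wpM2l ?invr_ge0 //.
  rewrite normrM (ger0_norm (arc_ge0 p i)) (le_trans (ler_piMr _ (arc_le1 p i))) //.
  have -> : u * v - g ^+ 2 = v * (u - g) + g * (v - g) by ring.
  rewrite (le_trans (ler_normD _ _)) // lerD // normrM ler_wpM2r //.
  - by rewrite ger0_norm ?wallis_ratio_ge0 ?wallis_ratio_le2.
  - by rewrite ger0_norm.
have WZ : \sum_(i < p.+1) `|semi_mass R p.+1 i - Z i| <= b.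
  apply: (@le_trans _ _ (\sum_(i < p.+1) p.+1%:R^-1 * b)).
    apply: ler_sum => i _; have ip : (i <= p)%N by have := ltn_ord i; lia.
    apply: (le_trans (semi_mass_arc ip)); rewrite /b.
    by rewrite [leRHS]mulrC invfM mulrA mulrAC.
  by rewrite sumr_const card_ord -[X in X <= _]mulr_natl mulrA divff ?mul1r // pnatr_eq0.
have sumW := sum_semi_mass R (ltn0Sn p).
have Zp : Z p = 0 by rewrite /Z arc_last mulr0.
have devY : `|1 - \sum_(i < p) Y i| <= 4 * A.
  by rewrite -[X in X - _](sum_swap_prob R p0) -sumrB (le_trans (ler_norm_sum _ _ _)).
have devZ : `|1 - \sum_(i < p) Z i| <= b.
  have -> : \sum_(i < p) Z i = \sum_(i < p.+1) Z i by rewrite big_ord_recr /= Zp addr0.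
  by rewrite -[X in X - _]sumW -sumrB (le_trans (ler_norm_sum _ _ _)).
have YZ : \sum_(i < p) `|Y i - Z i| <= 4 * A + b.
  have -> : \sum_(i < p) `|Y i - Z i| = `|\sum_(i < p) Y i - \sum_(i < p) Z i|.
    rewrite -!mulr_sumr -mulrBl normrM [in RHS](@ger0_norm _ (\sum_(i < p) _)); last first.
      by apply: sumr_ge0 => i _; exact: arc_ge0.
    rewrite mulr_sumr; apply: eq_bigr => i _.
    by rewrite /Y /Z -mulrBl normrM (ger0_norm (arc_ge0 p i)).
  move: devY devZ; rewrite !ler_norml => /andP[? ?] /andP[? ?]; apply/andP; split; lra.
have XW : \sum_(i < p) `|swap_prob R p i - semi_mass R p.+1 i| <=
    \sum_(i < p) `|swap_prob R p i - Y i| + \sum_(i < p) `|Y i - Z i| +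
    \sum_(i < p) `|semi_mass R p.+1 i - Z i|.
  rewrite -!big_split /=; apply: ler_sum => i _.
  rewrite (le_trans (ler_distD (Z i) _ _)) // (distrC (Z i)) lerD2r.
  exact: ler_distD.
move: WZ; rewrite big_ord_recr /= Zp subr0 (ger0_norm (semi_mass_ge0 _ _ _)); lra.
Qed.

Lemma cvg_swap_prob_semi (e : R) : 0 < e ->
  \forall p \near \oo,
    \sum_(i < p) `|swap_prob R p i - semi_mass R p.+1 i| + semi_mass R p.+1 p <= e.
Proof.
move=> e0; have [g cg] := cvg_wallis_ratio; have pi0 := @pi_gt0 R.
have g02 : 0 <= g <= 2.
  apply/andP; split.
    by apply: (cvgr_to_ge cg); apply: nearW => m; exact: wallis_ratio_ge0.
  by apply: (cvgr_to_le cg); apply: nearW => m; exact: wallis_ratio_le2.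
have /cesaro cm : (fun i => `|wallis_ratio i - g|) @ \oo --> (0 : R).
  rewrite -[X in _ --> X](normr0 R) -(subrr g); apply: cvg_norm; apply: cvgB => //; exact: cvg_cst.
have e16 : 0 < e / 16 by lra.
have [k _ mk] := (cvgr0Pnorm_le _).1 cm _ e16.
(* Once 4 / (p + 1) is at most [c], the semicircle error is at most 2 (e / 4); the Cesaro mean costs
   8 (e / 16). *)
pose c := (e * pi / 16) ^+ 2.
have c0 : 0 < c by rewrite exprn_gt0 // divr_gt0 // mulr_gt0.
near=> p.
have p0 : (0 < p)%N by near: p; exists 1%N.
apply: (le_trans (swap_prob_semi_le p0 g02)).
have H1 : p%:R^-1 * \sum_(i < p) `|wallis_ratio i - g| <= e / 16.
  have pk : (k < p)%N by near: p; exists k.+1.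
  have := mk p.-1; rewrite /= /arithmetic_mean /series /= prednK // big_mkord => H.
  by apply: le_trans (ler_norm _) (H _); lia.
have H2 : 4 / pi * Num.sqrt (4 / p.+1%:R) <= e / 4.
  have : Num.sqrt (4 / p.+1%:R) <= e * pi / 16.
    rewrite -(ger0_norm (_ : 0 <= e * pi / 16)); last by rewrite divr_ge0 // mulr_ge0 // ltW.
    rewrite -sqrtr_sqr -/c ler_wsqrtr // ler_pdivrMr ?ltr0n //.
    rewrite -ler_pdivrMl // (@le_trans _ _ p%:R) ?ler_nat //.
    near: p; exact: nbhs_infty_ger.
  rewrite -(ler_pM2l (_ : 0 < 4 / pi)); last by rewrite divr_gt0.
  move/le_trans; apply; rewrite le_eqVlt; apply/orP; left; apply/eqP.
  by move: (pi) pi0 => P P0; field; lra.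
lra.
Unshelve. all: by end_near.
Qed.
End SwapProbAsymptotics.

(** * Vague topology *)

Section Vague.
Context (R : realType).

Lemma cvg_vague (G : set_system (lfmeasure R)) (nu : lfmeasure R) : Filter G ->
  (forall f : @Cc R, (fun mu : lfmeasure R => vague_ev mu f) @ G --> vague_ev nu f) ->
  G --> nu.
Proof.
move=> FG H.
(* the image of G, spelled out because [fmap] does not fit its universe *)
pose VG : set_system (prod_topology (fun _ : @Cc R => R)) := fun A => G (@vague_ev R @^-1` A).
have FVG : Filter VG.
  split; first exact: filterT.
  - by move=> A B GA GB; exact: filterI.
  - by move=> A B AB; apply: filterS => mu; exact: AB.
have cv : VG --> (vague_ev nu : prod_topology (fun _ : @Cc R => R)).
  apply/cvg_sup => f A [_ [[U oU <-] /= Uf]] UA.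
  apply: (@filterS _ VG _ _ _ UA).
  by apply: (H f U); exact: open_nbhs_nbhs.
move=> A [_ [[U oU <-] /= Unu]] UA; apply: filterS UA _.
by apply: cv; exact: open_nbhs_nbhs.
Qed.

Lemma Cc_bounded (f : R * R -> R) : Cc f -> exists2 M, 0 < M & forall z, `|f z| <= M.
Proof.
move=> [cf cK]; set K := closure _ in cK.
have /compact_bounded [M [Mr HM]] : compact (f @` K).
  by apply: continuous_compact => //; exact: continuous_subspaceT.
exists (`|M| + 1) => [|z]; first by rewrite ltr_wpDl.
have [Kz|Kz] := pselect (K z).
  by apply: (HM (`|M| + 1)); [have := ler_norm M; lra|exists z].
have -> : f z = 0.
  by apply/eqP; apply: contrapT => fz; apply: Kz; apply: subset_closure; apply/negP.
by rewrite normr0 addr_ge0.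
Qed.

(** Compactness gives one [d] for all points of the support, with no restriction on the second
    point. If neither point lies in the support, both values are 0. *)
Lemma Cc_uniformly_continuous (f : R * R -> R) e : Cc f -> 0 < e ->
  exists2 d, 0 < d & forall x x' y y', `|x - x'| <= d -> `|y - y'| <= d ->
    `|f (x, y) - f (x', y')| <= e.
Proof.
move=> [cf cK] e0; set K := closure _ in cK.
pose close (d : R) (z z' : R * R) := `|z.1 - z'.1| <= d /\ `|z.2 - z'.2| <= d.
have closeC d z z' : close d z z' -> close d z' z by rewrite /close distrC (distrC z.2).
have : \forall d \near (0 : R)^'+, K `<=` [set z | forall z', close d z z' -> `|f z - f z'| <= e].
  have /compact_near_coveringP cover := cK.
  apply: (cover R (0 : R)^'+ (fun d z => forall z', close d z z' -> `|f z - f z'| <= e)) => z _.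
  have e2 : 0 < e / 2 by rewrite divr_gt0.
  have /cvgrPdist_le /(_ _ e2) := cf z.
  rewrite -nbhs_ballE => -[r /= r0 Hr].
  have r2 : 0 < r / 2 by rewrite divr_gt0.
  near=> z' d => z'' [c1 c2].
  have dr : d < r / 2 by near: d; exact: nbhs_right_lt.
  have [b1 b2] : ball z (r / 2) z' by near: z'; exact: nbhsx_ballx.
  have H1 : `|f z - f z'| <= e / 2.
    have rr : r / 2 <= r by lra.
    by apply: Hr; split; [apply: (lt_le_trans b1 rr)|apply: (lt_le_trans b2 rr)].
  have H2 : `|f z - f z''| <= e / 2.
    apply: Hr; split; rewrite /= /ball /=.
      rewrite -(subrKA z'.1) (le_lt_trans (ler_normD _ _)) //.
      by rewrite (splitr r) ltr_leD // (le_trans c1) // ltW.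
    rewrite -(subrKA z'.2) (le_lt_trans (ler_normD _ _)) //.
    by rewrite (splitr r) ltr_leD // (le_trans c2) // ltW.
  rewrite -(subrKA (f z)) (le_trans (ler_normD _ _)) // (splitr e) lerD // distrC //.
move=> nearK.
have [d [Hd d0]] : exists d, K `<=` [set z | forall z', close d z z' -> `|f z - f z'| <= e] /\ 0 < d.
  near (0 : R)^'+ => d; exists d; split; first by near: d.
  by near: d; exact: nbhs_right_gt.
exists d => // x x' y y' xx yy.
have c : close d (x, y) (x', y') by split.
have out z : ~ K z -> f z = 0.
  by move=> Kz; apply/eqP; apply: contrapT => fz; apply: Kz; apply: subset_closure; apply/negP.
have [K1|K1] := pselect (K (x, y)); first exact: Hd.
have [K2|K2] := pselect (K (x', y')); first by rewrite distrC; apply: Hd => //; exact: closeC.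
by rewrite !out // subrr normr0 ltW.
Unshelve. all: by end_near. Qed.

(** An open set is the union of the countably many rational boxes it contains, and boxes belong to
    the product sigma-algebra. *)
Lemma open_measurable_plane (U : set (R * R)) : open U -> measurable U.
Proof.
move=> oU; pose box (q : (rat * rat) * (rat * rat)) : set (R * R) :=
  `]ratr q.1.1, ratr q.1.2[ `*` `]ratr q.2.1, ratr q.2.2[.
have -> : U = \bigcup_q (if `[< box q `<=` U >] then box q else set0).
  apply/seteqP; split => [z Uz|z [q _]]; last by case: asboolP => // sub /sub.
  have : nbhs z U by exact: open_nbhs_nbhs.
  rewrite -nbhs_ballE => -[r /= r0 rU].
  have rat_between (x : R) : exists a b, x - r < ratr a < x /\ x < ratr b < x + r.
    have [|a] := @rat_in_itvoo R (x - r) x; first lra.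
    have [|b] := @rat_in_itvoo R x (x + r); first lra.
    by rewrite !in_itv /= => xb xa; exists a, b.
  have [a [b [/andP[a1 a2] /andP[b1 b2]]]] := rat_between z.1.
  have [c [d [/andP[c1 c2] /andP[d1 d2]]]] := rat_between z.2.
  exists ((a, b), (c, d)) => //; rewrite asboolT.
    by split; rewrite /= in_itv /= ?a2 ?b1 ?c2 ?d1.
  move=> [x y] [/=]; rewrite !in_itv /= => /andP[x1 x2] /andP[y1 y2]; apply: rU.
  by split; rewrite /= /ball /= ltr_norml; apply/andP; split; lra.
apply: countable_bigcupT_measurable; first exact: countableP.
move=> q; case: asboolP => // _; apply: measurableX; exact: measurable_itv.
Qed.

Lemma Cc_measurable (f : R * R -> R) : Cc f -> measurable_fun setT f.
Proof.
move=> [/continuousP cf _]; apply: (measurability _ (RGenOpens.measurableE R)).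
move=> _ [_ [a [b ->] <-]]; rewrite setTI; apply: open_measurable_plane.
exact/cf/interval_open.
Qed.

Lemma integral_eta n (w : network n) (f : R * R -> R) : measurable_fun setT f ->
  \int[eta R w]_z f z = 'C(n, 2)%:R^-1 * \sum_(k < 'C(n, 2)) f (swap_point R w k.+1).
Proof.
move=> mf; rewrite /Rintegral integralE.
have mEf : measurable_fun setT (EFin \o f) by exact/measurable_EFinP.
have pos (g : R * R -> \bar R) (r : R * R -> R) : (forall z, g z = (r z)%:E) -> (forall z, 0 <= r z) ->
    measurable_fun setT g ->
    (\int[eta R w]_z g z = ('C(n, 2)%:R^-1 * \sum_(k < 'C(n, 2)) r (swap_point R w k.+1))%:E)%E.
  move=> gr r0 mg.
  have g0 z : setT z -> (0 <= g z)%E by rewrite gr lee_fin.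
  transitivity (('C(n, 2)%:R^-1)%:E * \int[msum (fun k => \d_(swap_point R w k.+1)) 'C(n, 2)]_z g z)%E.
    exact: ge0_integral_mscale.
  rewrite ge0_integral_measure_sum // EFinM -sumEFin; congr (_ * _)%E.
  by apply: eq_bigr => k _; rewrite integral_dirac // diracT mul1e gr.
rewrite (pos _ (fun z => Num.max (f z) 0)) //; last first.
- exact: measurable_funepos.
- by move=> z; rewrite le_max lexx orbT.
- by move=> z; rewrite unlock EFin_max.
rewrite (pos _ (fun z => Num.max (- f z) 0)) //; last first.
- exact: measurable_funeneg.
- by move=> z; rewrite le_max lexx orbT.
- by move=> z; rewrite unlock EFin_max EFinN.
rewrite -EFinB /= -mulrBr -sumrB; congr (_ * _); apply: eq_bigr => k _.
by case: (leP (f _) 0) => H; case: leP => H'; lra.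
Qed.

End Vague.

(** * Convergence of the swap process *)

Section Mean.
Context (R : realType).

Lemma swap_point_height p (i0 : 'I_p) (w : network p.+1) (k : nat) : (k < 'C(p.+1, 2))%N ->
  swap_point R w k.+1 = (k.+1%:R / 'C(p.+1, 2)%:R, height R p (nth i0 (val (val w)) k)).
Proof.
by move=> kN; rewrite /swap_point /swap_loc /= (nth_map i0) ?size_tuple.
Qed.

(** The grid has [p.+1] cells for [p] locations; the mass of the top cell is an error of its own. *)
Lemma semi_swap_prob_le (p q : nat) (G : nat -> nat -> R) M : (0 < q)%N ->
  (forall k i, `|G k i| <= M) ->
  `|q%:R^-1 * \sum_(k < q) \sum_(i < p) swap_prob R p i * G k i -
    q%:R^-1 * \sum_(k < q) \sum_(i < p.+1) semi_mass R p.+1 i * G k i| <=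
  M * (\sum_(i < p) `|swap_prob R p i - semi_mass R p.+1 i| + semi_mass R p.+1 p).
Proof.
move=> q0 GM; have q0' : 0 < q%:R :> R by rewrite ltr0n.
set D := _ + semi_mass _ _ _.
rewrite -mulrBr normrM ger0_norm ?invr_ge0 // ler_pdivrMl // -sumrB.
rewrite (le_trans (ler_norm_sum _ _ _)) // mulr_natl -[X in _ *+ X]card_ord -sumr_const.
apply: ler_sum => k _; rewrite big_ord_recr /= opprD addrA -sumrB.
rewrite (le_trans (ler_normB _ _)) // /D mulrDr lerD //; last first.
  by rewrite normrM (ger0_norm (semi_mass_ge0 _ _ _)) mulrC ler_wpM2r ?semi_mass_ge0.
rewrite (le_trans (ler_norm_sum _ _ _)) // mulr_sumr; apply: ler_sum => i _.
by rewrite -mulrBl normrM mulrC ler_wpM2r.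
Qed.

Lemma cvg_mean_deviation (f : R * R -> R) e : Cc f -> 0 < e ->
  \forall p \near \oo,
    (\sum_(w : network p.+1) `|\int[eta R w]_z f z - \int[Leb_semi R]_z f z|) /
      #|{: network p.+1}|%:R <= e.
Proof.
move=> Cf e0; have mf := Cc_measurable Cf.
have [M M0 fM] := Cc_bounded Cf.
(* Seven errors occur: five in [network_average], one from the law of a swap and one from the
   Riemann sum. *)
have e8 : 0 < e / 8 by rewrite divr_gt0.
have [d d0 fd] := Cc_uniformly_continuous Cf e8.
(* The window length depends on [M] and [e] alone, so every error that grows with [m] is beaten by
   [p]. *)
have [m m0 Hm] : exists2 m : nat, (0 < m)%N & M ^+ 2 / (e / 8 * m%:R) <= e / 8.
  have [k _ Hk] := nbhs_infty_ger (M ^+ 2 / (e / 8) / (e / 8)).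
  exists k.+1 => //; have := Hk _ (leqnSn k).
  by rewrite /= ler_pdivrMr // ler_pdivrMr // ler_pdivrMr ?mulr_gt0 ?ltr0n //; lra.
have e8M : 0 < e / 8 / M by rewrite divr_gt0.
have m0' : 0 < m%:R :> R by rewrite ltr0n.
near=> p.
have p0 : (0 < p)%N by near: p; exists 1%N.
have p0' : 0 < p%:R :> R by rewrite ltr0n.
pose i0 : 'I_p := Ordinal p0.
set N := 'C(p.+1, 2).
have pN : (p <= N)%N by rewrite /N binS bin1 leq_addl.
have N0 : (0 < N)%N by apply: leq_trans pN.
have N0' : 0 < N%:R :> R by rewrite ltr0n.
have big (c a : R) : 0 < a -> 0 <= c -> c / a <= p%:R -> c / N%:R <= a /\ c / p.+1%:R <= a.
  move=> a0 c0; rewrite ler_pdivrMr // => cp.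
  rewrite !ler_pdivrMr ?ltr0n //; split; apply: (le_trans cp); rewrite mulrC ler_wpM2l ?ler_nat //; exact: ltW.
have mN : (m <= N)%N by apply: leq_trans pN; near: p; exists m.
have H1 : m%:R / N%:R <= d.
  by apply: (big _ _ d0 (ltW m0') _).1; near: p; exact: nbhs_infty_ger.
have H2 : 2 * M * m%:R / N%:R <= e / 8.
  apply: (big _ _ e8 _ _).1; first by rewrite !mulr_ge0 // ltW.
  by near: p; exact: nbhs_infty_ger.
have H3 : 2 * M * ((m * m)%:R * (6 / p.+1%:R)) <= e / 8.
  rewrite !mulrA; apply: (big _ _ e8 _ _).2; first by rewrite !mulr_ge0 // ltW.
  by near: p; exact: nbhs_infty_ger.
have H4 : 2 / p.+1%:R <= d.
  by apply: (big _ _ d0 _ _).2 => //; near: p; exact: nbhs_infty_ger.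
have H5 : N%:R^-1 <= d.
  rewrite -[leLHS]mul1r; apply: (big _ _ d0 _ _).1 => //; near: p; exact: nbhs_infty_ger.
have H6 : \sum_(i < p) `|swap_prob R p i - semi_mass R p.+1 i| + semi_mass R p.+1 p <= e / 8 / M.
  by near: p; exact: cvg_swap_prob_semi.
pose G k i := f (k.+1%:R / N%:R, height R p i).
have GM k i : `|G k i| <= M by exact: fM.
pose S (s : seq 'I_p) := N%:R^-1 * \sum_(k < N) G k (nth i0 s k).
pose A := N%:R^-1 * \sum_(k < N) \sum_(i < p) swap_prob R p i * G k i.
pose B := N%:R^-1 * \sum_(k < N) \sum_(i < p.+1) semi_mass R p.+1 i * G k i.
set L := \int[Leb_semi R]_z f z.
have AB : `|A - B| <= e / 8.
  apply: (le_trans (semi_swap_prob_le p N0 GM)).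
  by rewrite mulrC -ler_pdivlMr.
have BL : `|L - B| <= e / 8.
  apply: (@Leb_semi_step R f M) => // x x' y y' xx yy.
  by apply: fd; [apply: le_trans H5|apply: le_trans H4].
have avg : net_avg (fun s => `|S s - A|) <= 5 * (e / 8).
  have Gd k t (i : 'I_p) : (t < m)%N -> `|G (k + t)%N i - G k i| <= e / 8.
    move=> tm; apply: fd; last by rewrite subrr normr0 ltW.
    rewrite -mulrBl -natrB ?ltnS ?leq_addr // subSS addKn.
    by rewrite ger0_norm // (le_trans _ H1) // ler_wpM2r ?invr_ge0 // ler_nat ltnW.
  have := network_average p0 i0 (fun k (i : 'I_p) => GM k i) m0 mN e8 Gd.
  have -> : 5 * (e / 8) = e / 8 + e / 8 + (e / 8 + e / 8 + e / 8) by ring.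
  by move/le_trans; apply; rewrite !lerD.
have -> : (\sum_(w : network p.+1) `|\int[eta R w]_z f z - L|) / #|{: network p.+1}|%:R =
    net_avg (fun s => `|S s - L|).
  congr (_ / _); apply: eq_bigr => w _; congr `|_ - L|.
  rewrite integral_eta //; congr (_ * _); apply: eq_bigr => k _.
  by rewrite (swap_point_height i0).
apply: (@le_trans _ _ (net_avg (fun s => `|S s - A| + (e / 8 + e / 8)))).
  apply: le_net_avg => s _; rewrite -(subrKA A) (le_trans (ler_normD _ _)) // lerD2l.
  rewrite -(subrKA B) (le_trans (ler_normD _ _)) // lerD // distrC //.
rewrite net_avgD net_avg_cst //; lra.
Unshelve. all: by end_near. Qed.

Definition exceptional (A : set (lfmeasure R)) p : R :=
  (\sum_(w : network p.+1) (~~ `[< A (eta R w) >])%:R) / #|{: network p.+1}|%:R.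

(* Convergence along this filter is convergence in probability. *)
Definition likely : set_system (lfmeasure R) :=
  fun A => forall e, 0 < e -> \forall p \near \oo, exceptional A p <= e.

(** Markov's inequality for the uniform law on networks. *)
Lemma le_exceptional (c : R) (A : set (lfmeasure R)) p (G : network p.+1 -> R) :
  (forall w, c * (~~ `[< A (eta R w) >])%:R <= G w) ->
  c * exceptional A p <= (\sum_w G w) / #|{: network p.+1}|%:R.
Proof.
move=> cG; rewrite /exceptional mulrA ler_wpM2r ?invr_ge0 // mulr_sumr.
by apply: ler_sum => w _; exact: cG.
Qed.

Lemma likely_filter : Filter likely.
Proof.
split.
- move=> e e0; apply: nearW => p; rewrite /exceptional big1 ?mul0r ?ltW // => w _.
  by rewrite asboolT.
- move=> A B LA LB e e0; have e2 : 0 < e / 2 by rewrite divr_gt0.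
  apply: filterS2 (LA _ e2) (LB _ e2) => p Ap Bp; rewrite (splitr e).
  apply: le_trans (lerD Ap Bp); rewrite -mulrDl -big_split /= -[leLHS]mul1r.
  apply: le_exceptional => w; rewrite mul1r asbool_and negb_and.
  by do 2 case: asboolP => _ /=; rewrite ?addr0 ?add0r ?lerDl.
- move=> A B AB LA e e0; apply: filterS (LA _ e0) => p; apply: le_trans.
  rewrite -[leLHS]mul1r; apply: le_exceptional => w; rewrite mul1r ler_nat.
  by case: asboolP => // nB; case: asboolP => // /AB.
Qed.

(** Convergence in mean for each test function gives convergence in probability by Markov's
    inequality. As [likely] is a filter, [cvg_vague] passes from single test functions to the vague
    topology. *)
Lemma likely_cvg : likely --> Leb_semi R.
Proof.
have FL := likely_filter.
apply: cvg_vague => f; apply/cvgrPdist_le => d d0 e e0.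
have [f' Cf] := f.
near=> p; have H : d * exceptional [set mu | `|vague_ev (Leb_semi R) f - vague_ev mu f| <= d] p <= d * e.
  apply: (@le_trans _ _ ((\sum_(w : network p.+1)
    `|\int[eta R w]_z val f z - \int[Leb_semi R]_z val f z|) / #|{: network p.+1}|%:R)).
    apply: le_exceptional => w; case: asboolP => /= [_|]; first by rewrite mulr0.
    by move/negP; rewrite -ltNge mulr1 => /ltW; rewrite distrC.
  near: p; apply: cvg_mean_deviation; last by rewrite mulr_gt0.
  by apply: set_mem; exact: valP.
by move: H; rewrite ler_pM2l.
Unshelve. all: by end_near. Qed.

(** Likely networks have [F] within e/2 of its limit; each of the others costs at most 2B, and they
    are rare. *)
Lemma cvg_mean_eta (F : lfmeasure R -> R) : continuous F -> bounded_fun F ->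
  (\sum_(w : network p.+1) F (eta R w)) / #|{: network p.+1}|%:R @[p --> \oo] --> F (Leb_semi R).
Proof.
move=> cF [M [_ FM]]; have FL := likely_filter.
have {FM} [B B0 FB] : exists2 B, 0 < B & forall mu, `|F mu| <= B.
  exists (`|M| + 1) => [|mu]; first by rewrite ltr_wpDl.
  by apply: FM => //; have := ler_norm M; lra.
apply/cvgrPdist_le => e e0.
have e2 : 0 < e / 2 by rewrite divr_gt0.
have LF : likely [set mu | `|F (Leb_semi R) - F mu| <= e / 2].
  apply: likely_cvg.
  by have /cvgrPdist_le := cF (Leb_semi R); apply.
have eB : 0 < e / 2 / (2 * B) by rewrite divr_gt0 // mulr_gt0.
near=> p.
have n0 : 0 < #|{: network p.+1}|%:R :> R by rewrite ltr0n network_gt0.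
have E : exceptional [set mu | `|F (Leb_semi R) - F mu| <= e / 2] p <= e / 2 / (2 * B).
  by near: p; exact: LF.
set n := #|_|%:R in n0 *.
have -> : F (Leb_semi R) = (\sum_(w : network p.+1) F (Leb_semi R)) / n.
  by rewrite sumr_const -[_ *+ #|_|]mulr_natr mulfK // gt_eqF.
rewrite -mulrBl -sumrB normrM (ger0_norm (_ : 0 <= n^-1)) ?invr_ge0 ?(ltW n0) //.
apply: (@le_trans _ _ (e / 2 + 2 * B * exceptional [set mu | `|F (Leb_semi R) - F mu| <= e / 2] p)).
  rewrite /exceptional -/n mulrA -[X in X + _](mulfK (negbT (gt_eqF n0))) -mulrDl ler_wpM2r ?invr_ge0 ?(ltW n0) //.
  rewrite (le_trans (ler_norm_sum _ _ _)) // mulr_sumr.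
  rewrite [_ * n]mulr_natr -sumr_const -big_split /=; apply: ler_sum => w _.
  case: asboolP => /= [H|_]; first by rewrite mulr0 addr0.
  rewrite mulr1 (le_trans (ler_normB _ _)) //.
  by have := FB (Leb_semi R); have := FB (eta R w); move: e2; lra.
move: E; rewrite ler_pdivlMr ?mulr_gt0 // mulrC; lra.
Unshelve. all: by end_near. Qed.

(** The fibres of [omega] form a finite measurable partition into events of equal probability, on
    which [h \o omega] is constant. *)
Lemma expectation_uniform_network d (Om : measurableType d) (P : probability Om R) n
    (omega : Om -> network n) (h : network n -> R) : uniform_network P omega ->
  ('E_P[h \o omega] = ((\sum_w h w) / #|{: network n}|%:R)%:E)%E.
Proof.
move=> unif; pose C w := omega @^-1` [set w].
have mC w : measurable (C w) by have [] := unif w.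
have mh : measurable_fun setT (h \o omega).
  move=> _ Y _; rewrite setTI.
  have -> : (h \o omega) @^-1` Y = \big[setU/set0]_(w | `[< Y (h w) >]) C w.
    rewrite -bigcup_seq_cond; apply/seteqP; split => x /=.
      by move=> Yx; exists (omega x) => //=; rewrite mem_index_enum; exact/asboolP.
    by move=> [w /= /andP[_ /asboolP Yw] Cw]; rewrite /= Cw.
  exact: bigsetU_measurable.
have coverC : \big[setU/set0]_w C w = setT.
  rewrite -bigcup_seq; apply/seteqP; split => // x _; exists (omega x) => //=.
  by rewrite mem_index_enum.
have PT : (P setT < +oo)%E by rewrite probability_setT ltry.
have bh x : `|(h \o omega) x| <= \sum_w `|h w|.
  by rewrite (bigD1 (omega x)) //= lerDl sumr_ge0.
have tC : trivIset setT C.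
  apply/trivIsetP => i j _ _ /eqP ij; apply/seteqP; split => // x [] /= xi xj.
  by apply: ij; rewrite -xi.
have H := @Rintegral_step _ _ R P _ C (fun=> #|{: network n}|%:R^-1) h _ _ 0 mh bh PT mC tC.
have PC w : P (C w) = (#|{: network n}|%:R^-1)%:E by have [] := unif w.
have outC : P (~` \big[setU/set0]_w C w) = 0%E by rewrite coverC setCT measure0.
have oscC w x : C w x -> `|(h \o omega) x - h w| <= 0.
  by move=> /= <-; rewrite subrr normr0.
move: {H} (H PC outC oscC); rewrite mul0r.
rewrite normr_le0 subr_eq0 => /eqP; rewrite -mulr_suml => <-.
rewrite unlock /Rintegral fineK //; apply: integrable_fin_num => //.
apply: measurable_bounded_integrable => //.
exists (\sum_w `|h w|); split; first exact: num_real.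
by move=> K MK x _; apply: (le_trans (bh x)); exact: ltW.
Qed.
End Mean.

Theorem theorem2 (R : realType) (d : nat -> measure_display)
    (Om : forall n, measurableType (d n))
    (P : forall n, probability (Om n) R)
    (omega : forall n, Om n -> network n)
    (omega_unif : forall n, uniform_network (P n) (@omega n)) :
  cvg_in_distribution P (fun n x => eta R (omega n x))
    (\d_tt : probability unit R) (fun=> Leb_semi R).
Proof.
move=> F cF bF.
have -> : ('E_(\d_tt : probability unit R)[F \o (fun=> Leb_semi R)] = (F (Leb_semi R))%:E)%E.
  exact: expectation_cst.
have -> : (fun n => 'E_(P n)[F \o (fun x => eta R (omega n x))]%E) =
    (fun n => ((\sum_(w : network n) F (eta R w)) / #|{: network n}|%:R)%:E).
  by apply/funext => n; exact: (expectation_uniform_network (fun w => F (eta R w)) (omega_unif n)).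
apply: cvg_EFin; first by apply: nearW.
(* The limit ignores n = 0, so the networks may be taken on [p.+1] elements. *)
rewrite -cvg_shiftS; exact: cvg_mean_eta.
Qed.
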